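(* Let $x>0$. For $r,t\in\mathbb{N}\cup\{0\}$ such that $r+t\ge 1$, and $s\in\mathbb{C}$ such that $\Re(s)>2-r-t$, we have $$\begin{aligned}\Theta(r,s,t,x)=\;&\sum_{i=0}^{r-2}\frac{(-1)^i}{x^{t+i}}\binom{i+t-1}{i}\zeta(s+t+i)\,\zeta(r-i)-\frac{(-1)^r}{x^{r+t-1}}\binom{r+t-2}{t-1}\sum_{m=1}^{\infty}\frac{\gamma+\psi(mx+1)}{m^{r+s+t-1}}\\&+(-1)^r\sum_{j=0}^{t-2}\binom{j+r-1}{j}\frac{(-1)^{t-j}}{(t-j-1)!}\,\frac{1}{x^{j+r}}\sum_{m=1}^{\infty}\frac{\psi^{(t-j-1)}(mx+1)}{m^{r+s+j}},\end{aligned}$$ with the convention that $\binom{-1}{0}=1$, $\binom{c}{-1}=0$ for any $c\in\mathbb{Z}\setminus\{-1\}$, with the exception $\binom{-1}{-1}=1$.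
   Context: $\mathbb{N}=\{1,2,3,\dots\}$. For $x>0$ the generalized Mordell-Tornheim zeta function is $$\Theta(r,s,t,x)=\sum_{n=1}^{\infty}\sum_{m=1}^{\infty}\frac{1}{n^{r}m^{s}(n+mx)^{t}},$$ absolutely convergent for $(r,s,t)\in\mathbb{C}^3$ with $\Re(r+t)>1$, $\Re(s+t)>1$, $\Re(r+s+t)>2$, and continued meromorphically to $\mathbb{C}^3$. $\zeta$ is the (meromorphically continued) Riemann zeta function, $\gamma$ Euler's constant, $\psi=\Gamma'/\Gamma$ the digamma function and $\psi^{(j)}$ its $j$-th derivative. As usual, $\binom{a}{b}=0$ for integers $0\le a<b$, and empty sums are $0$.
   Formalization: The identity is asserted only where the continued Θ is holomorphic; this excludes r+t=1, where Θ has a pole while the right side is finite, and the points s+t+i=1 (0≤i≤r−2), where a factor ζ(1) makes the formula undefined. *)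

(* Defs.v *)
From Stdlib Require Import Reals ZArith List.
From Coquelicot Require Import Coquelicot.
Open Scope R_scope.

(** Sums over a family indexed by [m >= 1] are written as sequences indexed by
    [k : nat] with [m = S k]. *)

(** [a ^ z = exp (z * ln a)], meaningful for [0 < a]. *)
Definition cpow (a : R) (z : C) : C :=
  (exp (Re z * ln a) * cos (Im z * ln a), exp (Re z * ln a) * sin (Im z * ln a)).

(** [f 0 + ... + f (n - 1)]; empty for [n = 0]. *)
Definition csum (n : nat) (f : nat -> C) : C :=
  fold_right Cplus (RtoC 0) (map f (seq 0 n)).

(** Sum of a convergent complex series; like [Series], a junk value otherwise. *)
Definition CSeries (u : nat -> C) : C :=
  (Series (fun n => Re (u n)), Series (fun n => Im (u n))).

Definition ex_Cseries (u : nat -> C) : Prop :=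
  @ex_series C_AbsRing C_NormedModule u.

Definition is_Cseries (u : nat -> C) (l : C) : Prop :=
  @is_series C_AbsRing C_NormedModule u l.

(** Complex (Frechet) differentiability on a neighbourhood of [p]. *)
Definition holomorphic_at {U : NormedModule C_AbsRing} (F : U -> C) (p : U) : Prop :=
  locally p (fun q => ex_filterdiff F (locally q)).

(** [F] represents a meromorphic function on [U]: near every point it is a
    quotient of holomorphic functions whose denominator is not identically zero
    (balls are connected).  [F] is total, with arbitrary values where it is not
    determined by such a quotient; the meromorphic function has the value [F p]
    at [p] when [holomorphic_at F p]. *)
Definition meromorphic {U : NormedModule C_AbsRing} (F : U -> C) : Prop :=
  forall p : U, exists (e : posreal) (g h : U -> C),
    (forall q, ball p e q -> holomorphic_at g q /\ holomorphic_at h q) /\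
    (exists q, ball p e q /\ h q <> RtoC 0) /\
    (forall q, ball p e q -> h q <> RtoC 0 -> F q = Cdiv (g q) (h q)).

Definition MT_term (x : R) (r s t : C) (n m : nat) : C :=
  Cinv (cpow (INR n) r * cpow (INR m) s * cpow (INR n + INR m * x) t)%C.

(** [Theta] is the meromorphic continuation to [C^3] of
    [sum_(n >= 1) sum_(m >= 1) 1 / (n^r m^s (n + m x)^t)]. *)
Definition is_mordell_tornheim (x : R) (Theta : C * C * C -> C) : Prop :=
  meromorphic Theta /\
  forall r s t : C,
    1 < Re (r + t)%C -> 1 < Re (s + t)%C -> 2 < Re (r + s + t)%C ->
    exists a : nat -> C,
      (forall n, is_Cseries (fun m => MT_term x r s t (S n) (S m)) (a n)) /\
      is_Cseries a (Theta (r, s, t)).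

(** The value at the pole [1] is left arbitrary. *)
Definition is_riemann_zeta (zeta : C -> C) : Prop :=
  (forall z : C, z <> RtoC 1 -> holomorphic_at zeta z) /\
  (forall z : C, 1 < Re z -> is_Cseries (fun k => Cinv (cpow (INR (S k)) z)) (zeta z)).

Definition euler_gamma : R :=
  real (Lim_seq (fun n => sum_n (fun k => / INR (S k)) n - ln (INR (S n)))).

(** Euler's integral, for [0 < a]. *)
Definition Gamma (a : R) : R :=
  RInt_gen (fun u => Rpower u (a - 1) * exp (- u)) (at_right 0) (Rbar_locally p_infty).

Definition digamma (a : R) : R := Derive Gamma a / Gamma a.

Definition polygamma (k : nat) (a : R) : R := Derive_n digamma k a.

(** The conventions are [binom (-1) 0 = 1], [binom (-1) (-1) = 1], and
    [binom c (-1) = 0] for [c <> -1]. *)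
Definition binom (a b : Z) : R :=
  if Z.leb 0 a then
    if andb (Z.leb 0 b) (Z.leb b a) then Binomial.C (Z.to_nat a) (Z.to_nat b) else 0
  else if andb (Z.eqb a (-1)) (orb (Z.eqb b 0) (Z.eqb b (-1))) then 1
  else 0.

Definition digamma_term (x : R) (w : C) (k : nat) : C :=
  (RtoC (euler_gamma + digamma (INR (S k) * x + 1)) / cpow (INR (S k)) w)%C.

Definition polygamma_term (x : R) (i : nat) (w : C) (k : nat) : C :=
  (RtoC (polygamma i (INR (S k) * x + 1)) / cpow (INR (S k)) w)%C.

(* Main.v *)
(** The terms of the expansion of [(n + m x)^(-t)] in powers of [n / (m x)],
    summed over [m] and [n], are products of zeta values.  Once [r - 1] of them
    are subtracted, the double series converges absolutely and locally uniformly
    for [Re (r + s + t) > 2] and [(r, t)] near the given integers, so [Theta] is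
    a finite sum of zeta products plus this double series: on the region of
    convergence by rearrangement, and beyond it by uniqueness of analytic
    continuation along a segment on which [Im (s + t)] does not vanish.  Points
    with a pole of some [zeta (s + t + i)] are reached as limits from the right.
    For integers [r, t] the summand of the double series splits into partial
    fractions in [n], whose sums over [n] are the series of [gamma + psi(m x + 1)]
    and of [psi^(k)(m x + 1)].  When [r + t = 1] the point lies on the polar
    divisor and [Theta] is not holomorphic there. *)

Require Import Defs.
From Stdlib Require Import Reals ZArith Lra Lia List Classical.
From Coquelicot Require Import Coquelicot.
Open Scope R_scope.

(** * Complex differentiability *)

(** Outside the region of convergence the values of [Theta] are free wherever its local denominators
    vanish. Hence what travels along a segment is not equality near a point but equality on small
    balls arbitrarily close to it, and this becomes equality of values only where [Theta] is
    holomorphic. The analytic tool is an identity theorem on a disc, applied on complex lines, for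
    uniform limits of differentiable functions; it rests on Goursat's theorem for a rectangle in the
    logarithmic coordinate and on a concentrating kernel. Uniformity of the double series comes from
    interpolation: its Taylor remainder in [w = n / (m x)] is small like one power of [w] near 0 and
    grows at most like the previous power at infinity, so every exponent in between bounds it
    everywhere. The choice of that exponent shares the slack [Re (r + s + t) - 2] between the sums
    over [n] and over [m]. The target points have [Im t = 0], possibly [t = 0] and [s] real, so they
    need not lie in the open region of continuation; they are reached as limits along suitable
    directions. *)

Definition cderive (f : C -> C) (z l : C) : Prop :=
  forall eps : R, 0 < eps -> exists d : R, 0 < d /\
    forall w : C, Cmod w < d -> Cmod (f (z + w) - f z - l * w)%C <= eps * Cmod w.

Definition cdiff (f : C -> C) (z : C) : Prop := exists l, cderive f z l.

Definition ccont (f : C -> C) (z : C) : Prop :=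
  forall eps : R, 0 < eps -> exists d : R, 0 < d /\
    forall w : C, Cmod w < d -> Cmod (f (z + w) - f z)%C <= eps.

Lemma Cmod_triangle_minus (a b : C) : Cmod (a - b)%C <= Cmod a + Cmod b.
Proof. unfold Cminus. eapply Rle_trans. apply Cmod_triangle. rewrite Cmod_opp. lra. Qed.

Lemma cdiff_ccont (f : C -> C) (z : C) : cdiff f z -> ccont f z.
Proof.
  intros [l Hl] eps He.
  destruct (Hl 1 Rlt_0_1) as [d [Hd H]].
  (* The [+ 1] keeps the divisor positive when [l = 0]; the same device recurs wherever a norm that
     may vanish is divided by. *)
  assert (Hc : 0 < Cmod l + 1) by (pose proof (Cmod_ge_0 l); lra).
  exists (Rmin d (eps / (Cmod l + 1))). split.
  apply Rmin_pos; auto. apply Rdiv_lt_0_compat; auto.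
  intros w Hw.
  replace (f (z + w) - f z)%C with ((f (z + w) - f z - l * w) + l * w)%C by ring.
  eapply Rle_trans. apply Cmod_triangle. rewrite Cmod_mult.
  specialize (H w (Rlt_le_trans _ _ _ Hw (Rmin_l _ _))).
  assert (Hw2 : Cmod w < eps / (Cmod l + 1)) by (eapply Rlt_le_trans; [exact Hw| apply Rmin_r]).
  apply (Rmult_lt_compat_r _ _ _ Hc) in Hw2.
  unfold Rdiv in Hw2. rewrite Rmult_assoc, Rinv_l in Hw2 by lra. nra.
Qed.

Lemma cderive_ext (f g : C -> C) (z l : C) :
  (forall w, f w = g w) -> cderive f z l -> cderive g z l.
Proof.
  intros E H eps He. destruct (H eps He) as [d [Hd Hw]]. exists d. split; auto.
  intros w W. rewrite <- !E. auto.
Qed.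

Lemma cdiff_ext (f g : C -> C) (z : C) :
  (forall w, f w = g w) -> cdiff f z -> cdiff g z.
Proof. intros E [l H]. exists l. eapply cderive_ext; eauto. Qed.

Lemma cderive_const (c z : C) : cderive (fun _ => c) z 0.
Proof.
  intros eps He. exists 1. split. lra. intros w _.
  replace (c - c - 0 * w)%C with (RtoC 0) by ring. rewrite Cmod_0.
  pose proof (Cmod_ge_0 w). nra.
Qed.

Lemma cderive_affine (a b z : C) : cderive (fun w => a + w * b)%C z b.
Proof.
  intros eps He. exists 1. split. lra. intros w _.
  replace (a + (z + w) * b - (a + z * b) - b * w)%C with (RtoC 0) by ring. rewrite Cmod_0.
  pose proof (Cmod_ge_0 w). nra.
Qed.

Lemma cderive_plus (f g : C -> C) (z l m : C) :
  cderive f z l -> cderive g z m -> cderive (fun w => f w + g w)%C z (l + m)%C.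
Proof.
  intros Hf Hg eps He.
  destruct (Hf (eps / 2)) as [d1 [Hd1 H1]]. lra.
  destruct (Hg (eps / 2)) as [d2 [Hd2 H2]]. lra.
  exists (Rmin d1 d2). split. apply Rmin_pos; auto.
  intros w Hw.
  specialize (H1 w (Rlt_le_trans _ _ _ Hw (Rmin_l _ _))).
  specialize (H2 w (Rlt_le_trans _ _ _ Hw (Rmin_r _ _))).
  replace (f (z + w) + g (z + w) - (f z + g z) - (l + m) * w)%C
    with ((f (z + w) - f z - l * w) + (g (z + w) - g z - m * w))%C by ring.
  eapply Rle_trans. apply Cmod_triangle. lra.
Qed.

Lemma cderive_mult (f g : C -> C) (z l m : C) :
  cderive f z l -> cderive g z m ->
  cderive (fun w => f w * g w)%C z (l * g z + f z * m)%C.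
Proof.
  intros Hf Hg eps He.
  pose proof (Cmod_ge_0 (g z)) as Gz. pose proof (Cmod_ge_0 (f z)) as Fz.
  pose proof (Cmod_ge_0 l) as Lz.
  set (e1 := eps / 3 / (Cmod (g z) + 1)).
  set (e2 := eps / 3 / (Cmod (f z) + 1)).
  set (e3 := Rmin 1 (eps / 3 / (Cmod l + 1))).
  assert (He1 : 0 < e1) by (apply Rdiv_lt_0_compat; lra).
  assert (He2 : 0 < e2) by (apply Rdiv_lt_0_compat; lra).
  assert (He3 : 0 < e3) by (apply Rmin_pos; [lra | apply Rdiv_lt_0_compat; lra]).
  destruct (Hf e1 He1) as [d1 [Hd1 H1]].
  destruct (Hg e2 He2) as [d2 [Hd2 H2]].
  destruct (cdiff_ccont g z (ex_intro _ m Hg) e3 He3) as [d3 [Hd3 H3]].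
  exists (Rmin d1 (Rmin d2 d3)). split. repeat apply Rmin_pos; auto.
  intros w Hw.
  specialize (H1 w (Rlt_le_trans _ _ _ Hw (Rmin_l _ _))).
  specialize (H2 w (Rlt_le_trans _ _ _ Hw (Rle_trans _ _ _ (Rmin_r _ _) (Rmin_l _ _)))).
  specialize (H3 w (Rlt_le_trans _ _ _ Hw (Rle_trans _ _ _ (Rmin_r _ _) (Rmin_r _ _)))).
  replace (f (z + w) * g (z + w) - f z * g z - (l * g z + f z * m) * w)%C
    with ((f (z + w) - f z - l * w) * (g z + (g (z + w) - g z))
          + l * w * (g (z + w) - g z) + f z * (g (z + w) - g z - m * w))%C by ring.
  eapply Rle_trans. apply Cmod_triangle.
  eapply Rle_trans. apply Rplus_le_compat_r. apply Cmod_triangle.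
  rewrite !Cmod_mult.
  pose proof (Cmod_ge_0 w) as Wz.
  assert (A1 : Cmod (g z + (g (z + w) - g z))%C <= Cmod (g z) + 1).
  { eapply Rle_trans. apply Cmod_triangle. pose proof (Rmin_l 1 (eps / 3 / (Cmod l + 1))).
    fold e3 in H. lra. }
  assert (B1 : e1 * (Cmod (g z) + 1) = eps / 3) by (unfold e1; field; lra).
  assert (B2 : e2 * (Cmod (f z) + 1) = eps / 3) by (unfold e2; field; lra).
  assert (B3 : (Cmod l + 1) * e3 <= eps / 3).
  { eapply Rle_trans. apply Rmult_le_compat_l. lra. apply Rmin_r. right. field; lra. }
  assert (T1 : Cmod (f (z + w) - f z - l * w)%C * Cmod (g z + (g (z + w) - g z))%C <= eps / 3 * Cmod w).
  { eapply Rle_trans. apply Rmult_le_compat. apply Cmod_ge_0. apply Cmod_ge_0. exact H1. exact A1.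
    rewrite <- B1. right; ring. }
  assert (T2 : Cmod l * Cmod w * Cmod (g (z + w) - g z)%C <= eps / 3 * Cmod w).
  { eapply Rle_trans. apply Rmult_le_compat_l. nra. exact H3.
    replace (Cmod l * Cmod w * e3) with (Cmod l * e3 * Cmod w) by ring.
    apply Rmult_le_compat_r; auto. nra. }
  assert (T3 : Cmod (f z) * Cmod (g (z + w) - g z - m * w)%C <= eps / 3 * Cmod w).
  { eapply Rle_trans. apply Rmult_le_compat_l. lra. exact H2. rewrite <- B2. nra. }
  lra.
Qed.

Lemma cderive_comp (f g : C -> C) (z l m : C) :
  cderive g z m -> cderive f (g z) l -> cderive (fun w => f (g w)) z (l * m)%C.
Proof.
  intros Hg Hf eps He.
  pose proof (Cmod_ge_0 l) as Lz. pose proof (Cmod_ge_0 m) as Mz.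
  set (e1 := eps / 2 / (Cmod m + 1)).
  set (e2 := Rmin 1 (eps / 2 / (Cmod l + 1))).
  assert (He1 : 0 < e1) by (apply Rdiv_lt_0_compat; lra).
  assert (He2 : 0 < e2) by (apply Rmin_pos; [lra | apply Rdiv_lt_0_compat; lra]).
  destruct (Hf e1 He1) as [d1 [Hd1 H1]].
  destruct (Hg e2 He2) as [d2 [Hd2 H2]].
  exists (Rmin d2 (d1 / (Cmod m + 1))). split.
  apply Rmin_pos; auto. apply Rdiv_lt_0_compat; lra.
  intros w Hw. pose proof (Cmod_ge_0 w) as Wz.
  specialize (H2 w (Rlt_le_trans _ _ _ Hw (Rmin_l _ _))).
  assert (Hw2 : Cmod w < d1 / (Cmod m + 1)) by (eapply Rlt_le_trans; [exact Hw| apply Rmin_r]).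
  set (k := (g (z + w) - g z)%C).
  assert (Hk : Cmod k <= (Cmod m + 1) * Cmod w).
  { unfold k. replace (g (z + w) - g z)%C with ((g (z + w) - g z - m * w) + m * w)%C by ring.
    eapply Rle_trans. apply Cmod_triangle. rewrite Cmod_mult.
    pose proof (Rmin_l 1 (eps / 2 / (Cmod l + 1))). fold e2 in H. nra. }
  assert (Hk1 : Cmod k < d1).
  { eapply Rle_lt_trans. exact Hk. apply (Rmult_lt_compat_l (Cmod m + 1)) in Hw2; [|lra].
    replace ((Cmod m + 1) * (d1 / (Cmod m + 1))) with d1 in Hw2 by (field; lra). lra. }
  specialize (H1 k Hk1).
  replace (g z + k)%C with (g (z + w)%C) in H1 by (unfold k; ring).
  replace (f (g (z + w)) - f (g z) - l * m * w)%C
    with ((f (g (z + w)) - f (g z) - l * k) + l * (g (z + w) - g z - m * w))%C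
    by (unfold k; ring).
  eapply Rle_trans. apply Cmod_triangle. rewrite Cmod_mult.
  assert (T1 : e1 * Cmod k <= eps / 2 * Cmod w).
  { eapply Rle_trans. apply Rmult_le_compat_l. lra. exact Hk. right. unfold e1. field. lra. }
  assert (B3 : (Cmod l + 1) * e2 <= eps / 2).
  { eapply Rle_trans. apply Rmult_le_compat_l. lra. apply Rmin_r. right. field; lra. }
  assert (T2 : Cmod l * Cmod (g (z + w) - g z - m * w)%C <= eps / 2 * Cmod w).
  { eapply Rle_trans. apply Rmult_le_compat_l. lra. exact H2. nra. }
  lra.
Qed.

Lemma cdiff_const (c z : C) : cdiff (fun _ => c) z.
Proof. exists 0%C. apply cderive_const. Qed.

Lemma cdiff_affine (a b z : C) : cdiff (fun w => a + w * b)%C z.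
Proof. exists b. apply cderive_affine. Qed.

Lemma cdiff_plus (f g : C -> C) (z : C) :
  cdiff f z -> cdiff g z -> cdiff (fun w => f w + g w)%C z.
Proof. intros [l Hl] [m Hm]. exists (l + m)%C. apply cderive_plus; auto. Qed.

Lemma cdiff_mult (f g : C -> C) (z : C) :
  cdiff f z -> cdiff g z -> cdiff (fun w => f w * g w)%C z.
Proof. intros [l Hl] [m Hm]. eexists. apply cderive_mult; eauto. Qed.

Lemma cdiff_opp (f : C -> C) (z : C) : cdiff f z -> cdiff (fun w => - f w)%C z.
Proof.
  intros H. apply cdiff_ext with (fun w => (- RtoC 1) * f w)%C.
  intros w. ring. apply cdiff_mult; auto. apply cdiff_const.
Qed.

Lemma cdiff_minus (f g : C -> C) (z : C) :
  cdiff f z -> cdiff g z -> cdiff (fun w => f w - g w)%C z.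
Proof. intros Hf Hg. unfold Cminus. apply cdiff_plus; auto. apply cdiff_opp; auto. Qed.

Lemma cdiff_pow (f : C -> C) (z : C) (n : nat) : cdiff f z -> cdiff (fun w => f w ^ n)%C z.
Proof.
  intros Hf. induction n as [|n IH]; simpl. apply cdiff_const. apply cdiff_mult; auto.
Qed.

Lemma cdiff_comp (f g : C -> C) (z : C) :
  cdiff g z -> cdiff f (g z) -> cdiff (fun w => f (g w)) z.
Proof. intros [m Hm] [l Hl]. exists (l * m)%C. apply cderive_comp; auto. Qed.

Lemma minus_plus_cancel {G : AbelianGroup} (a b : G) : minus (plus a b) a = b.
Proof.
  unfold minus. rewrite (plus_comm a b), <- plus_assoc.
  rewrite <- (plus_zero_r b) at 2. apply f_equal. exact (plus_opp_r a).
Qed.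

(** The identity theorem is one-dimensional, so differentiability on [U] is used through
    restrictions to complex lines; the derivative along [v] is the differential applied to [v]. *)
Lemma ex_filterdiff_line {U : NormedModule C_AbsRing} (F : U -> C) (q v : U) :
  ex_filterdiff F (locally q) -> cdiff (fun z : C => F (plus q (scal z v))) 0.
Proof.
  intros [l [Hl Hd]].
  exists (l v).
  assert (Hq : is_filter_lim (locally q) q) by (intros P HP; exact HP).
  specialize (Hd q Hq).
  intros eps He.
  assert (Hv : 0 < norm v + 1) by (pose proof (norm_ge_0 v); lra).
  specialize (Hd (mkposreal (eps / (norm v + 1)) (Rdiv_lt_0_compat _ _ He Hv))).
  simpl in Hd. 
  apply (locally_norm_le_locally q) in Hd.
  destruct Hd as [[d Hdp] Hd]. simpl in Hd.
  exists (d / (norm v + 1)). split. apply Rdiv_lt_0_compat; auto.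
  intros w Hw.
  assert (Hsc : norm (scal w v) <= Cmod w * norm v) by apply (norm_scal w v).
  pose proof (Cmod_ge_0 w) as Wz. pose proof (norm_ge_0 v) as Vz.
  replace (0 + w)%C with w by ring.
  assert (E0 : plus q (scal (RtoC 0) v) = q).
  { change (RtoC 0) with (@zero C_Ring). rewrite scal_zero_l. apply plus_zero_r. }
  rewrite E0.
  assert (Em : minus (plus q (scal w v)) q = scal w v) by exact (@minus_plus_cancel (NormedModule.AbelianGroup C_AbsRing U) q (scal w v)).
  specialize (Hd (plus q (scal w v))).
  unfold ball_norm in Hd. rewrite Em in Hd.
  assert (Hlt : norm (scal w v) < d).
  { eapply Rle_lt_trans. exact Hsc. apply (Rmult_lt_compat_r (norm v + 1)) in Hw; [|lra].
    replace (d / (norm v + 1) * (norm v + 1)) with d in Hw by (field; lra). nra. }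
  specialize (Hd Hlt).
  rewrite (linear_scal l Hl) in Hd.
  eapply Rle_trans; [|eapply Rle_trans; [exact Hd|]].
  { right. match goal with |- _ = norm ?B => change (norm B) with (Cmod B) end.
    f_equal. unfold minus, plus, opp, scal; simpl. unfold mult; simpl. ring. }
  apply Rle_trans with (eps / (norm v + 1) * (Cmod w * (norm v + 1))).
  apply Rmult_le_compat_l. apply Rlt_le, Rdiv_lt_0_compat; lra. nra.
  right. field. lra.
Qed.

(** * Goursat on rectangles *)

(** The integral of [S du + P dv] around the rectangle, counterclockwise. For [P = Re F] and
    [S = Im F] it is the imaginary part of the contour integral of [F]. *)
Definition green_defect (P S : R -> R -> R) (a b c d : R) : R :=
  RInt (P b) c d - RInt (P a) c d
  - (RInt (fun u => S u d) a b - RInt (fun u => S u c) a b).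

(** The linear parts share [p], that is, [P_u = S_v]; this is all that Green's
    formula for the pair needs. *)
Definition half_CR (P S : R -> R -> R) (u0 v0 : R) : Prop :=
  exists p q s : R, forall eps, 0 < eps -> exists delta, 0 < delta /\
    forall u v, Rabs (u - u0) < delta -> Rabs (v - v0) < delta ->
      Rabs (P u v - P u0 v0 - p * (u - u0) - q * (v - v0))
        <= eps * (Rabs (u - u0) + Rabs (v - v0)) /\
      Rabs (S u v - S u0 v0 - s * (u - u0) - p * (v - v0))
        <= eps * (Rabs (u - u0) + Rabs (v - v0)).

Lemma continuous_lipschitz_at (f : R -> R) (x0 d M : R) :
  0 < d -> (forall x, Rabs (x - x0) < d -> Rabs (f x - f x0) <= M * Rabs (x - x0)) ->
  continuous f x0.
Proof.
  intros Hd H P [e He].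
  assert (HM : 0 < Rmax M 0 + 1) by (pose proof (Rmax_r M 0); lra).
  assert (Hp : 0 < Rmin d (e / (Rmax M 0 + 1))).
  { apply Rmin_pos; auto. apply Rdiv_lt_0_compat; auto. apply cond_pos. }
  exists (mkposreal _ Hp). intros x Hx. apply He.
  change (Rabs (x - x0) < Rmin d (e / (Rmax M 0 + 1))) in Hx.
  change (Rabs (f x - f x0) < e).
  assert (H1 : Rabs (x - x0) < d) by (eapply Rlt_le_trans; [exact Hx|apply Rmin_l]).
  assert (H2 : Rabs (x - x0) < e / (Rmax M 0 + 1)) by (eapply Rlt_le_trans; [exact Hx|apply Rmin_r]).
  apply (Rmult_lt_compat_l _ _ _ HM) in H2.
  replace ((Rmax M 0 + 1) * (e / (Rmax M 0 + 1))) with (pos e) in H2 by (field; lra).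
  specialize (H x H1). pose proof (Rmax_l M 0). pose proof (Rabs_pos (x - x0)). nra.
Qed.

(** Integrability along the sides asks for no more: [P] is integrated over vertical sides and [S]
    over horizontal ones. *)
Lemma half_CR_continuous (P S : R -> R -> R) (u0 v0 : R) :
  half_CR P S u0 v0 ->
  continuous (P u0) v0 /\ continuous (fun u => S u v0) u0.
Proof.
  intros [p [q [s H]]]. destruct (H 1 Rlt_0_1) as [d [Hd K]].
  split.
  - apply continuous_lipschitz_at with d (Rabs q + 1); auto.
    intros v Hv. destruct (K u0 v) as [K1 _]; auto.
    rewrite Rminus_diag, Rabs_R0; auto.
    rewrite Rminus_diag, Rabs_R0 in K1.
    replace (P u0 v - P u0 v0) with ((P u0 v - P u0 v0 - p * 0 - q * (v - v0)) + q * (v - v0)) by ring.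
    eapply Rle_trans. apply Rabs_triang. rewrite Rabs_mult. lra.
  - apply continuous_lipschitz_at with d (Rabs s + 1); auto.
    intros u Hu. destruct (K u v0) as [_ K1]; auto.
    rewrite Rminus_diag, Rabs_R0; auto.
    rewrite Rminus_diag, Rabs_R0 in K1.
    replace (S u v0 - S u0 v0) with ((S u v0 - S u0 v0 - s * (u - u0) - p * 0) + s * (u - u0)) by ring.
    eapply Rle_trans. apply Rabs_triang. rewrite Rabs_mult. lra.
Qed.

Section Green.
Variables (P S : R -> R -> R) (A B C D : R).
Hypothesis HCR : forall u v, A <= u <= B -> C <= v <= D -> half_CR P S u v.

Lemma green_exP (u c d : R) : A <= u <= B -> C <= c -> c <= d -> d <= D -> ex_RInt (P u) c d.
Proof.
  intros Hu H1 H2 H3. apply (ex_RInt_continuous (P u)). intros v.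
  rewrite Rmin_left, Rmax_right by lra. intros Hv.
  apply (half_CR_continuous P S u v). apply HCR; lra.
Qed.

Lemma green_exS (v a b : R) : C <= v <= D -> A <= a -> a <= b -> b <= B ->
  ex_RInt (fun u => S u v) a b.
Proof.
  intros Hu H1 H2 H3. apply (ex_RInt_continuous (fun u => S u v)). intros u.
  rewrite Rmin_left, Rmax_right by lra. intros Hv.
  apply (half_CR_continuous P S u v). apply HCR; lra.
Qed.

Lemma green_defect_split (a m b c n d : R) :
  A <= a <= m -> m <= b <= B -> C <= c <= n -> n <= d <= D ->
  green_defect P S a b c d =
  green_defect P S a m c n + green_defect P S m b c n
  + (green_defect P S a m n d + green_defect P S m b n d).
Proof.
  intros H1 H2 H3 H4. unfold green_defect.
  assert (XP : forall u, A <= u <= B -> RInt (P u) c d = RInt (P u) c n + RInt (P u) n d).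
  { intros u Hu. symmetry. apply (RInt_Chasles (P u)); apply green_exP; lra. }
  assert (XS : forall v, C <= v <= D -> RInt (fun u => S u v) a b
     = RInt (fun u => S u v) a m + RInt (fun u => S u v) m b).
  { intros v Hv. symmetry. apply (RInt_Chasles (fun u => S u v)); apply green_exS; lra. }
  rewrite !XP, !XS by lra. ring.
Qed.

(** Differences of opposite sides remove the constants and the terms with [q] and [s]; the terms
    with [p] contribute [p * (b - a) * (d - c)] once from [P] and once from [S], with opposite
    signs. What is left is an error of order [eps] times the perimeter, integrated over a side. *)
Lemma green_defect_local (u0 v0 : R) : A <= u0 <= B -> C <= v0 <= D ->
  forall eps, 0 < eps -> exists delta, 0 < delta /\
  forall a b c d, A <= a <= u0 -> u0 <= b <= B -> C <= c <= v0 -> v0 <= d <= D ->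
    (b - a) + (d - c) < delta ->
    Rabs (green_defect P S a b c d) <= eps * ((b - a) + (d - c)) ^ 2.
Proof.
  intros Hu Hv eps He.
  destruct (HCR u0 v0 Hu Hv) as [p [q [s K]]].
  destruct (K (eps / 2)) as [delta [Hd L]]. lra.
  exists delta. split; auto. intros a b c d Ha Hb Hc Hd' Hs.
  assert (E1 : RInt (P b) c d - RInt (P a) c d
     = RInt (fun v => P b v - P a v - p * (b - a)) c d + (d - c) * (p * (b - a))).
  { assert (X1 : RInt (fun v => P b v - P a v) c d = RInt (P b) c d - RInt (P a) c d)
      by (apply (RInt_minus (P b) (P a)); apply green_exP; lra).
    assert (X2 : RInt (fun v => P b v - P a v - p * (b - a)) c d
       = RInt (fun v => P b v - P a v) c d - RInt (fun _ => p * (b - a)) c d).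
    { apply (RInt_minus (fun v => P b v - P a v) (fun _ => p * (b - a))).
      apply (ex_RInt_minus (P b) (P a)); apply green_exP; lra. apply ex_RInt_const. }
    rewrite X2, X1, RInt_const. unfold scal; simpl; unfold mult; simpl. ring. }
  assert (E2 : RInt (fun u => S u d) a b - RInt (fun u => S u c) a b
     = RInt (fun u => S u d - S u c - p * (d - c)) a b + (b - a) * (p * (d - c))).
  { assert (X1 : RInt (fun u => S u d - S u c) a b = RInt (fun u => S u d) a b - RInt (fun u => S u c) a b)
      by (apply (RInt_minus (fun u => S u d) (fun u => S u c)); apply green_exS; lra).
    assert (X2 : RInt (fun u => S u d - S u c - p * (d - c)) a b
       = RInt (fun u => S u d - S u c) a b - RInt (fun _ => p * (d - c)) a b).
    { apply (RInt_minus (fun u => S u d - S u c) (fun _ => p * (d - c))).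
      apply (ex_RInt_minus (fun u => S u d) (fun u => S u c)); apply green_exS; lra.
      apply ex_RInt_const. }
    rewrite X2, X1, RInt_const. unfold scal; simpl; unfold mult; simpl. ring. }
  unfold green_defect. rewrite E1, E2.
  replace (RInt (fun v : R => P b v - P a v - p * (b - a)) c d + (d - c) * (p * (b - a)) -
   (RInt (fun u : R => S u d - S u c - p * (d - c)) a b + (b - a) * (p * (d - c))))
  with (RInt (fun v : R => P b v - P a v - p * (b - a)) c d - RInt (fun u : R => S u d - S u c - p * (d - c)) a b) by ring.
  set (L1 := (b - a) + (d - c)) in *.
  assert (B1 : Rabs (RInt (fun v : R => P b v - P a v - p * (b - a)) c d) <= (d - c) * (eps * L1)).
  { apply abs_RInt_le_const. lra.
    { apply (ex_RInt_minus (fun v => P b v - P a v) (fun _ => p * (b - a))).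
      apply (ex_RInt_minus (P b) (P a)); apply green_exP; lra. apply ex_RInt_const. }
    intros v Hvv.
    assert (Mv : Rabs (v - v0) <= d - c) by (apply Rabs_le; lra).
    assert (Mb : Rabs (b - u0) = b - u0) by (apply Rabs_right; lra).
    assert (Ma : Rabs (a - u0) = u0 - a) by (rewrite Rabs_minus_sym; apply Rabs_right; lra).
    destruct (L b v) as [Y1 _]. unfold L1 in Hs; rewrite Mb; lra. unfold L1 in Hs; lra.
    destruct (L a v) as [Y2 _]. unfold L1 in Hs; rewrite Ma; lra. unfold L1 in Hs; lra.
    replace (P b v - P a v - p * (b - a)) with
      ((P b v - P u0 v0 - p * (b - u0) - q * (v - v0)) - (P a v - P u0 v0 - p * (a - u0) - q * (v - v0))) by ring.
    eapply Rle_trans. apply Rabs_triang. rewrite Rabs_Ropp. rewrite Mb in Y1. rewrite Ma in Y2.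
    unfold L1. nra. }
  assert (B2 : Rabs (RInt (fun u : R => S u d - S u c - p * (d - c)) a b) <= (b - a) * (eps * L1)).
  { apply abs_RInt_le_const. lra.
    { apply (ex_RInt_minus (fun u => S u d - S u c) (fun _ => p * (d - c))).
      apply (ex_RInt_minus (fun u => S u d) (fun u => S u c)); apply green_exS; lra.
      apply ex_RInt_const. }
    intros u Huu.
    assert (Mv : Rabs (u - u0) <= b - a) by (apply Rabs_le; lra).
    assert (Mb : Rabs (d - v0) = d - v0) by (apply Rabs_right; lra).
    assert (Ma : Rabs (c - v0) = v0 - c) by (rewrite Rabs_minus_sym; apply Rabs_right; lra).
    destruct (L u d) as [_ Y1]. unfold L1 in Hs; lra. unfold L1 in Hs; rewrite Mb; lra.
    destruct (L u c) as [_ Y2]. unfold L1 in Hs; lra. unfold L1 in Hs; rewrite Ma; lra.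
    replace (S u d - S u c - p * (d - c)) with
      ((S u d - S u0 v0 - s * (u - u0) - p * (d - v0)) - (S u c - S u0 v0 - s * (u - u0) - p * (c - v0))) by ring.
    eapply Rle_trans. apply Rabs_triang. rewrite Rabs_Ropp. rewrite Mb in Y1. rewrite Ma in Y2.
    unfold L1. nra. }
  eapply Rle_trans. apply Rabs_triang. rewrite Rabs_Ropp.
  replace (eps * L1 ^ 2) with ((d - c) * (eps * L1) + (b - a) * (eps * L1)) by (unfold L1; ring).
  lra.
Qed.

Hypothesis HAB : A < B.
Hypothesis HCD : C < D.

Let W (n : nat) := (B - A) / 2 ^ n.
Let H (n : nat) := (D - C) / 2 ^ n.
Let G (n : nat) (ac : R * R) :=
  Rabs (green_defect P S (fst ac) (fst ac + W n) (snd ac) (snd ac + H n)).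

(** Goursat's bisection: a quarter that carries at least a fourth of the defect. The last quarter
    needs no test, because the four absolute values add up to at least the whole. *)
Let next (n : nat) (ac : R * R) : R * R :=
  let '(a, c) := ac in
  let q1 := (a, c) in let q2 := (a + W (Datatypes.S n), c) in
  let q3 := (a, c + H (Datatypes.S n)) in
  if Rle_dec (G n ac / 4) (G (Datatypes.S n) q1) then q1 else
  if Rle_dec (G n ac / 4) (G (Datatypes.S n) q2) then q2 else
  if Rle_dec (G n ac / 4) (G (Datatypes.S n) q3) then q3 else
  (a + W (Datatypes.S n), c + H (Datatypes.S n)).

Let cell (n : nat) : R * R := nat_rect (fun _ => (R * R)%type) (A, C) next n.

Lemma green_W_half n : W n = W (Datatypes.S n) + W (Datatypes.S n) /\ H n = H (Datatypes.S n) + H (Datatypes.S n).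
Proof.
  unfold W, H. simpl. assert (0 < 2 ^ n) by (apply pow_lt; lra). split; field; lra.
Qed.

Lemma green_W_pos n : 0 < W n /\ 0 < H n.
Proof.
  unfold W, H. assert (0 < 2 ^ n) by (apply pow_lt; lra). split; apply Rdiv_lt_0_compat; lra.
Qed.

Lemma green_cell_step n :
  A <= fst (cell n) -> fst (cell n) + W n <= B ->
  C <= snd (cell n) -> snd (cell n) + H n <= D ->
  fst (cell n) <= fst (cell (Datatypes.S n)) /\
  fst (cell (Datatypes.S n)) + W (Datatypes.S n) <= fst (cell n) + W n /\
  snd (cell n) <= snd (cell (Datatypes.S n)) /\
  snd (cell (Datatypes.S n)) + H (Datatypes.S n) <= snd (cell n) + H n /\
  G n (cell n) / 4 <= G (Datatypes.S n) (cell (Datatypes.S n)).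
Proof.
  intros H1 H2 H3 H4.
  change (cell (Datatypes.S n)) with (next n (cell n)).
  destruct (cell n) as [a c] eqn:E. simpl fst in *; simpl snd in *.
  destruct (green_W_half n) as [E1 E2].
  destruct (green_W_pos (Datatypes.S n)) as [P1 P2].
  assert (Sp := green_defect_split a (a + W (Datatypes.S n)) (a + W n) c (c + H (Datatypes.S n)) (c + H n)).
  assert (Sp' : G n (a, c) <= G (Datatypes.S n) (a, c) + G (Datatypes.S n) (a + W (Datatypes.S n), c)
     + (G (Datatypes.S n) (a, c + H (Datatypes.S n)) + G (Datatypes.S n) (a + W (Datatypes.S n), c + H (Datatypes.S n)))).
  { unfold G; simpl fst; simpl snd. rewrite Sp by lra.
    replace (a + W (Datatypes.S n) + W (Datatypes.S n)) with (a + W n) by lra.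
    replace (c + H (Datatypes.S n) + H (Datatypes.S n)) with (c + H n) by lra.
    eapply Rle_trans. apply Rabs_triang. apply Rplus_le_compat; apply Rabs_triang. }
  unfold next.
  destruct (Rle_dec _ _) as [K1|K1]. simpl; repeat split; lra.
  destruct (Rle_dec _ _) as [K2|K2]. simpl fst; simpl snd; repeat split; lra.
  destruct (Rle_dec _ _) as [K3|K3]; simpl fst; simpl snd; repeat split; lra.
Qed.

Lemma green_cell_in n :
  A <= fst (cell n) /\ fst (cell n) + W n <= B /\
  C <= snd (cell n) /\ snd (cell n) + H n <= D /\
  G 0 (cell 0) / 4 ^ n <= G n (cell n).
Proof.
  induction n as [|n [I1 [I2 [I3 [I4 I5]]]]].
  - simpl. unfold W, H. simpl. repeat split; try lra.
  - destruct (green_cell_step n I1 I2 I3 I4) as [J1 [J2 [J3 [J4 J5]]]].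
    repeat split; try lra.
    eapply Rle_trans; [|exact J5].
    assert (0 < 4 ^ n) by (apply pow_lt; lra). simpl pow.
    replace (G 0 (cell 0) / (4 * 4 ^ n)) with (G 0 (cell 0) / 4 ^ n / 4) by (field; lra). lra.
Qed.

Lemma green_cell_mono n k :
  fst (cell n) <= fst (cell (n + k)) /\ fst (cell (n + k)) + W (n + k) <= fst (cell n) + W n /\
  snd (cell n) <= snd (cell (n + k)) /\ snd (cell (n + k)) + H (n + k) <= snd (cell n) + H n.
Proof.
  induction k as [|k IH]. rewrite Nat.add_0_r. lra.
  rewrite Nat.add_succ_r.
  destruct (green_cell_in (n + k)) as [I1 [I2 [I3 [I4 I5]]]].
  destruct (green_cell_step (n + k) I1 I2 I3 I4) as [J1 [J2 [J3 [J4 J5]]]]. lra.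
Qed.

Lemma nested_intervals (a w : nat -> R) :
  (forall n k, a n <= a (n + k)%nat /\ a (n + k)%nat + w (n + k)%nat <= a n + w n) ->
  (forall n, 0 <= w n) ->
  exists x, forall n, a n <= x <= a n + w n.
Proof.
  intros Hm Hw.
  assert (Hab : forall n m, a n <= a m + w m).
  { intros n m. destruct (Hm n m) as [X _]. destruct (Hm m n) as [_ Y].
    rewrite Nat.add_comm in Y. specialize (Hw (n + m)%nat). lra. }
  destruct (completeness (fun x => exists n, x = a n)) as [x [U L]].
  - exists (a 0%nat + w 0%nat). intros y [n ->]. apply Hab.
  - exists (a 0%nat). exists 0%nat. reflexivity.
  - exists x. intros n. split. apply U. exists n; reflexivity.
    apply L. intros y [m ->]. apply Hab.
Qed.

Theorem green_zero : green_defect P S A B C D = 0.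
Proof.
  assert (E0 : G 0 (cell 0) = Rabs (green_defect P S A B C D)).
  { unfold G, cell, W, H; simpl. do 2 f_equal; field. }
  destruct (Req_dec (green_defect P S A B C D) 0) as [Z|Z]; auto. exfalso.
  apply Rabs_pos_lt in Z. rewrite <- E0 in Z.
  destruct (nested_intervals (fun n => fst (cell n)) W) as [u0 Hu].
  { intros n k. destruct (green_cell_mono n k) as [X [Y _]]. auto. }
  { intros n. apply Rlt_le, green_W_pos. }
  destruct (nested_intervals (fun n => snd (cell n)) H) as [v0 Hv].
  { intros n k. destruct (green_cell_mono n k) as [_ [_ [X Y]]]. auto. }
  { intros n. apply Rlt_le, green_W_pos. }
  set (L := (B - A) + (D - C)).
  assert (HL : 0 < L) by (unfold L; lra).
  assert (Bu : A <= u0 <= B).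
  { specialize (Hu 0%nat). unfold cell, W in Hu. simpl in Hu. lra. }
  assert (Bv : C <= v0 <= D).
  { specialize (Hv 0%nat). unfold cell, H in Hv. simpl in Hv. lra. }
  (* With this tolerance the local bound on the [n]-th cell, whose half-perimeter is [L / 2 ^ n], is
     half of [G 0 (cell 0) / 4 ^ n], whereas the cell carries at least the whole of it. *)
  destruct (green_defect_local u0 v0 Bu Bv (G 0 (cell 0) / (2 * L ^ 2))) as [delta [Hd K]].
  { apply Rdiv_lt_0_compat; auto. apply Rmult_lt_0_compat. lra. apply pow_lt; auto. }
  assert (Hn : exists n : nat, L / 2 ^ n < delta).
  { destruct (pow_lt_1_zero (/ 2)) with (y := delta / L) as [n Hn].
    rewrite Rabs_right; lra. apply Rdiv_lt_0_compat; auto.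
    exists n. specialize (Hn n (Nat.le_refl n)). rewrite Rabs_right in Hn.
    rewrite pow_inv in Hn. apply (Rmult_lt_compat_l L) in Hn; auto.
    replace (L * (delta / L)) with delta in Hn by (field; lra). exact Hn.
    apply Rle_ge, pow_le; lra. }
  destruct Hn as [n Hn].
  destruct (green_cell_in n) as [I1 [I2 [I3 [I4 I5]]]].
  specialize (Hu n). specialize (Hv n). cbv beta in Hu, Hv.
  assert (P2 : 0 < 2 ^ n) by (apply pow_lt; lra).
  assert (ES : W n + H n = L / 2 ^ n) by (unfold W, H, L; field; lra).
  specialize (K (fst (cell n)) (fst (cell n) + W n) (snd (cell n)) (snd (cell n) + H n)).
  replace (fst (cell n) + W n - fst (cell n) + (snd (cell n) + H n - snd (cell n))) with (L / 2 ^ n) in K by lra.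
  assert (K' := K ltac:(lra) ltac:(lra) ltac:(lra) ltac:(lra) Hn).
  fold (G n (cell n)) in K'.
  assert (E4 : 4 ^ n = 2 ^ n * 2 ^ n) by (rewrite <- Rpow_mult_distr; f_equal; lra).
  assert (F : G 0 (cell 0) / (2 * L ^ 2) * (L / 2 ^ n) ^ 2 = G 0 (cell 0) / 4 ^ n / 2).
  { rewrite E4. field. split; lra. }
  rewrite F in K'.
  assert (0 < G 0 (cell 0) / 4 ^ n) by (apply Rdiv_lt_0_compat; auto; apply pow_lt; lra).
  lra.
Qed.
End Green.

(** * An identity theorem on discs *)

Definition Cexp (z : C) : C := (exp (Re z) * cos (Im z), exp (Re z) * sin (Im z)).

Lemma exp_le_compat (a b : R) : a <= b -> exp a <= exp b.
Proof. intros [H|H]. left. apply exp_increasing; auto. right; f_equal; auto. Qed.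

Lemma Cexp_0 : Cexp 0 = 1.
Proof. unfold Cexp; simpl. rewrite exp_0, cos_0, sin_0.
apply injective_projections; simpl; ring. Qed.

Lemma Cexp_plus (z w : C) : Cexp (z + w) = (Cexp z * Cexp w)%C.
Proof.
  destruct z as [a b], w as [c d]. unfold Cexp; simpl.
  rewrite exp_plus, cos_plus, sin_plus.
  apply injective_projections; simpl; ring.
Qed.

Lemma Cmod_Cexp (z : C) : Cmod (Cexp z) = exp (Re z).
Proof.
  unfold Cmod, Cexp; simpl fst; simpl snd.
  replace ((exp (Re z) * cos (Im z)) ^ 2 + (exp (Re z) * sin (Im z)) ^ 2) with ((exp (Re z)) ^ 2).
  apply sqrt_pow2. apply Rlt_le, exp_pos.
  pose proof (sin2_cos2 (Im z)). unfold Rsqr in H.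
  replace ((exp (Re z) * cos (Im z)) ^ 2 + (exp (Re z) * sin (Im z)) ^ 2)
    with ((exp (Re z)) ^ 2 * (sin (Im z) * sin (Im z) + cos (Im z) * cos (Im z))) by ring.
  rewrite H. ring.
Qed.

Lemma im_le_Cmod (z : C) : Rabs (Im z) <= Cmod z.
Proof. eapply Rle_trans; [|apply Rmax_Cmod]. apply Rmax_r. Qed.

Lemma Cmod_le_sum (z : C) : Cmod z <= Rabs (Re z) + Rabs (Im z).
Proof.
  destruct z as [a b]. replace (a, b) with (RtoC a + RtoC b * Ci)%C.
  eapply Rle_trans. apply Cmod_triangle. rewrite Cmod_mult, Cmod_Ci, !Cmod_R.
  simpl. right.
  replace (a + (b * 0 - 0 * 1)) with a by ring. replace (0 + (b * 1 + 0 * 0)) with b by ring. ring.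
  apply injective_projections; simpl; ring.
Qed.

Lemma derivable_pt_lim_bound (f : R -> R) (l : R) :
  derivable_pt_lim f 0 l -> forall eps, 0 < eps -> exists d, 0 < d /\
  forall h, Rabs h < d -> Rabs (f h - f 0 - l * h) <= eps * Rabs h.
Proof.
  intros H eps He. destruct (H eps He) as [d Hd].
  exists d. split. apply cond_pos. intros h Hh.
  destruct (Req_dec h 0) as [->|Hn].
  replace (f 0 - f 0 - l * 0) with 0 by ring. rewrite Rabs_R0. lra.
  specialize (Hd h Hn Hh). rewrite Rplus_0_l in Hd.
  replace (f h - f 0 - l * h) with (((f h - f 0) / h - l) * h) by (field; auto).
  rewrite Rabs_mult. apply Rmult_le_compat_r. apply Rabs_pos. lra.
Qed.

Lemma cderive_Cexp_0 : cderive Cexp 0 1.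
Proof.
  intros eps He.
  destruct (derivable_pt_lim_bound exp 1) with (eps := Rmin 1 (eps / 4)) as [d1 [Hd1 H1]].
  { rewrite <- exp_0. apply derivable_pt_lim_exp. } { apply Rmin_pos; lra. }
  destruct (derivable_pt_lim_bound sin 1) with (eps := eps / 16) as [d2 [Hd2 H2]].
  { rewrite <- cos_0. apply derivable_pt_lim_sin. } { lra. }
  destruct (derivable_pt_lim_bound cos 0) with (eps := eps / 16) as [d3 [Hd3 H3]].
  { replace 0 with (- sin 0) at 2 by (rewrite sin_0; ring). apply derivable_pt_lim_cos. } { lra. }
  set (d4 := Rmin 1 (eps / 16)).
  assert (Hd4 : 0 < d4) by (apply Rmin_pos; lra).
  exists (Rmin (Rmin d1 d2) (Rmin d3 d4)). split. repeat apply Rmin_pos; try lra.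
  intros w Hw. rewrite Cexp_0, Cplus_0_l.
  set (u := Re w). set (v := Im w).
  pose proof (re_le_Cmod w) as Hu. fold u in Hu. pose proof (im_le_Cmod w) as Hv. fold v in Hv.
  pose proof (Rmin_l (Rmin d1 d2) (Rmin d3 d4)). pose proof (Rmin_r (Rmin d1 d2) (Rmin d3 d4)).
  pose proof (Rmin_l d1 d2). pose proof (Rmin_r d1 d2). pose proof (Rmin_l d3 d4).
  pose proof (Rmin_r d3 d4).
  pose proof (Rmin_l 1 (eps / 16)) as Hda. pose proof (Rmin_r 1 (eps / 16)) as Hdb.
  fold d4 in Hda, Hdb.
  specialize (H1 u ltac:(lra)). specialize (H2 v ltac:(lra)). specialize (H3 v ltac:(lra)).
  rewrite exp_0 in H1. rewrite sin_0 in H2. rewrite cos_0 in H3.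
  assert (H1a : Rabs (exp u - 1 - 1 * u) <= Rabs u).
  { pose proof (Rmin_l 1 (eps / 4)). pose proof (Rabs_pos u). nra. }
  assert (H1b : Rabs (exp u - 1 - 1 * u) <= eps / 4 * Rabs u).
  { pose proof (Rmin_r 1 (eps / 4)). pose proof (Rabs_pos u). nra. }
  clear H1.
  assert (Hex : Rabs (exp u - 1) <= 2 * Rabs u).
  { replace (exp u - 1) with ((exp u - 1 - 1 * u) + u) by ring. eapply Rle_trans. apply Rabs_triang.
    lra. }
  assert (Hcos : Rabs (cos v) <= 1) by (apply Rabs_le; apply COS_bound).
  pose proof (Rabs_pos u) as U0. pose proof (Rabs_pos v) as V0.
  eapply Rle_trans. apply Cmod_le_sum.
  replace (Re (Cexp w - 1 - 1 * w)) with (exp u * cos v - 1 - u)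
    by (unfold Cexp, u, v; simpl; unfold Re, Im; ring).
  replace (Im (Cexp w - 1 - 1 * w)) with (exp u * sin v - v)
    by (unfold Cexp, u, v; simpl; unfold Re, Im; ring).
  assert (R1 : Rabs (exp u * cos v - 1 - u) <= eps / 2 * Cmod w).
  { replace (exp u * cos v - 1 - u) with
      ((exp u - 1 - 1 * u) * cos v + (1 + u) * (cos v - 1 - 0 * v)) by ring.
    eapply Rle_trans. apply Rabs_triang. rewrite !Rabs_mult.
    assert (Rabs (1 + u) <= 2).
    { eapply Rle_trans. apply Rabs_triang. rewrite Rabs_R1. lra. }
    assert (Rabs (exp u - 1 - 1 * u) * Rabs (cos v) <= eps / 4 * Rabs u * 1).
    { apply Rmult_le_compat; auto; apply Rabs_pos. }
    assert (Rabs (1 + u) * Rabs (cos v - 1 - 0 * v) <= 2 * (eps / 16 * Rabs v)).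
    { apply Rmult_le_compat; auto; apply Rabs_pos. }
    nra. }
  assert (R2 : Rabs (exp u * sin v - v) <= eps / 2 * Cmod w).
  { replace (exp u * sin v - v) with
      ((exp u - 1) * v + (1 + (exp u - 1)) * (sin v - 0 - 1 * v)) by ring.
    eapply Rle_trans. apply Rabs_triang. rewrite !Rabs_mult.
    assert (Rabs (1 + (exp u - 1)) <= 3).
    { eapply Rle_trans. apply Rabs_triang. rewrite Rabs_R1. lra. }
    assert (Rabs (exp u - 1) * Rabs v <= (2 * (eps / 16)) * Rabs v).
    { apply Rmult_le_compat_r; auto. lra. }
    assert (Rabs (1 + (exp u - 1)) * Rabs (sin v - 0 - 1 * v) <= 3 * (eps / 16 * Rabs v)).
    { apply Rmult_le_compat; auto; apply Rabs_pos. }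
    nra. }
  lra.
Qed.

Lemma cderive_Cexp (z : C) : cderive Cexp z (Cexp z).
Proof.
  intros eps He.
  assert (Hm : 0 < Cmod (Cexp z)) by (rewrite Cmod_Cexp; apply exp_pos).
  destruct (cderive_Cexp_0 (eps / Cmod (Cexp z))) as [d [Hd H]].
  apply Rdiv_lt_0_compat; auto.
  exists d. split; auto. intros w Hw. specialize (H w Hw).
  rewrite Cplus_0_l, Cexp_0 in H.
  rewrite Cexp_plus.
  replace (Cexp z * Cexp w - Cexp z - Cexp z * w)%C with (Cexp z * (Cexp w - 1 - 1 * w))%C by ring.
  rewrite Cmod_mult. apply (Rmult_le_compat_l (Cmod (Cexp z))) in H; [|lra].
  eapply Rle_trans. exact H. right. field. lra.
Qed.

Lemma cdiff_Cexp (z : C) : cdiff Cexp z.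
Proof. exists (Cexp z). apply cderive_Cexp. Qed.

Lemma cdiff_half_CR (F : C -> C) (u0 v0 : R) :
  cdiff F (u0, v0) -> half_CR (fun u v => Re (F (u, v))) (fun u v => Im (F (u, v))) u0 v0.
Proof.
  intros [l Hl]. exists (Re l), (- Im l), (Im l). intros eps He.
  destruct (Hl eps He) as [d [Hd H]]. exists (d / 2). split. lra.
  intros u v Hu Hv.
  set (w := ((u - u0)%R, (v - v0)%R) : C).
  pose proof (Cmod_le_sum w) as K. simpl in K.
  specialize (H w ltac:(lra)).
  replace ((u0, v0) + w)%C with ((u, v) : C) in H
    by (apply injective_projections; simpl; ring).
  assert (Hb : Cmod (F (u, v) - F (u0, v0) - l * w) <= eps * (Rabs (u - u0) + Rabs (v - v0))).
  { eapply Rle_trans. exact H. apply Rmult_le_compat_l; lra. }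
  split.
  - eapply Rle_trans; [|exact Hb]. eapply Rle_trans; [|apply re_le_Cmod].
    right. f_equal. simpl. unfold Re, Im. ring.
  - eapply Rle_trans; [|exact Hb]. eapply Rle_trans; [|apply im_le_Cmod].
    right. f_equal. simpl. unfold Re, Im. ring.
Qed.

(** Goursat on a rectangle of height [2 pi]. *)
Lemma periodic_mean_const (F : C -> C) (a b : R) :
  a < b ->
  (forall u v, a <= u <= b -> - PI <= v <= PI -> cdiff F (u, v)) ->
  (forall u, F (u, PI) = F (u, - PI)) ->
  RInt (fun v => Re (F (a, v))) (- PI) PI = RInt (fun v => Re (F (b, v))) (- PI) PI.
Proof.
  intros Hab HF Hp. pose proof PI_RGT_0.
  assert (Z := green_zero (fun u v => Re (F (u, v))) (fun u v => Im (F (u, v))) a b (- PI) PI).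
  assert (Z' := Z (fun u v Hu Hv => cdiff_half_CR F u v (HF u v Hu Hv)) Hab ltac:(lra)).
  unfold green_defect in Z'.
  (* By periodicity the two horizontal sides cancel. *)
  rewrite (RInt_ext (fun u => Im (F (u, PI))) (fun u => Im (F (u, - PI)))) in Z'.
  lra. intros; rewrite Hp; reflexivity.
Qed.

(** This is [cosh (z / 2) ^ 2]: entire, of period [2 pi i], and on the imaginary axis real with
    values in [[0, 1]] and its maximum 1 at [v = 0] within a period. Its powers are therefore
    analytic weights that concentrate at the point 1 of the unit circle. *)
Definition bump (z : C) : C := (RtoC (/ 4) * (RtoC 2 + Cexp z + Cexp (- z)))%C.

Lemma cdiff_bump (z : C) : cdiff bump z.
Proof.
  unfold bump. apply cdiff_mult. apply cdiff_const.
  apply cdiff_plus. apply cdiff_plus. apply cdiff_const. apply cdiff_Cexp.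
  apply (cdiff_comp Cexp (fun w => - w)%C).
  apply cdiff_ext with (fun w => 0 + w * (- (1)))%C. intros; ring. apply cdiff_affine.
  apply cdiff_Cexp.
Qed.

Lemma Cexp_pi_periodic (u : R) : Cexp (u, PI) = Cexp (u, - PI) /\ Cexp (- (u, PI)) = Cexp (- (u, - PI)).
Proof.
  unfold Cexp; simpl. rewrite !Ropp_involutive, !cos_neg, !sin_neg, sin_PI.
  split; apply injective_projections; simpl; ring.
Qed.

Lemma bump_imag (v : R) : bump (0, v) = RtoC ((1 + cos v) / 2).
Proof.
  unfold bump, Cexp; simpl. rewrite Ropp_0, exp_0, cos_neg, sin_neg.
  apply injective_projections; simpl; field.
Qed.

Lemma Cmod_bump (u v : R) : Cmod (bump (u, v)) <= (2 + exp u + exp (- u)) / 4.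
Proof.
  unfold bump. rewrite Cmod_mult, Cmod_R, Rabs_right by lra.
  assert (Cmod (2 + Cexp (u, v) + Cexp (- (u, v))) <= 2 + exp u + exp (- u)); [|lra].
  eapply Rle_trans. apply Cmod_triangle. rewrite Cmod_Cexp.
  apply Rplus_le_compat; [|simpl; lra].
  eapply Rle_trans. apply Cmod_triangle. rewrite Cmod_Cexp, Cmod_R, Rabs_right by lra. simpl; lra.
Qed.

(** Enough for the identity theorem, in which only the approximants are integrated and [f] enters
    through its distance from them. *)
Definition ulimit_cdiff (S : C -> Prop) (f : C -> C) : Prop :=
  forall eps, 0 < eps -> exists g : C -> C,
    (forall z, S z -> cdiff g z) /\ (forall z, S z -> Cmod (f z - g z) <= eps).

Lemma RInt_ge_middle (f : R -> R) (a b e k : R) :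
  a <= - e -> 0 <= e -> e <= b ->
  (forall x, a <= x <= b -> continuous f x) ->
  (forall x, a <= x <= b -> 0 <= f x) ->
  (forall x, - e <= x <= e -> k <= f x) ->
  2 * e * k <= RInt f a b.
Proof.
  intros H1 H2 H3 Hc Hp Hk.
  assert (X : forall c d, a <= c -> c <= d -> d <= b -> ex_RInt f c d).
  { intros c d K1 K2 K3. apply (ex_RInt_continuous f). intros x.
    rewrite Rmin_left, Rmax_right by lra. intros Hx. apply Hc. lra. }
  rewrite <- (RInt_Chasles f a (- e) b) by (apply X; lra).
  rewrite <- (RInt_Chasles f (- e) e b) by (apply X; lra).
  change plus with Rplus. cbv beta.
  assert (Y1 : 0 <= RInt f a (- e)).
  { apply RInt_ge_0; auto. apply X; lra. intros; apply Hp; lra. }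
  assert (Y2 : 0 <= RInt f e b).
  { apply RInt_ge_0; auto. apply X; lra. intros; apply Hp; lra. }
  assert (Y3 : 2 * e * k <= RInt f (- e) e).
  { replace (2 * e * k) with (RInt (fun _ => k) (- e) e).
    apply RInt_le. lra. apply ex_RInt_const. apply X; lra. intros; apply Hk; lra.
    rewrite RInt_const. unfold scal; simpl; unfold mult; simpl. ring. }
  simpl. lra.
Qed.

Lemma pow_ratio_unbounded (p q c : R) : 0 <= p < q -> 0 < c -> forall M, exists n : nat, M * p ^ n < c * q ^ n.
Proof.
  intros Hpq Hc M.
  destruct (Rle_dec M 0) as [HM|HM].
  { exists 0%nat. simpl. lra. }
  destruct (pow_lt_1_zero (p / q)) with (y := c / M) as [n Hn].
  { rewrite Rabs_right. apply (Rmult_lt_reg_r q). lra. unfold Rdiv.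
    rewrite Rmult_assoc, Rinv_l; lra.
    apply Rle_ge. apply Rmult_le_pos. lra. left. apply Rinv_0_lt_compat; lra. }
  { apply Rdiv_lt_0_compat; lra. }
  exists n. specialize (Hn n (Nat.le_refl n)).
  assert (Hq : 0 < q ^ n) by (apply pow_lt; lra).
  unfold Rdiv in Hn at 1. rewrite Rpow_mult_distr, pow_inv in Hn.
  apply (Rle_lt_trans _ _ _ (Rle_abs _)) in Hn.
  apply (Rmult_lt_compat_r (M * q ^ n)) in Hn; [|apply Rmult_lt_0_compat; lra].
  replace (c / M * (M * q ^ n)) with (c * q ^ n) in Hn by (field; lra).
  replace (p ^ n * / q ^ n * (M * q ^ n)) with (M * p ^ n) in Hn by (field; lra).
  exact Hn.
Qed.

Lemma kappa_half_lt (eta : R) : 0 < eta -> eta <= PI -> 0 <= (1 + cos eta) / 2 < (1 + cos (eta / 2)) / 2.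
Proof.
  intros H1 H2. pose proof (COS_bound eta). split. lra.
  assert (cos eta < cos (eta / 2)) by (apply cos_decreasing_1; lra). lra.
Qed.

(** The moments [int phi(e^(it)) ((1 + cos t) / 2)^N dt] vanish, whereas the
    weights concentrate at [t = 0]. *)
Lemma disc_identity (f : C -> C) (rho : R) :
  ulimit_cdiff (fun z => Cmod z < 2) f -> 0 < rho ->
  (forall z, Cmod z < rho -> f z = 0) -> f 1 = 0.
Proof.
  intros Hf Hrho Hz.
  destruct (Ceq_dec (f 1) 0) as [E|E]; auto. exfalso.
  (* Multiplication by the conjugate makes the value at 1 the positive number [m], so that real
     parts suffice from here on. *)
  set (c := Cconj (f 1)). set (m := Cmod (f 1) ^ 2).
  assert (Hf1 : 0 < Cmod (f 1)) by (apply Cmod_gt_0; auto).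
  assert (Hm : 0 < m) by (apply pow_lt; auto).
  assert (Hcm : Cmod c = Cmod (f 1)) by apply Cmod_conj.
  pose proof PI_RGT_0 as HPI.
  set (e0 := m / 8 / Cmod c).
  assert (He0 : 0 < e0) by (apply Rdiv_lt_0_compat; lra).
  destruct (Hf e0 He0) as [g0 [D0 L0]].
  assert (Hunit : forall v, Cmod (Cexp (0, v)) < 2).
  { intros v. rewrite Cmod_Cexp. simpl. rewrite exp_0. lra. }
  assert (Hdiff : forall (g : C -> C), (forall z, Cmod z < 2 -> cdiff g z) -> forall N u v, u <= 0 ->
     cdiff (fun z => c * g (Cexp z) * bump z ^ N)%C (u, v)).
  { intros g Hg N u v Hu. apply cdiff_mult. apply cdiff_mult. apply cdiff_const.
    apply (cdiff_comp g Cexp). apply cdiff_Cexp. apply Hg. rewrite Cmod_Cexp. simpl.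
    assert (exp u <= 1) by (rewrite <- exp_0; apply exp_le_compat; auto). lra.
    apply cdiff_pow. apply cdiff_bump. }
  assert (Hcont : forall (g : C -> C), (forall z, Cmod z < 2 -> cdiff g z) -> forall N u v, u <= 0 ->
     continuous (fun v => Re (c * g (Cexp (u, v)) * bump (u, v) ^ N)) v).
  { intros g Hg N u v Hu.
    apply (half_CR_continuous (fun u v => Re (c * g (Cexp (u, v)) * bump (u, v) ^ N)) _ u v
      (cdiff_half_CR (fun z => c * g (Cexp z) * bump z ^ N)%C u v (Hdiff g Hg N u v Hu))). }
  set (f0 := fun v => Re (c * g0 (Cexp (0, v)))).
  assert (C0 : forall v, continuous f0 v).
  { intros v. apply continuous_ext with (fun v => Re (c * g0 (Cexp (0, v)) * bump (0, v) ^ 0)).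
    intros x. unfold f0. f_equal. simpl. ring. apply Hcont; auto. lra. }
  assert (Exp0 : Cexp (0, 0) = 1) by (apply Cexp_0).
  assert (V0 : 7 * m / 8 <= f0 0).
  { unfold f0. rewrite Exp0.
    assert (Cmod (c * f 1 - c * g0 1) <= m / 8).
    { replace (c * f 1 - c * g0 1)%C with (c * (f 1 - g0 1))%C by ring. rewrite Cmod_mult.
      apply Rle_trans with (Cmod c * e0). apply Rmult_le_compat_l. lra. apply L0.
      rewrite Cmod_1; lra.
      right. unfold e0. field. lra. }
    assert (Re (c * f 1)%C = m).
    { unfold c, m. rewrite Cmult_comm. rewrite <- Cmod2_conj. simpl. reflexivity. }
    pose proof (re_le_Cmod (c * f 1 - c * g0 1)) as K.
    replace (Re (c * f 1 - c * g0 1)) with (Re (c * f 1)%C - Re (c * g0 1)%C) in K by (simpl; ring).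
    assert (Rabs (Re (c * f 1)%C - Re (c * g0 1)%C) <= m / 8) by lra.
    apply Rabs_le_between in H1. lra. }
  (* [eta] and the bound [B] below are read off the fixed approximant [g0], so no continuity of [f]
     itself has to be established. *)
  assert (Near : exists eta, 0 < eta <= PI /\ forall v, Rabs v <= eta -> 3 * m / 4 <= f0 v).
  { destruct (C0 0 (fun y => 3 * m / 4 < y)) as [d Hd].
    { exists (mkposreal (m / 8) ltac:(lra)). intros y Hy. change (Rabs (y - f0 0) < m / 8) in Hy.
      apply Rabs_lt_between in Hy. lra. }
    exists (Rmin (d / 2) PI). pose proof (cond_pos d).
    split. split. apply Rmin_pos; lra. apply Rmin_r.
    intros v Hv. left. apply (Hd v). change (Rabs (v - 0) < d). rewrite Rminus_0_r.
    pose proof (Rmin_l (d / 2) PI). lra. }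
  destruct Near as [eta [[Heta1 Heta2] Near]].
  assert (Bd : exists B, 0 <= B /\ forall v, - PI <= v <= PI -> - B <= f0 v).
  { destruct (continuity_ab_min f0 (- PI) PI) as [x [Hx _]]. lra.
    intros y _. apply continuity_pt_filterlim. apply C0.
    exists (Rabs (f0 x)). split. apply Rabs_pos. intros v Hv. specialize (Hx v Hv).
    pose proof (Rle_abs (- f0 x)). rewrite Rabs_Ropp in H. lra. }
  destruct Bd as [B [HB Bd]].
  set (kap := fun v => (1 + cos v) / 2).
  (* For large [N] the gain over [[- eta / 2, eta / 2]], where the weight is at least
     [kap (eta / 2) ^ N], exceeds the possible loss beyond [eta], where it is at most
     [kap eta ^ N]. *)
  destruct (pow_ratio_unbounded (kap eta) (kap (eta / 2)) (m / 2 * eta)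
     (kappa_half_lt eta Heta1 Heta2) ltac:(apply Rmult_lt_0_compat; lra) (2 * PI * (B + m / 4 + m / 2) )) as [N HN].
  set (dN := m / 2 * eta * kap (eta / 2) ^ N - 2 * PI * (B + m / 4 + m / 2) * kap eta ^ N).
  assert (HdN : 0 < dN) by (unfold dN; lra).
  (* The vertical line [Re z = u1] is mapped by [Cexp] into the disc where [f] vanishes; [u1 < 0]
     keeps the rectangle over the unit disc. *)
  set (u1 := ln (Rmin rho 1 / 2)).
  assert (Hmr : 0 < Rmin rho 1) by (apply Rmin_pos; lra).
  assert (Hmr1 : Rmin rho 1 <= 1) by apply Rmin_r.
  assert (Hmr2 : Rmin rho 1 <= rho) by apply Rmin_l.
  assert (Hu1 : u1 < 0). { unfold u1. rewrite <- ln_1. apply ln_increasing; lra. }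
  assert (Heu1 : exp u1 < rho). { unfold u1. rewrite exp_ln; lra. }
  set (K := ((2 + exp u1 + exp (- u1)) / 4) ^ N).
  assert (HK : 0 < K). { apply pow_lt. pose proof (exp_pos u1). pose proof (exp_pos (- u1)). lra. }
  (* The final approximant comes after [N]: on the line [Re z = u1] its error is amplified by the
     bound [K] on [bump ^ N], and the total there must stay below [dN / 2]. *)
  set (e := Rmin e0 (dN / 2 / (2 * PI * Cmod c * K))).
  assert (He : 0 < e). { apply Rmin_pos; auto. apply Rdiv_lt_0_compat. lra.
    apply Rmult_lt_0_compat; auto. apply Rmult_lt_0_compat; lra. }
  destruct (Hf e He) as [g [D L]].
  assert (Eq := periodic_mean_const (fun z => c * g (Cexp z) * bump z ^ N)%C u1 0 Hu1
    (fun u v Hu _ => Hdiff g D N u v (proj2 Hu))).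
  assert (Eq' : RInt (fun v => Re (c * g (Cexp (u1, v)) * bump (u1, v) ^ N)) (- PI) PI
              = RInt (fun v => Re (c * g (Cexp (0, v)) * bump (0, v) ^ N)) (- PI) PI).
  { apply Eq. intros u. unfold bump. destruct (Cexp_pi_periodic u) as [Q1 Q2]. rewrite Q1, Q2.
    reflexivity. }
  clear Eq.
  assert (Up : Rabs (RInt (fun v => Re (c * g (Cexp (u1, v)) * bump (u1, v) ^ N)) (- PI) PI) <= dN / 2).
  { eapply Rle_trans. apply abs_RInt_le_const with (M := Cmod c * e * K). lra.
    { apply (ex_RInt_continuous (fun v => Re (c * g (Cexp (u1, v)) * bump (u1, v) ^ N))).
      intros v _. apply Hcont; auto. lra. }
    intros v _. eapply Rle_trans. apply re_le_Cmod. rewrite !Cmod_mult, Cmod_pow.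
    apply Rmult_le_compat. apply Rmult_le_pos; apply Cmod_ge_0. apply pow_le, Cmod_ge_0.
    apply Rmult_le_compat_l. lra.
    assert (Hs : Cmod (Cexp (u1, v)) = exp u1) by (rewrite Cmod_Cexp; reflexivity).
    specialize (L (Cexp (u1, v))). rewrite Hs in L. rewrite Hz in L by lra.
    replace (0 - g (Cexp (u1, v)))%C with (- g (Cexp (u1, v)))%C in L by ring.
    rewrite Cmod_opp in L. apply L. apply Rlt_trans with 1; [|lra]. rewrite <- exp_0.
    apply exp_increasing; lra.
    apply pow_incr. split. apply Cmod_ge_0. apply Cmod_bump.
    apply Rle_trans with (2 * PI * Cmod c * K * e). right; ring.
    apply Rle_trans with (2 * PI * Cmod c * K * (dN / 2 / (2 * PI * Cmod c * K))).
    apply Rmult_le_compat_l. apply Rmult_le_pos; [apply Rmult_le_pos|]; lra. apply Rmin_r.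
    right. field. repeat split; lra. }
  assert (Low : dN <= RInt (fun v => Re (c * g (Cexp (0, v)) * bump (0, v) ^ N)) (- PI) PI).
  { assert (kc : forall v, continuous (fun v => kap v ^ N) v).
    { intros v. apply continuity_pt_filterlim. apply derivable_continuous_pt.
      unfold kap. reg. }
    assert (knn : forall v, 0 <= kap v). { intros v. unfold kap. pose proof (COS_bound v). lra. }
    assert (I1 : 2 * (eta / 2) * kap (eta / 2) ^ N <= RInt (fun v => kap v ^ N) (- PI) PI).
    { apply RInt_ge_middle; try lra. intros; apply kc. intros; apply pow_le, knn.
      intros v Hv. apply pow_incr. split. apply knn. unfold kap.
      assert (cos (eta / 2) <= cos v); [|lra].
      destruct (Rle_dec 0 v). apply cos_decr_1; lra.
      rewrite <- (cos_neg v). apply cos_decr_1; lra. }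
    (* One minorant for both regions: for [|v| <= eta] the real part is at least [m / 2]; beyond, it
       is at least [- (B + m / 4)], and the additional [m / 2] in the constant pays for the first
       term. *)
    assert (I2 : RInt (fun v => m / 2 * kap v ^ N - (B + m / 4 + m / 2) * kap eta ^ N) (- PI) PI
      = m / 2 * RInt (fun v => kap v ^ N) (- PI) PI - 2 * PI * (B + m / 4 + m / 2) * kap eta ^ N).
    { assert (Xk : ex_RInt (fun v => kap v ^ N) (- PI) PI)
        by (apply (ex_RInt_continuous (fun v => kap v ^ N)); intros; apply kc).
      transitivity (RInt (fun v => m / 2 * kap v ^ N) (- PI) PI - RInt (fun _ => (B + m / 4 + m / 2) * kap eta ^ N) (- PI) PI).
      apply (RInt_minus (fun v => m / 2 * kap v ^ N) (fun _ => (B + m / 4 + m / 2) * kap eta ^ N)).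
      apply (ex_RInt_scal (fun v => kap v ^ N)). exact Xk. apply ex_RInt_const.
      rewrite RInt_const. f_equal. apply (RInt_scal (fun v => kap v ^ N)). exact Xk.
      unfold scal; simpl; unfold mult; simpl. ring. }
    apply Rle_trans with (RInt (fun v => m / 2 * kap v ^ N - (B + m / 4 + m / 2) * kap eta ^ N) (- PI) PI).
    { rewrite I2. unfold dN. apply Rplus_le_compat_r.
      replace (m / 2 * eta * kap (eta / 2) ^ N) with (m / 2 * (2 * (eta / 2) * kap (eta / 2) ^ N)) by field.
      apply Rmult_le_compat_l; lra. }
    apply RInt_le. lra.
    { apply (ex_RInt_minus (fun v => m / 2 * kap v ^ N) (fun _ => (B + m / 4 + m / 2) * kap eta ^ N)).
      apply (ex_RInt_scal (fun v => kap v ^ N)).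
      apply (ex_RInt_continuous (fun v => kap v ^ N)); intros; apply kc.
      apply ex_RInt_const. }
    { apply (ex_RInt_continuous (fun v => Re (c * g (Cexp (0, v)) * bump (0, v) ^ N))).
      intros v _. apply Hcont; auto. lra. }
    intros v Hv. rewrite bump_imag. fold (kap v).
    replace (Re (c * g (Cexp (0, v)) * RtoC (kap v) ^ N)) with (Re (c * g (Cexp (0, v))) * kap v ^ N).
    2:{ rewrite <- RtoC_pow. simpl. ring. }
    assert (fg : f0 v - m / 4 <= Re (c * g (Cexp (0, v)))).
    { assert (Q : Cmod (c * g0 (Cexp (0, v)) - c * g (Cexp (0, v))) <= m / 4).
      { replace (c * g0 (Cexp (0, v)) - c * g (Cexp (0, v)))%C with
          (c * ((f (Cexp (0, v)) - g (Cexp (0, v))) - (f (Cexp (0, v)) - g0 (Cexp (0, v)))))%C by ring.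
        rewrite Cmod_mult. apply Rle_trans with (Cmod c * (e0 + e0)).
        apply Rmult_le_compat_l. lra. eapply Rle_trans. apply Cmod_triangle_minus.
        apply Rplus_le_compat. eapply Rle_trans. apply L; auto. apply Rmin_l. apply L0; auto.
        right. unfold e0. field. lra. }
      pose proof (re_le_Cmod (c * g0 (Cexp (0, v)) - c * g (Cexp (0, v)))) as Kq.
      replace (Re (c * g0 (Cexp (0, v)) - c * g (Cexp (0, v)))) with (f0 v - Re (c * g (Cexp (0, v)))%C) in Kq
        by (unfold f0; simpl; ring).
      assert (Kq2 : Rabs (f0 v - Re (c * g (Cexp (0, v)))%C) <= m / 4) by lra.
      apply Rabs_le_between in Kq2. lra. }
    assert (0 <= kap v ^ N) by (apply pow_le, knn).
    assert (0 <= kap eta ^ N) by (apply pow_le, knn).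
    destruct (Rle_dec (Rabs v) eta) as [Hin|Hout].
    - specialize (Near v Hin). assert (m / 2 <= Re (c * g (Cexp (0, v)))) by lra. nra.
    - specialize (Bd v ltac:(lra)).
      assert (kap v ^ N <= kap eta ^ N).
      { apply pow_incr. split. apply knn. unfold kap.
        assert (cos v <= cos eta); [|lra].
        destruct (Rle_dec 0 v). rewrite Rabs_right in Hout by lra. apply cos_decr_1; lra.
        rewrite Rabs_left in Hout by lra. rewrite <- (cos_neg v). apply cos_decr_1; lra. }
      assert (- (B + m / 4) <= Re (c * g (Cexp (0, v)))) by lra. nra. }
  rewrite Eq' in Up. pose proof (Rle_abs (RInt (fun v => Re (c * g (Cexp (0, v)) * bump (0, v) ^ N)) (- PI) PI)). lra.
Qed.

(** * Continuation of meromorphic functions along segments *)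

Ltac Rmin_bounds_of a b :=
  lazymatch goal with
  | _ : Rmin a b <= a |- _ => fail
  | _ => pose proof (Rmin_l a b); pose proof (Rmin_r a b)
  end.

Ltac Rmin_bounds :=
  repeat match goal with
  | _ : context [Rmin ?a ?b] |- _ => Rmin_bounds_of a b
  | _ := context [Rmin ?a ?b] |- _ => Rmin_bounds_of a b
  | |- context [Rmin ?a ?b] => Rmin_bounds_of a b
  end.

(** Connectedness of [[0, 1]]: the supremum of the parameters that satisfy [P] satisfies it as well,
    and could be exceeded if it were below 1. *)
Lemma interval_chain (P : R -> Prop) :
  (forall T, 0 <= T <= 1 -> exists d, 0 < d /\ forall T1 T2,
     0 <= T1 <= 1 -> 0 <= T2 <= 1 -> Rabs (T1 - T) < d -> Rabs (T2 - T) < d -> P T1 -> P T2) ->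
  P 0 -> P 1.
Proof.
  intros H P0.
  destruct (completeness (fun T => 0 <= T <= 1 /\ P T)) as [m [U L]].
  { exists 1. intros T [HT _]. lra. }
  { exists 0. split; auto. lra. }
  assert (Hm : 0 <= m <= 1).
  { split. apply U. split; auto; lra. apply L. intros T [HT _]. lra. }
  destruct (H m Hm) as [d [Hd K]].
  assert (exists T1, 0 <= T1 <= 1 /\ P T1 /\ m - d < T1 <= m) as [T1 [HT1 [PT1 B1]]].
  { apply NNPP. intros N. assert (m <= m - d / 2); [|lra].
    apply L. intros T [HT PT]. destruct (Rle_dec T (m - d / 2)); auto. exfalso. apply N.
    exists T. repeat split; auto; try lra. }
  assert (Near : forall T2, 0 <= T2 <= 1 -> Rabs (T2 - m) < d -> P T2).
  { intros T2 H2 H3. apply (K T1 T2); auto. apply Rabs_lt_between; lra. }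
  destruct (Rle_dec 1 m) as [Hge|Hlt].
  - apply Near. lra. apply Rabs_lt_between; lra.
  - exfalso. set (T2 := Rmin 1 (m + d / 2)).
    assert (B2 : m < T2 <= m + d / 2).
    { unfold T2. split. apply Rmin_glb_lt; lra. apply Rmin_r. }
    assert (B3 : T2 <= 1) by apply Rmin_l.
    assert (T2 <= m); [|lra]. apply U. split. lra. apply Near. lra. apply Rabs_lt_between; lra.
Qed.

Lemma plus_minus_cancel {G : AbelianGroup} (p q : G) : plus p (minus q p) = q.
Proof.
  transitivity (plus p (plus (opp p) q)). apply (f_equal (plus p)). exact (plus_comm q (opp p)).
  etransitivity; [apply plus_assoc|].
  etransitivity; [apply (f_equal (fun a => plus a q)); exact (plus_opp_r p) | apply plus_zero_l].
Qed.

Section Lines.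
Context {U : NormedModule C_AbsRing}.

Definition ndist (p q : U) : R := norm (minus q p).
Definition line (q v : U) (z : C) : U := plus q (scal z v).

Lemma ndist_refl (p : U) : ndist p p = 0.
Proof. unfold ndist. rewrite minus_eq_zero. apply norm_zero. Qed.

Lemma ndist_sym (p q : U) : ndist p q = ndist q p.
Proof. unfold ndist. rewrite <- (norm_opp (minus q p)), opp_minus. reflexivity. Qed.

Lemma ndist_triangle (p q r : U) : ndist p r <= ndist p q + ndist q r.
Proof.
  unfold ndist. rewrite (minus_trans q r p). rewrite Rplus_comm.
  apply (norm_triangle (minus r q) (minus q p)).
Qed.

Lemma ndist_line (q v : U) (z : C) : ndist q (line q v z) <= Cmod z * norm v.
Proof.
  unfold ndist, line.
  replace (minus (plus q (scal z v)) q) with (scal z v)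
    by (symmetry; exact (@minus_plus_cancel (NormedModule.AbelianGroup C_AbsRing U) q (scal z v))).
  apply (norm_scal z v).
Qed.

Lemma line_0 (q v : U) : line q v 0 = q.
Proof. unfold line. change (RtoC 0) with (@zero C_Ring). rewrite scal_zero_l.
apply plus_zero_r. Qed.

Lemma line_line (q v : U) (z w : C) : line (line q v z) v w = line q v (z + w).
Proof.
  unfold line. rewrite <- plus_assoc. f_equal.
  change (z + w)%C with (@plus C_Ring z w). rewrite scal_distr_r. reflexivity.
Qed.

Lemma line_end (p q : U) : line p (minus q p) 1 = q.
Proof.
  unfold line. change (RtoC 1) with (@one C_Ring). rewrite scal_one.
  exact (@plus_minus_cancel (NormedModule.AbelianGroup C_AbsRing U) p q).
Qed.

Lemma ndist_line_line (q v : U) (z w : C) : ndist (line q v z) (line q v w) <= Cmod (w - z) * norm v.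
Proof.
  replace (line q v w) with (line (line q v z) v (w - z)). apply ndist_line.
  rewrite line_line. f_equal. ring.
Qed.

(** Closed under uniform limits, so that the double series never has to be
    differentiated. *)
Definition lhol (S : U -> Prop) (f : U -> C) : Prop :=
  forall eps, 0 < eps -> exists g : U -> C,
    (forall q, S q -> forall v, cdiff (fun z => g (line q v z)) 0) /\
    (forall q, S q -> Cmod (f q - g q) <= eps).

Definition lhol_at (f : U -> C) (q : U) : Prop :=
  exists r, 0 < r /\ lhol (fun q' => ndist q q' < r) f.

Definition vanish_near (f : U -> C) (q : U) : Prop :=
  exists r, 0 < r /\ forall q', ndist q q' < r -> f q' = 0.

Lemma lhol_subset (S S' : U -> Prop) (f : U -> C) :
  (forall q, S' q -> S q) -> lhol S f -> lhol S' f.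
Proof. intros H Hf eps He. destruct (Hf eps He) as [g [G1 G2]]. exists g; split; auto. Qed.

Lemma line_identity (S : U -> Prop) (f : U -> C) (q v : U) (rho : R) :
  lhol S f -> (forall z, Cmod z < 2 -> S (line q v z)) -> 0 < rho ->
  (forall z, Cmod z < rho -> f (line q v z) = 0) -> f (line q v 1) = 0.
Proof.
  intros Hf HS Hrho Hz.
  apply (disc_identity (fun z => f (line q v z)) rho); auto.
  intros eps He. destruct (Hf eps He) as [g [G1 G2]].
  exists (fun z => g (line q v z)). split.
  - intros z Hz2. destruct (G1 _ (HS z Hz2) v) as [l Hl]. exists l.
    intros e1 He1. destruct (Hl e1 He1) as [d [Hd K]]. exists d; split; auto.
    intros w Hw. specialize (K w Hw). rewrite !line_line, Cplus_0_l, Cplus_0_r in K. exact K.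
  - intros z Hz2. apply G2. auto.
Qed.

(** The points [q0] and [q2] are less than [2 * r] apart, and the disc of radius 2 on the line
    through them strays at most [4 * r] from [q0], which is itself within [r] of [q]: hence
    [5 * r]. *)
Lemma vanish_spread (f : U -> C) (q q0 q2 : U) (r : R) :
  lhol (fun q' => ndist q q' < 5 * r) f ->
  ndist q q0 < r -> vanish_near f q0 -> ndist q q2 < r -> f q2 = 0.
Proof.
  intros Hf H0 [rho [Hrho Hv]] H2.
  rewrite <- (line_end q0 q2).
  set (v := minus q2 q0).
  assert (Hnv : norm v < 2 * r).
  { change (ndist q0 q2 < 2 * r). pose proof (ndist_triangle q0 q q2).
    rewrite (ndist_sym q0 q) in H. lra. }
  pose proof (norm_ge_0 v) as Hv0.
  apply (line_identity (fun q' => ndist q q' < 5 * r) f q0 v (rho / (norm v + 1))); auto.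
  - intros z Hz. pose proof (ndist_triangle q q0 (line q0 v z)). pose proof (ndist_line q0 v z).
    assert (Cmod z * norm v <= 2 * norm v) by (apply Rmult_le_compat_r; lra). lra.
  - apply Rdiv_lt_0_compat; lra.
  - intros z Hz. apply Hv. eapply Rle_lt_trans. apply ndist_line.
    apply (Rmult_lt_compat_r (norm v + 1)) in Hz; [|lra].
    replace (rho / (norm v + 1) * (norm v + 1)) with rho in Hz by (field; lra).
    pose proof (Cmod_ge_0 z). nra.
Qed.

Lemma vanish_spread_near (f : U -> C) (q q0 q2 : U) (r : R) :
  lhol (fun q' => ndist q q' < 5 * r) f ->
  ndist q q0 < r -> vanish_near f q0 -> ndist q q2 < r -> vanish_near f q2.
Proof.
  intros Hf H0 Hv H2. exists (r - ndist q q2). split. lra.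
  intros q' Hq'. apply (vanish_spread f q q0 q' r); auto.
  pose proof (ndist_triangle q q2 q'). lra.
Qed.

Definition seg (p q : U) (T : R) : U := line p (minus q p) (RtoC T).

Lemma seg_chain (P : U -> Prop) (p q : U) :
  (forall T, 0 <= T <= 1 -> exists d, 0 < d /\ forall q1 q2,
     ndist (seg p q T) q1 < d -> ndist (seg p q T) q2 < d -> P q1 -> P q2) ->
  P p -> P q.
Proof.
  intros H Pp.
  rewrite <- (line_end p q). change (P (seg p q 1)).
  apply (interval_chain (fun T => P (seg p q T))).
  - intros T HT. destruct (H T HT) as [d [Hd K]].
    set (n := norm (minus q p)).
    assert (Hn : 0 < n + 1) by (pose proof (norm_ge_0 (minus q p)); unfold n; lra).
    exists (d / (n + 1)). split. apply Rdiv_lt_0_compat; lra.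
    assert (X : forall T1, Rabs (T1 - T) < d / (n + 1) -> ndist (seg p q T) (seg p q T1) < d).
    { intros T1 H1. eapply Rle_lt_trans. apply ndist_line_line. fold n.
      rewrite <- RtoC_minus, Cmod_R.
      apply (Rmult_lt_compat_r (n + 1)) in H1; [|lra].
      replace (d / (n + 1) * (n + 1)) with d in H1 by (field; lra).
      pose proof (Rabs_pos (T1 - T)). lra. }
    intros T1 T2 _ _ H1 H2 HP. apply (K (seg p q T1) (seg p q T2)); auto.
  - unfold seg. rewrite line_0. exact Pp.
Qed.

Lemma vanish_global (S : U -> Prop) (f : U -> C) (p q : U) :
  (forall T, 0 <= T <= 1 -> S (seg p q T)) ->
  (forall q', S q' -> lhol_at f q') ->
  vanish_near f p -> vanish_near f q.
Proof.
  intros HS Hf Hp. apply (seg_chain (vanish_near f) p q); auto.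
  intros T HT. destruct (Hf _ (HS T HT)) as [r [Hr Hl]].
  exists (r / 5). split. lra. intros q1 q2 H1 H2 V1.
  apply (vanish_spread_near f (seg p q T) q1 q2 (r / 5)); auto.
  eapply lhol_subset; [|exact Hl]. intros q'. simpl. lra.
Qed.

Lemma ball_of_ndist (p q : U) (e : R) : ndist p q < e -> ball p e q.
Proof. intros H. apply (norm_compat1 p q e). exact H. Qed.

Lemma locally_ndist (p : U) (P : U -> Prop) :
  locally p P -> exists r, 0 < r /\ forall q, ndist p q < r -> P q.
Proof.
  intros [e He]. exists e. split. apply cond_pos. intros q Hq. apply He. apply ball_of_ndist.
  exact Hq.
Qed.

Lemma ex_filterdiff_cont (F : U -> C) (p : U) :
  ex_filterdiff F (locally p) ->
  forall eps, 0 < eps -> exists d, 0 < d /\ forall q, ndist p q < d -> Cmod (F q - F p) < eps.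
Proof.
  intros HF eps He.
  assert (Hc : continuous F p).
  { exact (@filterdiff_continuous C_AbsRing U C_NormedModule F p HF). }
  (* A [ball] of [C] is a square; it fits into a disc whose radius is [sqrt 2] times as large, and 2
     covers that factor. *)
  assert (He2 : 0 < eps / 2) by lra.
  assert (HB : locally (F p) (fun y : C => Cmod (y - F p) < eps)).
  { exists (mkposreal _ He2). intros y Hy.
    assert (K := C_NormedModule_mixin_compat2 (F p) y (mkposreal _ He2) Hy). simpl in K.
    change (Cmod (y - F p) < sqrt 2 * (eps / 2)) in K.
    assert (sqrt 2 <= 2). { rewrite <- (sqrt_pow2 2) at 2 by lra. apply sqrt_le_1_alt. lra. }
    nra. }
  apply (locally_ndist p (fun q => Cmod (F q - F p) < eps)).
  exact (Hc _ HB).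
Qed.

Lemma holomorphic_at_diff (F : U -> C) (p : U) :
  holomorphic_at F p -> ex_filterdiff F (locally p).
Proof. intros H. apply (locally_singleton _ _ H). Qed.

Lemma holomorphic_lhol_at (F : U -> C) (p : U) : holomorphic_at F p -> lhol_at F p.
Proof.
  intros H. destruct (locally_ndist p _ H) as [r [Hr K]].
  exists r. split; auto. intros eps He. exists F. split.
  - intros q Hq v. apply ex_filterdiff_line. auto.
  - intros q _. unfold Cminus. rewrite Cplus_opp_r, Cmod_0. lra.
Qed.

Lemma nonzero_near (h : U -> C) (q : U) :
  ex_filterdiff h (locally q) -> h q <> 0 ->
  exists d, 0 < d /\ forall q', ndist q q' < d -> h q' <> 0.
Proof.
  intros Hh Hn. assert (Hp : 0 < Cmod (h q)) by (apply Cmod_gt_0; auto).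
  destruct (ex_filterdiff_cont h q Hh (Cmod (h q)) Hp) as [d [Hd K]].
  exists d. split; auto. intros q' Hq' E. specialize (K q' Hq'). rewrite E in K.
  replace (0 - h q)%C with (- h q)%C in K by ring. rewrite Cmod_opp in K. lra.
Qed.

(** Equality near [q] itself would be too strong, since a representative of a meromorphic function
    is arbitrary where its denominators vanish. Agreement on balls arbitrarily close to [q] ignores
    such points and still determines the function. *)
Definition agree_close (F G : U -> C) (q : U) : Prop :=
  forall rho, 0 < rho -> exists q' d, 0 < d /\ ndist q q' < rho /\
    forall q'', ndist q' q'' < d -> F q'' = G q''.

(** Inside a ball the numerator and denominator are holomorphic; convexity lets zeros be carried
    along a segment without leaving it. *)
Hypothesis ball_convex : forall (p : U) (e : R) (q0 q1 : U),
  ball p e q0 -> ball p e q1 -> forall T, 0 <= T <= 1 -> ball p e (seg q0 q1 T).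

(** Locally [F = g / h], so the difference is cleared of its denominator: [g - G * h] is a uniform
    limit of differentiable functions, vanishes on a small ball near one point, and therefore on a
    whole neighbourhood. Division by [h] is possible on balls arbitrarily close to each point. *)
Lemma meromorphic_continuation (F G : U -> C) (S : U -> Prop) (p q : U) :
  meromorphic F ->
  (forall T, 0 <= T <= 1 -> S (seg p q T)) ->
  (forall q', S q' -> lhol_at G q') ->
  agree_close F G p -> agree_close F G q.
Proof.
  intros HF HS HG Hp.
  apply (seg_chain (agree_close F G) p q); auto.
  intros T HT. set (c := seg p q T).
  destruct (HF c) as [e [g [h [Hgh [Hnz Hq]]]]].
  destruct (HG c (HS T HT)) as [r1 [Hr1 LG]].
  (* The bound [M] on [h] turns a uniform approximation of [G] into one of [G * h]. *)
  assert (HB : exists r M, 0 < r /\ 0 < M /\ 5 * r <= r1 /\ 5 * r <= e /\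
      forall q', ndist c q' < 5 * r -> Cmod (h q') <= M).
  { destruct (Hgh c (ball_center c e)) as [_ Hh].
    destruct (ex_filterdiff_cont h c (holomorphic_at_diff h c Hh) 1 Rlt_0_1) as [d [Hd K]].
    exists (Rmin (Rmin r1 e) d / 5), (Cmod (h c) + 1).
    pose proof (cond_pos e). pose proof (Cmod_ge_0 (h c)).
    Rmin_bounds.
    assert (0 < Rmin (Rmin r1 e) d) by (repeat apply Rmin_pos; auto).
    repeat split; try lra. intros q' Hq'.
    specialize (K q' ltac:(lra)).
    replace (h q') with ((h q' - h c) + h c)%C by ring.
    eapply Rle_trans. apply Cmod_triangle. lra. }
  destruct HB as [r [M [Hr [HM [Hrr1 [Hre HhM]]]]]].
  assert (Hin : forall q', ndist c q' < 5 * r -> ball c e q').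
  { intros q' Hq'. apply ball_of_ndist. lra. }
  (* The zeros of [h] have empty interior: otherwise [h] would vanish on the whole ball, also at the
     point where it is known to be nonzero. *)
  assert (Hdense : forall q', ndist c q' < 5 * r -> ~ vanish_near h q').
  { intros q' Hq' V. destruct Hnz as [q0 [Hq0 Hn]].
    assert (V0 : vanish_near h q0).
    { apply (vanish_global (ball c e) h q' q0); auto.
      intros q2 Hq2. apply holomorphic_lhol_at. apply Hgh. exact Hq2. }
    destruct V0 as [d [Hd V0]]. apply Hn. apply V0. rewrite ndist_refl. exact Hd. }
  assert (Hpick : forall q' rho, ndist c q' < 5 * r -> 0 < rho ->
     exists q'' d, 0 < d /\ ndist q' q'' < rho /\ ndist c q'' < 5 * r /\
       forall q3, ndist q'' q3 < d -> h q3 <> 0 /\ ball c e q3).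
  { intros q' rho Hq' Hrho.
    assert (N : exists q'', ndist q' q'' < Rmin rho (5 * r - ndist c q') /\ h q'' <> 0).
    { apply NNPP. intros N. apply (Hdense q' Hq'). exists (Rmin rho (5 * r - ndist c q')).
      split. apply Rmin_pos; lra. intros q3 H3. apply NNPP. intros N3. apply N. exists q3. auto. }
    destruct N as [q'' [N1 N2]].
    Rmin_bounds.
    pose proof (ndist_triangle c q' q'').
    assert (Hc : ndist c q'' < 5 * r) by lra.
    destruct (Hgh q'' (Hin q'' Hc)) as [_ Hh].
    destruct (nonzero_near h q'' (holomorphic_at_diff h q'' Hh) N2) as [d [Hd K]].
    exists q'', (Rmin d (5 * r - ndist c q'')). split. apply Rmin_pos; lra. split. lra. split. auto.
    intros q3 H3. split. apply K. eapply Rlt_le_trans; [exact H3|apply Rmin_l].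
    apply Hin. pose proof (ndist_triangle c q'' q3). Rmin_bounds. lra. }
  set (f := fun q' => (g q' - G q' * h q')%C).
  assert (Lf : lhol (fun q' => ndist c q' < 5 * r) f).
  { intros eps He.
    destruct (LG (eps / M)) as [G' [D1 D2]]. apply Rdiv_lt_0_compat; lra.
    exists (fun q' => (g q' - G' q' * h q')%C). split.
    - intros q' Hq' v. destruct (Hgh q' (Hin q' Hq')) as [Kg Kh].
      apply cdiff_minus. apply ex_filterdiff_line, holomorphic_at_diff, Kg.
      apply cdiff_mult. apply D1. lra. apply ex_filterdiff_line, holomorphic_at_diff, Kh.
    - intros q' Hq'. unfold f.
      replace (g q' - G q' * h q' - (g q' - G' q' * h q'))%C with (- ((G q' - G' q') * h q'))%C by ring.
      rewrite Cmod_opp, Cmod_mult.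
      apply Rle_trans with (eps / M * M). apply Rmult_le_compat; try apply Cmod_ge_0.
      apply D2; lra. apply HhM; lra. right. field. lra. }
  exists (r / 2). split. lra. intros q1 q2 H1 H2 A1.
  destruct (A1 (r / 2)) as [qa [d [Hd [Ha Ka]]]]. lra.
  assert (Hca : ndist c qa < r) by (pose proof (ndist_triangle c q1 qa); lra).
  destruct (Hpick qa (Rmin d (r - ndist c qa))) as [qb [db [Hdb [Hab [Hcb Kb]]]]]. lra.
  apply Rmin_pos; lra.
  Rmin_bounds.
  assert (Vb : vanish_near f qb).
  { exists (Rmin db (d - ndist qa qb)). split. apply Rmin_pos; lra.
    intros q3 H3. Rmin_bounds.
    destruct (Kb q3) as [N3 B3]. lra.
    pose proof (ndist_triangle qa qb q3).
    unfold f. rewrite <- (Ka q3) by lra. rewrite (Hq q3 B3 N3). field. exact N3. }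
  intros rho Hrho.
  destruct (Hpick q2 (Rmin rho (r / 2))) as [qc [dc [Hdc [Hac [Hcc Kc]]]]]. lra.
  apply Rmin_pos; lra.
  Rmin_bounds.
  assert (Hcr : ndist c qc < r) by (pose proof (ndist_triangle c q2 qc); lra).
  exists qc, (Rmin dc (r - ndist c qc)). split. apply Rmin_pos; lra. split. lra.
  intros q3 Hq3. Rmin_bounds.
  destruct (Kc q3) as [N3 B3]. lra.
  assert (Z : f q3 = 0).
  { apply (vanish_spread f c qb q3 r); auto. pose proof (ndist_triangle c qa qb). lra.
    pose proof (ndist_triangle c qc q3). lra. }
  rewrite (Hq q3 B3 N3). unfold f in Z.
  replace (g q3) with (g q3 - G q3 * h q3 + G q3 * h q3)%C by ring. rewrite Z. field. exact N3.
Qed.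
End Lines.

Lemma C_ball_convex (p : C) (e : R) (q0 q1 : C) (T : R) :
  ball p e q0 -> ball p e q1 -> 0 <= T <= 1 ->
  ball (M := C_UniformSpace) p e (q0 + RtoC T * (q1 - q0))%C.
Proof.
  intros [A1 A2] [B1 B2] HT.
  assert (X : forall a b c : R, Rabs (b - a) < e -> Rabs (c - a) < e -> Rabs (b + T * (c - b) - a) < e).
  { intros a b c Hb Hc. apply Rabs_lt_between in Hb. apply Rabs_lt_between in Hc.
    apply Rabs_lt_between. destruct (Rle_dec b c) as [L|L].
    assert (0 <= T * (c - b) <= c - b) by nra. lra.
    assert (0 <= T * (b - c) <= b - c) by nra. lra. }
  destruct p as [a b], q0 as [c d], q1 as [c' d'].
  split.
  - change (Rabs (c + (T * (c' + - c) - 0 * (d' + - d)) - a) < e).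
    replace (c + (T * (c' + - c) - 0 * (d' + - d)) - a) with (c + T * (c' - c) - a) by ring.
    apply X; auto.
  - change (Rabs (d + (T * (d' + - d) + 0 * (c' + - c)) - b) < e).
    replace (d + (T * (d' + - d) + 0 * (c' + - c)) - b) with (d + T * (d' - d) - b) by ring.
    apply X; auto.
Qed.

Notation C3 := (prod_NormedModule C_AbsRing (prod_NormedModule C_AbsRing C_NormedModule C_NormedModule) C_NormedModule).

Lemma C3_ball_convex (p : C3) (e : R) (q0 q1 : C3) :
  ball p e q0 -> ball p e q1 -> forall T, 0 <= T <= 1 -> ball p e (seg q0 q1 T).
Proof.
  intros [[A1 A2] A3] [[B1 B2] B3] T HT.
  split. split.
  - exact (C_ball_convex _ _ _ _ T A1 B1 HT).
  - exact (C_ball_convex _ _ _ _ T A2 B2 HT).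
  - exact (C_ball_convex _ _ _ _ T A3 B3 HT).
Qed.

(** * Real series *)

Lemma INR_S_pos (n : nat) : 0 < INR (S n).
Proof. apply lt_0_INR. lia. Qed.

Lemma INR_S_ge_1 (n : nat) : 1 <= INR (S n).
Proof. rewrite S_INR. pose proof (pos_INR n). lra. Qed.

Lemma ln_le_sub_1 (x : R) : 0 < x -> ln x <= x - 1.
Proof.
  intros Hx. pose proof (exp_ineq1_le (ln x)). rewrite exp_ln in H by auto. lra.
Qed.

Lemma ln_diff_le (a b : R) : 0 < a -> 0 < b -> ln b - ln a <= (b - a) / a.
Proof.
  intros Ha Hb. rewrite <- ln_div by auto.
  eapply Rle_trans. apply ln_le_sub_1. apply Rdiv_lt_0_compat; auto. right. field. lra.
Qed.

Lemma ln_diff_ge (a b : R) : 0 < a -> 0 < b -> (b - a) / b <= ln b - ln a.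
Proof.
  intros Ha Hb. pose proof (ln_diff_le b a Hb Ha).
  replace ((b - a) / b) with (- ((a - b) / b)) by (field; lra). lra.
Qed.

Lemma sum_Sn_R (a : nat -> R) (n : nat) : sum_n a (S n) = sum_n a n + a (S n).
Proof. exact (sum_Sn a n). Qed.

Lemma ex_series_nonneg_bounded (a : nat -> R) (M : R) :
  (forall n, 0 <= a n) -> (forall N, sum_n a N <= M) -> ex_series a.
Proof.
  intros Ha HM. destruct (ex_finite_lim_seq_incr (sum_n a) M) as [l Hl].
  - intros n. rewrite sum_Sn_R. specialize (Ha (S n)). simpl. lra.
  - exact HM.
  - exists l. exact Hl.
Qed.

Lemma sum_n_le_Series (a : nat -> R) (N : nat) :
  (forall n, 0 <= a n) -> ex_series a -> sum_n a N <= Series a.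
Proof.
  intros Ha [l Hl]. rewrite (is_series_unique _ _ Hl).
  apply (is_lim_seq_incr_compare (sum_n a) l). exact Hl.
  intros n. rewrite sum_Sn_R. specialize (Ha (S n)). simpl. lra.
Qed.

Lemma ex_series_le_R (a b : nat -> R) :
  (forall n, Rabs (a n) <= b n) -> ex_series b -> ex_series a.
Proof. intros H Hb. apply (@ex_series_le R_AbsRing R_CompleteNormedModule a b H Hb). Qed.

Lemma ex_series_scal_R (c : R) (a : nat -> R) : ex_series a -> ex_series (fun n => c * a n).
Proof. intros H. exact (ex_series_scal_l c a H). Qed.

(** The integral test in telescoped form: with [c = a - 1], the term at [y = x + 1] is at most
    [(x ^ (- c) - y ^ (- c)) / c], by [1 / y <= ln y - ln x] and [1 + u <= exp u]. *)
Lemma ex_series_Rpower (a : R) : 1 < a -> ex_series (fun n => Rpower (INR (S n)) (- a)).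
Proof.
  intros Ha. set (c := a - 1). assert (Hc : 0 < c) by (unfold c; lra).
  apply ex_series_incr_1.
  apply (ex_series_nonneg_bounded _ (/ c)).
  { intros n. left. apply exp_pos. }
  assert (H : forall N, sum_n (fun k => Rpower (INR (S (S k))) (- a)) N
     <= / c * (1 - Rpower (INR (S (S N))) (- c))).
  { assert (St : forall n, Rpower (INR (S (S n))) (- a)
       <= / c * (Rpower (INR (S n)) (- c) - Rpower (INR (S (S n))) (- c))).
    { intros n. pose proof (INR_S_pos n) as P1. pose proof (INR_S_pos (S n)) as P2.
      set (x := INR (S n)) in *. set (y := INR (S (S n))) in *.
      assert (Exy : y = x + 1) by (unfold x, y; rewrite !S_INR; ring).
      assert (E1 : Rpower y (- a) = Rpower y (- c) * / y).
      { unfold c. replace (- a) with (- (a - 1) + - (1)) by ring.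
        rewrite Rpower_plus, (Rpower_Ropp y 1), Rpower_1; auto. }
      assert (E2 : Rpower x (- c) = Rpower y (- c) * exp (c * (ln y - ln x))).
      { unfold Rpower. rewrite <- exp_plus. f_equal. ring. }
      rewrite E1, E2.
      assert (Q : / y <= / c * (exp (c * (ln y - ln x)) - 1)).
      { apply Rle_trans with (ln y - ln x).
        replace (/ y) with ((y - x) / y) by (rewrite Exy; field; lra). apply ln_diff_ge; auto.
        pose proof (exp_ineq1_le (c * (ln y - ln x))).
        apply (Rmult_le_reg_l c); auto. rewrite <- Rmult_assoc, Rinv_r by lra. lra. }
      assert (0 < Rpower y (- c)) by apply exp_pos. nra. }
    induction N.
    - rewrite sum_O. specialize (St 0%nat). simpl (INR 1) in St.
      replace (Rpower 1 (- c)) with 1 in St. exact St.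
      unfold Rpower. rewrite ln_1, Rmult_0_r, exp_0. reflexivity.
    - rewrite sum_Sn_R.
      specialize (St (S N)). lra. }
  intros N. eapply Rle_trans. apply H. assert (0 < / c) by (apply Rinv_0_lt_compat; lra).
  assert (0 < Rpower (INR (S (S N))) (- c)) by apply exp_pos. nra.
Qed.

Lemma ex_series_inv_sq : ex_series (fun n => / (INR (S n)) ^ 2).
Proof.
  apply ex_series_ext with (fun n => Rpower (INR (S n)) (- (2))).
  intros n. rewrite Rpower_Ropp. f_equal. rewrite <- (Rpower_pow 2). simpl. f_equal.
  apply INR_S_pos.
  apply ex_series_Rpower. lra.
Qed.

Lemma ln_le_harmonic (n : nat) : ln (INR (S (S n))) <= sum_n (fun k => / INR (S k)) n.
Proof.
  assert (St : forall n, ln (INR (S (S n))) - ln (INR (S n)) <= / INR (S n)).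
  { intros k. pose proof (ln_diff_le (INR (S k)) (INR (S (S k))) (INR_S_pos k) (INR_S_pos (S k))).
    replace ((INR (S (S k)) - INR (S k)) / INR (S k)) with (/ INR (S k)) in H. exact H.
    rewrite (S_INR (S k)). field. pose proof (INR_S_pos k). lra. }
  induction n. rewrite sum_O. specialize (St 0%nat). simpl (INR 1) in *. rewrite ln_1 in St. lra.
  rewrite sum_Sn_R. specialize (St (S n)). lra.
Qed.

(** [Lim_seq] is total, so convergence has to be shown: the sequence decreases and, by comparison of
    the harmonic sum with the logarithm, is bounded below by 0. *)
Lemma euler_gamma_lim :
  is_lim_seq (fun n => sum_n (fun k => / INR (S k)) n - ln (INR (S n))) euler_gamma.
Proof.
  set (u := fun n => sum_n (fun k => / INR (S k)) n - ln (INR (S n))).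
  destruct (ex_finite_lim_seq_decr u 0) as [l Hl].
  - intros n. unfold u. rewrite sum_Sn_R.
    pose proof (ln_diff_ge (INR (S n)) (INR (S (S n))) (INR_S_pos n) (INR_S_pos (S n))).
    replace ((INR (S (S n)) - INR (S n)) / INR (S (S n))) with (/ INR (S (S n))) in H. lra.
    rewrite (S_INR (S n)). field. rewrite <- S_INR. pose proof (INR_S_pos (S n)). lra.
  - intros n. unfold u. pose proof (ln_le_harmonic n) as H.
    assert (ln (INR (S n)) <= ln (INR (S (S n)))).
    { left. apply ln_increasing. apply INR_S_pos. rewrite (S_INR (S n)). lra. } lra.
  - change (is_lim_seq u (real (Lim_seq u))). rewrite (is_lim_seq_unique _ _ Hl). exact Hl.
Qed.

(** A second-order bound with summable constants, uniform in [h], controls the difference quotient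
    of the sum directly; no uniform convergence of derivatives is involved. *)
Lemma is_derive_Series (f : nat -> R -> R) (d M : nat -> R) (a delta : R) :
  0 < delta ->
  (forall x, Rabs (x - a) < delta -> ex_series (fun n => f n x)) ->
  ex_series d -> ex_series M ->
  (forall n h, Rabs h < delta -> Rabs (f n (a + h) - f n a - h * d n) <= h ^ 2 * M n) ->
  is_derive (fun x => Series (fun n => f n x)) a (Series d).
Proof.
  intros Hd Hf Hd' HM Hb.
  assert (HMp : 0 <= Series M).
  { apply Rle_trans with (Rabs (Series M)). apply Rabs_pos.
    assert (Mp : forall n, 0 <= M n).
    { intros n. specialize (Hb n (delta / 2)). rewrite Rabs_right in Hb by lra.
      specialize (Hb ltac:(lra)).
      pose proof (Rabs_pos (f n (a + delta / 2) - f n a - delta / 2 * d n)).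
      assert (0 < (delta / 2) ^ 2) by (apply pow_lt; lra). nra. }
    rewrite Rabs_right. lra. apply Rle_ge.
    replace 0 with (sum_n (fun _ : nat => 0) 0) by apply sum_O.
    eapply Rle_trans; [|apply (sum_n_le_Series M 0); auto]. rewrite !sum_O. apply Mp. }
  apply is_derive_Reals. intros eps He.
  assert (Hp : 0 < Rmin delta (eps / (Series M + 1))).
  { apply Rmin_pos; auto. apply Rdiv_lt_0_compat; lra. }
  exists (mkposreal _ Hp). intros h Hn Hh. simpl in Hh.
  assert (H1 : Rabs h < delta) by (eapply Rlt_le_trans; [exact Hh|apply Rmin_l]).
  assert (H2 : Rabs h < eps / (Series M + 1)) by (eapply Rlt_le_trans; [exact Hh|apply Rmin_r]).
  assert (X0 : ex_series (fun n => f n a)) by (apply Hf; rewrite Rminus_diag, Rabs_R0; auto).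
  assert (X1 : ex_series (fun n => f n (a + h))) by (apply Hf; replace (a + h - a) with h by ring; auto).
  assert (X2 : ex_series (fun n => h * d n)) by (apply (ex_series_scal_R h d Hd')).
  assert (X3 : ex_series (fun n => f n (a + h) - f n a)) by (apply (ex_series_minus (fun n => f n (a + h)) (fun n => f n a)); auto).
  assert (E : Series (fun n => f n (a + h)) - Series (fun n => f n a) - h * Series d
     = Series (fun n => f n (a + h) - f n a - h * d n)).
  { rewrite (Series_minus (fun n => f n (a + h) - f n a) (fun n => h * d n)) by auto.
    rewrite Series_minus by auto. rewrite Series_scal_l. reflexivity. }
  assert (XM : ex_series (fun n => h ^ 2 * M n)) by (apply (ex_series_scal_R (h ^ 2) M HM)).
  assert (B : Rabs (Series (fun n => f n (a + h)) - Series (fun n => f n a) - h * Series d) <= h ^ 2 * Series M).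
  { rewrite E. eapply Rle_trans. apply Series_Rabs.
    apply (ex_series_le_R _ (fun n => h ^ 2 * M n)). intros n. rewrite Rabs_Rabsolu. apply Hb; auto.
    exact XM.
    rewrite <- Series_scal_l. apply Series_le; auto. intros n. split. apply Rabs_pos.
    apply Hb; auto. }
  replace ((Series (fun n => f n (a + h)) - Series (fun n => f n a)) / h - Series d)
    with ((Series (fun n => f n (a + h)) - Series (fun n => f n a) - h * Series d) / h) by (field; auto).
  unfold Rdiv. rewrite Rabs_mult, Rabs_inv.
  apply Rle_lt_trans with (h ^ 2 * Series M * / Rabs h).
  apply Rmult_le_compat_r. left. apply Rinv_0_lt_compat, Rabs_pos_lt; auto. exact B.
  assert (Hah : 0 < Rabs h) by (apply Rabs_pos_lt; auto).
  rewrite <- (pow2_abs h).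
  replace (Rabs h ^ 2 * Series M * / Rabs h) with (Rabs h * Series M) by (field; lra).
  apply (Rmult_lt_compat_r (Series M + 1)) in H2; [|lra].
  replace (eps / (Series M + 1) * (Series M + 1)) with eps in H2 by (field; lra). nra.
Qed.

(** Induction from [1 / b - 1 / (b + h) = h / (b * (b + h))]. The factors 2 in the constant come
    from [b + h >= 1 / 2]; the weight [/ b ^ 2] is what makes the errors summable for
    [b = n + a]. *)
Lemma inv_pow_taylor (p : nat) : exists K, 0 <= K /\ forall b h, 1 <= b -> Rabs h < / 2 ->
  Rabs (/ (b + h) ^ p - / b ^ p - h * (- INR p * / b ^ (S p))) <= h ^ 2 * (K * / b ^ 2).
Proof.
  induction p as [|p [K [HK IH]]].
  - exists 0. split. lra. intros b h Hb Hh. simpl.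
    replace (/ 1 - / 1 - h * (- 0 * / (b * 1))) with 0 by (field; lra). rewrite Rabs_R0. lra.
  - exists (2 * K + 2 * INR (S p)). split. pose proof (pos_INR (S p)). lra.
    intros b h Hb Hh. specialize (IH b h Hb Hh). apply Rabs_lt_between in Hh.
    set (u := / (b + h)). set (v := / b).
    assert (Hu : 0 < u <= 2).
    { unfold u. split. apply Rinv_0_lt_compat; lra. rewrite <- (Rinv_inv 2).
      apply Rinv_le_contravar; lra. }
    assert (Hv : 0 < v <= 1).
    { unfold v. split. apply Rinv_0_lt_compat; lra. rewrite <- Rinv_1.
      apply Rinv_le_contravar; lra. }
    rewrite <- !pow_inv in IH. rewrite <- !pow_inv. fold u v in IH. fold u v.
    assert (Euv : v - u = h * u * v) by (unfold u, v; field; split; lra).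
    replace (u ^ S p - v ^ S p - h * (- INR (S p) * v ^ S (S p)))
      with (u * (u ^ p - v ^ p - h * (- INR p * v ^ S p)) + INR (S p) * h ^ 2 * v ^ 2 * u * v ^ p).
    2:{ rewrite S_INR. simpl pow. apply Rminus_diag_uniq.
        transitivity (v ^ p * ((INR p + 1) * h * v) * (u + h * u * v - v) + v ^ p * ((v - u) - h * u * v)).
        ring. rewrite Euv. replace (u + h * u * v - v) with 0 by lra. ring. }
    assert (Hvp : 0 <= v ^ p <= 1).
    { split. apply pow_le; lra. rewrite <- (pow1 p). apply pow_incr; lra. }
    pose proof (pos_INR (S p)) as HI.
    assert (H0 : 0 <= h ^ 2) by apply pow2_ge_0. assert (Hv2 : 0 <= v ^ 2) by apply pow2_ge_0.
    eapply Rle_trans. apply Rabs_triang. rewrite Rabs_mult, (Rabs_right u) by lra.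
    assert (T1 : u * Rabs (u ^ p - v ^ p - h * (- INR p * v ^ S p)) <= 2 * (h ^ 2 * (K * v ^ 2))).
    { apply Rmult_le_compat; [lra | apply Rabs_pos | lra | exact IH]. }
    assert (T2 : Rabs (INR (S p) * h ^ 2 * v ^ 2 * u * v ^ p) <= INR (S p) * h ^ 2 * v ^ 2 * 2).
    { assert (0 <= INR (S p) * h ^ 2 * v ^ 2) by (apply Rmult_le_pos; [apply Rmult_le_pos|]; assumption).
      rewrite Rabs_right. rewrite Rmult_assoc. apply Rmult_le_compat_l; auto. nra.
      apply Rle_ge. apply Rmult_le_pos; [apply Rmult_le_pos|]; lra. }
    lra.
Qed.

(** * The digamma and polygamma series *)

Lemma at_right_0_interval (c : R) : 0 < c -> at_right 0 (fun x => 0 < x <= c).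
Proof.
  intros Hc. exists (mkposreal c Hc). intros y Hy Hy0. change (Rabs (y - 0) < c) in Hy.
  rewrite Rminus_0_r, Rabs_right in Hy; lra.
Qed.

Lemma p_infty_ge (d : R) : Rbar_locally p_infty (fun x => d <= x).
Proof. exists d. intros; lra. Qed.

Lemma filter_prod_0_infty (P : R * R -> Prop) :
  (forall c d, 0 < c <= 1 -> 1 <= d -> P (c, d)) ->
  filter_prod (at_right 0) (Rbar_locally p_infty) P.
Proof.
  apply Filter_prod. apply at_right_0_interval; lra. apply p_infty_ge.
Qed.

(** For a nonnegative integrand the improper integral is the supremum of the integrals over compact
    intervals. *)
Lemma is_RInt_gen_nonneg (f : R -> R) (M : R) :
  (forall x, 0 < x -> continuous f x) -> (forall x, 0 < x -> 0 <= f x) ->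
  (forall c d, 0 < c <= d -> RInt f c d <= M) ->
  exists l, is_RInt_gen f (at_right 0) (Rbar_locally p_infty) l /\
    forall c d, 0 < c <= d -> RInt f c d <= l.
Proof.
  intros Hc Hp HM.
  assert (Ex : forall c d, 0 < c <= d -> ex_RInt f c d).
  { intros c d H. apply (ex_RInt_continuous f). intros x. rewrite Rmin_left, Rmax_right by lra.
    intros; apply Hc; lra. }
  assert (Mono : forall c c0 d0 d, 0 < c <= c0 -> c0 <= d0 -> d0 <= d -> RInt f c0 d0 <= RInt f c d).
  { intros c c0 d0 d H1 H2 H3.
    rewrite <- (RInt_Chasles f c c0 d) by (apply Ex; lra).
    rewrite <- (RInt_Chasles f c0 d0 d) by (apply Ex; lra).
    assert (0 <= RInt f c c0) by (apply RInt_ge_0; [lra|apply Ex; lra|intros; apply Hp; lra]).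
    assert (0 <= RInt f d0 d) by (apply RInt_ge_0; [lra|apply Ex; lra|intros; apply Hp; lra]).
    unfold plus; simpl. lra. }
  destruct (completeness (fun y => exists c d, 0 < c <= d /\ y = RInt f c d)) as [l [U L]].
  { exists M. intros y [c [d [H ->]]]. auto. }
  { exists (RInt f 1 1), 1, 1. split; auto. lra. }
  exists l. split.
  2:{ intros c d H. apply U. exists c, d. auto. }
  intros P [e He].
  assert (exists c0 d0, 0 < c0 <= d0 /\ l - e < RInt f c0 d0) as [c0 [d0 [H0 B0]]].
  { apply NNPP. intros N. assert (l <= l - e); [|pose proof (cond_pos e); lra].
    apply L. intros y [c [d [H ->]]]. apply Rnot_lt_le. intros K. apply N. exists c, d. auto. }
  apply (Filter_prod _ _ _ (fun x => 0 < x <= c0) (fun x => d0 <= x)).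
  apply at_right_0_interval; lra. apply p_infty_ge.
  intros c d Hcc Hdd. simpl. exists (RInt f c d). split.
  apply (RInt_correct f). apply Ex; lra.
  apply He. change (Rabs (RInt f c d - l) < e).
  assert (RInt f c d <= l) by (apply U; exists c, d; split; auto; lra).
  assert (RInt f c0 d0 <= RInt f c d) by (apply Mono; lra).
  apply Rabs_lt_between. pose proof (cond_pos e). lra.
Qed.

(** * Euler's integral: convergence, functional equation and logarithmic increments *)

Definition gamma_integrand (a u : R) : R := Rpower u (a - 1) * exp (- u).

Lemma gamma_integrand_pos (a u : R) : 0 < gamma_integrand a u.
Proof. apply Rmult_lt_0_compat; apply exp_pos. Qed.

Lemma gamma_integrand_continuous (a u : R) : 0 < u -> continuous (gamma_integrand a) u.
Proof.
  intros Hu. apply (ex_derive_continuous (gamma_integrand a)). unfold gamma_integrand, Rpower.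
  auto_derive. auto.
Qed.

Lemma gamma_integrand_decay (a : R) : 1 < a -> exists K, 0 < K /\ forall u, 0 < u ->
  gamma_integrand a u <= K * exp (- u / 2).
Proof.
  intros Ha. exists (exp ((a - 1) * ln (2 * (a - 1)))). split. apply exp_pos.
  intros u Hu. unfold gamma_integrand, Rpower. rewrite <- !exp_plus. apply exp_le_compat.
  assert (H : ln (u / (2 * (a - 1))) <= u / (2 * (a - 1))).
  { pose proof (ln_le_sub_1 (u / (2 * (a - 1)))).
    assert (0 < u / (2 * (a - 1))) by (apply Rdiv_lt_0_compat; lra). lra. }
  rewrite ln_div in H by lra.
  apply (Rmult_le_compat_l (a - 1)) in H; [|lra].
  replace ((a - 1) * (u / (2 * (a - 1)))) with (u / 2) in H by (field; lra). lra.
Qed.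

(** The range [1 < a] covers all arguments [m x + 1] that occur; there the exponential bound holds
    down to 0 and serves both ends of the integral. *)
Lemma Gamma_spec (a : R) : 1 < a ->
  is_RInt_gen (gamma_integrand a) (at_right 0) (Rbar_locally p_infty) (Gamma a) /\ 0 < Gamma a.
Proof.
  intros Ha. destruct (gamma_integrand_decay a Ha) as [K [HK B]].
  assert (Ex : forall c d, 0 < c <= d -> ex_RInt (gamma_integrand a) c d).
  { intros c d H. apply (ex_RInt_continuous (gamma_integrand a)). intros x.
    rewrite Rmin_left, Rmax_right by lra.
    intros; apply gamma_integrand_continuous; lra. }
  destruct (is_RInt_gen_nonneg (gamma_integrand a) (2 * K)) as [l [Hl Hsup]].
  - intros; apply gamma_integrand_continuous; auto.
  - intros; left; apply gamma_integrand_pos.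
  - intros c d H.
    assert (I : is_RInt (fun u => K * exp (- u / 2)) c d
      (minus (- 2 * K * exp (- d / 2)) (- 2 * K * exp (- c / 2)))).
    { apply (is_RInt_derive (fun u => - 2 * K * exp (- u / 2))).
      - intros x _. auto_derive; auto. unfold Rdiv. field.
      - intros x _. apply (ex_derive_continuous (fun u => K * exp (- u / 2))). auto_derive. auto. }
    apply Rle_trans with (RInt (fun u => K * exp (- u / 2)) c d).
    apply RInt_le. lra. apply Ex; auto. eexists; exact I. intros; apply B; lra.
    rewrite (is_RInt_unique _ _ _ _ I). unfold minus, plus, opp; simpl.
    pose proof (exp_pos (- d / 2)).
    assert (exp (- c / 2) <= 1) by (rewrite <- exp_0; apply exp_le_compat; lra). nra.
  - assert (E : Gamma a = l).
    { unfold Gamma. apply (is_RInt_gen_unique (gamma_integrand a)). exact Hl. }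
    rewrite E. split. exact Hl.
    apply Rlt_le_trans with (RInt (gamma_integrand a) 1 2); [|apply Hsup; lra].
    apply RInt_gt_0. lra. intros; apply gamma_integrand_pos.
    intros x Hx. apply gamma_integrand_continuous; lra.
Qed.

Lemma Gamma_succ (a : R) : 1 < a -> Gamma (a + 1) = a * Gamma a.
Proof.
  intros Ha.
  destruct (Gamma_spec a Ha) as [I0 _]. destruct (Gamma_spec (a + 1) ltac:(lra)) as [I1 _].
  (* Integration by parts: [phi] tends to 0 at both ends, and its derivative is the difference of
     the two integrands. *)
  set (phi := fun u => - (Rpower u a * exp (- u))).
  assert (Dphi : forall u, 0 < u -> is_derive phi u (gamma_integrand (a + 1) u - a * gamma_integrand a u)).
  { intros u Hu. unfold phi, gamma_integrand, Rpower. auto_derive. auto.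
    replace (a + 1 - 1) with a by ring.
    assert (E : exp ((a - 1) * ln u) = exp (a * ln u) * / u).
    { replace ((a - 1) * ln u) with (a * ln u + - ln u) by ring.
      rewrite exp_plus, (exp_Ropp (ln u)), exp_ln by auto. reflexivity. }
    rewrite E. field. lra. }
  assert (J : is_RInt_gen (Derive phi) (at_right 0) (Rbar_locally p_infty) (0 - 0)).
  { apply is_RInt_gen_Derive; try apply _.
    - apply filter_prod_0_infty.
      intros c d Hc Hd x. simpl. rewrite Rmin_left, Rmax_right by lra. intros Hx.
      eexists; apply Dphi; lra.
    - apply filter_prod_0_infty.
      intros c d Hc Hd x. simpl. rewrite Rmin_left, Rmax_right by lra. intros Hx.
      apply (continuous_ext_loc _ (fun u => gamma_integrand (a + 1) u - a * gamma_integrand a u)).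
      { assert (Hx0 : 0 < x) by lra. exists (mkposreal x Hx0). intros y Hy.
        change (Rabs (y - x) < x) in Hy.
        apply Rabs_lt_between in Hy. symmetry. apply is_derive_unique. apply Dphi. lra. }
      apply (continuous_minus (gamma_integrand (a + 1)) (fun u => a * gamma_integrand a u)).
      apply gamma_integrand_continuous; lra.
      apply (continuous_scal_r a (gamma_integrand a)). apply gamma_integrand_continuous; lra.
    - intros P [e He].
      assert (Hm : 0 < Rmin e 1 / 2) by (assert (0 < Rmin e 1) by (apply Rmin_pos; [apply cond_pos|lra]); lra).
      Rmin_bounds.
      change (at_right 0 (fun x => P (phi x))).
      apply (filter_imp (fun x => 0 < x <= Rmin e 1 / 2)); [|apply at_right_0_interval; exact Hm].
      intros x Hx. apply He. change (Rabs (phi x - 0) < e).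
      unfold phi. rewrite Rminus_0_r, Rabs_Ropp, Rabs_right.
      2:{ apply Rle_ge, Rmult_le_pos; left; apply exp_pos. }
      apply Rle_lt_trans with (x * 1); [|pose proof (cond_pos e); lra].
      apply Rmult_le_compat; try (left; apply exp_pos).
      unfold Rpower. rewrite <- (exp_ln x) at 2 by lra. apply exp_le_compat.
      assert (ln x <= 0). { rewrite <- ln_1. apply ln_le; lra. } nra.
      rewrite <- exp_0. apply exp_le_compat. lra.
    - destruct (gamma_integrand_decay (a + 1) ltac:(lra)) as [K [HK B]].
      intros P [e He]. change (Rbar_locally p_infty (fun x => P (phi x))).
      apply (filter_imp (fun x => Rmax 1 (4 * K / e) <= x)); [|apply p_infty_ge].
      intros x Hx. pose proof (Rmax_l 1 (4 * K / e)). pose proof (Rmax_r 1 (4 * K / e)).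
      pose proof (cond_pos e).
      apply He. change (Rabs (phi x - 0) < e).
      unfold phi. rewrite Rminus_0_r, Rabs_Ropp, Rabs_right.
      2:{ apply Rle_ge, Rmult_le_pos; left; apply exp_pos. }
      specialize (B x ltac:(lra)). unfold gamma_integrand in B.
      replace (a + 1 - 1) with a in B by ring.
      eapply Rle_lt_trans. exact B.
      assert (Ex : exp (- x / 2) < 2 / x).
      { replace (- x / 2) with (- (x / 2)) by field. rewrite exp_Ropp.
        replace (2 / x) with (/ (x / 2)) by (field; lra).
        apply Rinv_lt_contravar. apply Rmult_lt_0_compat. lra. apply exp_pos.
        pose proof (exp_ineq1_le (x / 2)). lra. }
      apply Rlt_le_trans with (K * (2 / x)). apply Rmult_lt_compat_l; auto.
      apply (Rmult_le_reg_r x). lra. replace (K * (2 / x) * x) with (2 * K) by (field; lra).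
      assert (4 * K <= e * x). { replace (4 * K) with (e * (4 * K / e)) by (field; lra).
        apply Rmult_le_compat_l; lra. } lra. }
  assert (J' : is_RInt_gen (fun u => gamma_integrand (a + 1) u - a * gamma_integrand a u)
     (at_right 0) (Rbar_locally p_infty) (0 - 0)).
  { apply (is_RInt_gen_ext (Derive phi)); auto.
    apply filter_prod_0_infty.
    intros c d Hc Hd x. simpl. rewrite Rmin_left, Rmax_right by lra. intros Hx.
    apply is_derive_unique. apply Dphi; lra. }
  assert (J2 : is_RInt_gen (fun u => gamma_integrand (a + 1) u - a * gamma_integrand a u)
     (at_right 0) (Rbar_locally p_infty) (Gamma (a + 1) - a * Gamma a)).
  { apply (is_RInt_gen_minus (gamma_integrand (a + 1)) (fun u => a * gamma_integrand a u)).
    exact I1.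
    apply (is_RInt_gen_scal (gamma_integrand a) a). exact I0. }
  pose proof (is_RInt_gen_unique (V := R_CompleteNormedModule) _ _ J') as E'.
  pose proof (is_RInt_gen_unique (V := R_CompleteNormedModule) _ _ J2) as E2.
  rewrite E' in E2. lra.
Qed.

(** The tangent line of the concave function [u^h] at [u = a]. *)
Lemma Gamma_shift_le (a h : R) : 1 < a -> 0 <= h <= 1 -> Gamma (a + h) <= Gamma a * Rpower a h.
Proof.
  intros Ha Hh.
  destruct (Gamma_spec a Ha) as [I0 P0]. destruct (Gamma_spec (a + 1) ltac:(lra)) as [I1 _].
  destruct (Gamma_spec (a + h) ltac:(lra)) as [Ih Ph].
  set (k := Rpower a h).
  assert (Ig : is_RInt_gen (fun u => ((1 - h) * k) * gamma_integrand a u + (h * k / a) * gamma_integrand (a + 1) u)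
     (at_right 0) (Rbar_locally p_infty) (((1 - h) * k) * Gamma a + (h * k / a) * Gamma (a + 1))).
  { apply (is_RInt_gen_plus (fun u => ((1 - h) * k) * gamma_integrand a u) (fun u => (h * k / a) * gamma_integrand (a + 1) u)).
    apply (is_RInt_gen_scal (gamma_integrand a)); auto.
    apply (is_RInt_gen_scal (gamma_integrand (a + 1))); auto. }
  replace (Gamma a * k) with (((1 - h) * k) * Gamma a + (h * k / a) * Gamma (a + 1))
    by (rewrite Gamma_succ by auto; field; lra).
  rewrite <- (Rabs_right (Gamma (a + h))) by lra.
  refine (RInt_gen_norm (V := R_CompleteNormedModule) (gamma_integrand (a + h))
    (fun u => ((1 - h) * k) * gamma_integrand a u + (h * k / a) * gamma_integrand (a + 1) u) _ _ _ _ Ih Ig).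
  - apply filter_prod_0_infty. simpl; intros; lra.
  - apply filter_prod_0_infty.
    intros c d Hc Hd u Hu. simpl in Hu.
    change (Rabs (gamma_integrand (a + h) u) <= (1 - h) * k * gamma_integrand a u + h * k / a * gamma_integrand (a + 1) u).
    rewrite Rabs_right by (left; apply gamma_integrand_pos).
    set (L := ln u - ln a).
    assert (E1 : gamma_integrand (a + h) u = gamma_integrand a u * k * exp (h * L)).
    { unfold gamma_integrand, k, Rpower, L. rewrite <- !exp_plus. f_equal. ring. }
    assert (E2 : gamma_integrand (a + 1) u = gamma_integrand a u * a * exp L).
    { unfold gamma_integrand, Rpower, L. rewrite <- (exp_ln a) at 3 by lra. rewrite <- !exp_plus.
      f_equal. ring. }
    rewrite E1, E2.
    (* Convexity of the exponential: its tangent at [h * L], evaluated at [L] and at 0 and averaged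
       with weights [h] and [1 - h]. *)
    assert (Q : exp (h * L) <= (1 - h) + h * exp L).
    { pose proof (exp_ineq1_le ((1 - h) * L)) as Q1. pose proof (exp_ineq1_le (- h * L)) as Q2.
      assert (X1 : exp L = exp (h * L) * exp ((1 - h) * L)) by (rewrite <- exp_plus; f_equal; ring).
      assert (X2 : 1 = exp (h * L) * exp (- h * L)) by (rewrite <- exp_plus, <- exp_0; f_equal; ring).
      pose proof (exp_pos (h * L)) as Ep.
      assert (Y1 : h * (exp (h * L) * (1 + (1 - h) * L)) <= h * exp L).
      { rewrite X1. apply Rmult_le_compat_l. lra. apply Rmult_le_compat_l; lra. }
      assert (Y2 : (1 - h) * (exp (h * L) * (1 + - h * L)) <= (1 - h) * 1).
      { rewrite X2. apply Rmult_le_compat_l. lra. apply Rmult_le_compat_l; lra. }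
      lra. }
    assert (0 < gamma_integrand a u * k) by (apply Rmult_lt_0_compat; [apply gamma_integrand_pos|apply exp_pos]).
    replace ((1 - h) * k * gamma_integrand a u + h * k / a * (gamma_integrand a u * a * exp L))
      with (gamma_integrand a u * k * ((1 - h) + h * exp L)) by (field; lra).
    apply Rmult_le_compat_l; lra.
Qed.

Lemma ln_Gamma_succ (a : R) : 1 < a -> ln (Gamma (a + 1)) = ln (Gamma a) + ln a.
Proof.
  intros Ha. rewrite Gamma_succ by auto. destruct (Gamma_spec a Ha). rewrite ln_mult by lra. ring.
Qed.

(** The upper half is [Gamma_shift_le] at [a]. The lower half is the same inequality for the step
    [1 - h] from [a + h] to [a + 1], where the functional equation gives [ln (Gamma (a + 1))]. *)
Lemma ln_Gamma_shift (a h : R) : 1 < a -> 0 <= h <= 1 ->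
  Rabs (ln (Gamma (a + h)) - ln (Gamma a) - h * ln a) <= h / a.
Proof.
  intros Ha Hh.
  assert (G : forall b k, 1 < b -> 0 <= k <= 1 -> ln (Gamma (b + k)) <= ln (Gamma b) + k * ln b).
  { intros b k Hb Hk. destruct (Gamma_spec b Hb) as [_ P0].
    destruct (Gamma_spec (b + k) ltac:(lra)) as [_ P1].
    rewrite <- ln_Rpower by lra. rewrite <- ln_mult; auto. 2: apply exp_pos.
    apply ln_le; auto. apply Gamma_shift_le; auto. }
  pose proof (G a h Ha Hh) as U.
  pose proof (G (a + h) (1 - h) ltac:(lra) ltac:(lra)) as L.
  replace (a + h + (1 - h)) with (a + 1) in L by ring. rewrite ln_Gamma_succ in L by auto.
  pose proof (ln_diff_le a (a + h) ltac:(lra) ltac:(lra)) as D.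
  replace ((a + h - a) / a) with (h / a) in D by (field; lra).
  assert (0 <= h / a) by (apply Rmult_le_pos; [lra|left; apply Rinv_0_lt_compat; lra]).
  apply Rabs_le_between. split.
  assert ((1 - h) * (ln (a + h) - ln a) <= h / a).
  { apply Rle_trans with ((1 - h) * (h / a)). apply Rmult_le_compat_l; lra. nra. }
  lra. lra.
Qed.

Lemma ln_Gamma_shift_abs (a h : R) : 2 < a -> Rabs h <= / 2 ->
  Rabs (ln (Gamma (a + h)) - ln (Gamma a) - h * ln a) <= 2 * Rabs h / (a - 1).
Proof.
  intros Ha Hh. destruct (Rle_dec 0 h) as [P|N].
  - rewrite (Rabs_right h) in * by lra. eapply Rle_trans. apply ln_Gamma_shift; lra.
    apply Rle_trans with (1 * h / (a - 1)).
    unfold Rdiv. rewrite Rmult_1_l. apply Rmult_le_compat_l; auto. apply Rinv_le_contravar; lra.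
    apply Rmult_le_compat_r. left; apply Rinv_0_lt_compat; lra. lra.
  - rewrite (Rabs_left h) in * by lra.
    pose proof (ln_Gamma_shift (a + h) (- h) ltac:(lra) ltac:(lra)) as S.
    replace (a + h + - h) with a in S by ring.
    pose proof (ln_diff_le (a + h) a ltac:(lra) ltac:(lra)) as D.
    pose proof (ln_diff_ge (a + h) a ltac:(lra) ltac:(lra)) as D'.
    assert (Hd : - h / (a + h) <= - h / (a - 1)).
    { apply Rmult_le_compat_l. lra. apply Rinv_le_contravar; lra. }
    replace ((a - (a + h)) / (a + h)) with (- h / (a + h)) in D by (field; lra).
    assert (0 <= ln a - ln (a + h)).
    { assert (ln (a + h) <= ln a) by (apply ln_le; lra). lra. }
    replace (ln (Gamma (a + h)) - ln (Gamma a) - h * ln a)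
      with (- (ln (Gamma a) - ln (Gamma (a + h)) - - h * ln (a + h)) + - h * (ln a - ln (a + h))) by ring.
    eapply Rle_trans. apply Rabs_triang. rewrite Rabs_Ropp.
    rewrite (Rabs_right (- h * _)) by (apply Rle_ge, Rmult_le_pos; lra).
    assert (- h * (ln a - ln (a + h)) <= - h / (a - 1)) by nra.
    replace (2 * - h / (a - 1)) with (- h / (a - 1) + - h / (a - 1)) by (field; lra). lra.
Qed.

(** * The digamma and polygamma functions as series *)

Lemma ln_shift_taylor (b h : R) : 1 <= b -> Rabs h <= / 2 ->
  Rabs (ln (b + h) - ln b - h * / b) <= h ^ 2 * (2 * / b ^ 2).
Proof.
  intros Hb Hh. apply Rabs_le_between in Hh.
  pose proof (ln_diff_le b (b + h) ltac:(lra) ltac:(lra)) as U.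
  pose proof (ln_diff_ge b (b + h) ltac:(lra) ltac:(lra)) as L.
  replace ((b + h - b) / b) with (h * / b) in U by (field; lra).
  replace ((b + h - b) / (b + h)) with (h * / b - h ^ 2 * / (b * (b + h))) in L by (field; lra).
  assert (/ (b * (b + h)) <= 2 * / b ^ 2).
  { replace (2 * / b ^ 2) with (/ (b * (b / 2))) by (field; lra). apply Rinv_le_contravar.
    apply Rmult_lt_0_compat; lra. apply Rmult_le_compat_l; lra. }
  pose proof (pow2_ge_0 h).
  assert (0 < / b ^ 2) by (apply Rinv_0_lt_compat, pow_lt; lra).
  apply Rabs_le_between. split; nra.
Qed.

(** The classical series of [psi(a) + gamma]: Euler's constant is not subtracted here, since the
    theorem uses just this combination. *)
Definition digamma_series (a : R) : R := Series (fun n => / INR (S n) - / (INR n + a)).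

Lemma ex_digamma_series (a : R) : 1 <= a -> ex_series (fun n => / INR (S n) - / (INR n + a)).
Proof.
  intros Ha. apply (ex_series_le_R _ (fun n => (a - 1) * / INR (S n) ^ 2)).
  - intros n. pose proof (INR_S_pos n). rewrite S_INR in *.
    replace (/ (INR n + 1) - / (INR n + a)) with ((a - 1) * / ((INR n + 1) * (INR n + a))) by (field; lra).
    rewrite Rabs_right.
    apply Rmult_le_compat_l. lra. apply Rinv_le_contravar. apply pow_lt; lra. simpl.
    apply Rmult_le_compat_l; lra.
    apply Rle_ge, Rmult_le_pos. lra. left. apply Rinv_0_lt_compat, Rmult_lt_0_compat; lra.
  - apply (ex_series_scal_R (a - 1)). apply ex_series_inv_sq.
Qed.

(** The shape is dictated by the functional equation: after [n + 1] steps, the logarithm is the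
    slope of [ln Gamma] at the shifted point, and the sum is the derivative of the logarithms
    collected on the way. *)
Lemma digamma_partial_lim (a : R) : 1 < a ->
  is_lim_seq (fun n => ln (a + INR (S n)) - sum_n (fun k => / (INR k + a)) n)
    (digamma_series a - euler_gamma).
Proof.
  intros Ha.
  pose proof (Series_correct _ (ex_digamma_series a ltac:(lra))) as L1.
  change (is_lim_seq (sum_n (fun n => / INR (S n) - / (INR n + a))) (digamma_series a)) in L1.
  assert (L3 : is_lim_seq (fun n => ln (a + INR (S n)) - ln (INR (S n))) 0).
  { apply (is_lim_seq_le_le (fun _ => 0) _ (fun n => a * / INR (S n))).
    - intros n. pose proof (INR_S_pos n). split.
      assert (ln (INR (S n)) <= ln (a + INR (S n))) by (apply ln_le; lra). lra.
      eapply Rle_trans. apply ln_diff_le; lra. right. field. lra.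
    - apply is_lim_seq_const.
    - rewrite <- (Rmult_0_r a).
      apply (is_lim_seq_scal_l (fun n => / INR (S n)) a 0).
      replace (Finite 0) with (Rbar_inv p_infty) by reflexivity.
      apply is_lim_seq_inv. apply (is_lim_seq_incr_1 INR). apply is_lim_seq_INR. discriminate. }
  apply (is_lim_seq_ext (fun n => sum_n (fun n => / INR (S n) - / (INR n + a)) n
     - (sum_n (fun k => / INR (S k)) n - ln (INR (S n))) + (ln (a + INR (S n)) - ln (INR (S n))))).
  { intros n. assert (E : @eq R (sum_n (fun n => / INR (S n) - / (INR n + a)) n)
      (sum_n (fun k => / INR (S k)) n - sum_n (fun k => / (INR k + a)) n)).
    { clear. induction n. rewrite !sum_O. reflexivity. rewrite !sum_Sn_R, IHn. ring. }
    rewrite E. ring. }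
  replace (digamma_series a - euler_gamma) with (digamma_series a - euler_gamma + 0) by ring.
  apply is_lim_seq_plus'; auto. apply is_lim_seq_minus'; auto. apply euler_gamma_lim.
Qed.

(** Move [a] to [a + n] with the functional equation: there the increment of
    [ln Gamma] is [h ln (a + n) + o(1)]. *)
Lemma is_derive_ln_Gamma (a : R) : 1 < a ->
  is_derive (fun x => ln (Gamma x)) a (digamma_series a - euler_gamma).
Proof.
  intros Ha. set (d := digamma_series a - euler_gamma).
  (* [Z] is [zeta(2)]; it bounds the accumulated second-order errors of the logarithms for every
     number of steps at once. *)
  set (Z := Series (fun n => / INR (S n) ^ 2)).
  assert (HZ : forall n, sum_n (fun n => / INR (S n) ^ 2) n <= Z).
  { intros n. apply (sum_n_le_Series (fun n => / INR (S n) ^ 2)); [|apply ex_series_inv_sq].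
    intros k. left. apply Rinv_0_lt_compat, pow_lt, INR_S_pos. }
  assert (HZ0 : 0 < Z).
  { eapply Rlt_le_trans; [|apply (HZ 0%nat)]. rewrite sum_O. simpl. lra. }
  set (f := fun x => ln (Gamma x)).
  assert (Main : forall h, Rabs h <= / 2 -> 1 < a + h -> Rabs (f (a + h) - f a - h * d) <= 2 * Z * h ^ 2).
  { intros h Hh Hah. pose proof Hh as Hh'. apply Rabs_le_between in Hh'.
    assert (Rec : forall b n, 1 < b -> f (b + INR (S n)) = f b + sum_n (fun k => ln (b + INR k)) n).
    { intros b n Hb. induction n.
      rewrite sum_O. simpl. rewrite Rplus_0_r. unfold f. apply ln_Gamma_succ; auto.
      rewrite sum_Sn_R. rewrite (S_INR (S n)). rewrite <- Rplus_assoc.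
      unfold f in *. pose proof (INR_S_pos n). rewrite ln_Gamma_succ by lra. rewrite IHn. ring. }
    assert (Tay : forall n, Rabs (sum_n (fun k => ln (a + h + INR k)) n - sum_n (fun k => ln (a + INR k)) n
       - h * sum_n (fun k => / (INR k + a)) n) <= 2 * h ^ 2 * sum_n (fun k => / INR (S k) ^ 2) n).
    { assert (St : forall k, Rabs (ln (a + h + INR k) - ln (a + INR k) - h * / (INR k + a)) <= 2 * h ^ 2 * / INR (S k) ^ 2).
      { intros k. pose proof (pos_INR k).
        pose proof (ln_shift_taylor (INR k + a) h ltac:(lra) Hh) as T.
        replace (a + h + INR k) with (INR k + a + h) by ring. rewrite (Rplus_comm a).
        eapply Rle_trans. exact T.
        assert (/ (INR k + a) ^ 2 <= / INR (S k) ^ 2).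
        { apply Rinv_le_contravar. apply pow_lt, INR_S_pos. rewrite S_INR. apply pow_incr. lra. }
        pose proof (pow2_ge_0 h). nra. }
      induction n. rewrite !sum_O. apply St.
      rewrite !sum_Sn_R. specialize (St (S n)).
      match goal with |- Rabs ?X <= _ => replace X with
        ((sum_n (fun k => ln (a + h + INR k)) n - sum_n (fun k => ln (a + INR k)) n
          - h * sum_n (fun k => / (INR k + a)) n) + (ln (a + h + INR (S n)) - ln (a + INR (S n)) - h * / (INR (S n) + a))) by ring end.
      eapply Rle_trans. apply Rabs_triang. lra. }
    set (D := fun n => ln (a + INR (S n)) - sum_n (fun k => / (INR k + a)) n).
    (* Two errors: the Taylor errors, quadratic in [h] and uniform in [n], and the error at the
       shifted point, only linear in [h] but vanishing as [n] grows. The limit in [n] is taken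
       before the one in [h]. *)
    assert (Bn : forall n, Rabs (f (a + h) - f a - h * D n) <= 2 * Z * h ^ 2 + 2 * Rabs h * / INR (S n)).
    { intros n. pose proof (INR_S_pos n) as In.
      pose proof (Rec a n Ha) as R1. pose proof (Rec (a + h) n Hah) as R2.
      pose proof (INR_S_ge_1 n).
      pose proof (ln_Gamma_shift_abs (a + INR (S n)) h ltac:(lra) Hh) as Sh.
      replace (a + INR (S n) + h) with (a + h + INR (S n)) in Sh by ring.
      fold (f (a + h + INR (S n))) in Sh. fold (f (a + INR (S n))) in Sh.
      match goal with |- Rabs ?X <= _ => replace X with
        ((f (a + h + INR (S n)) - f (a + INR (S n)) - h * ln (a + INR (S n)))
         - (sum_n (fun k => ln (a + h + INR k)) n - sum_n (fun k => ln (a + INR k)) n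
          - h * sum_n (fun k => / (INR k + a)) n)) by (unfold D; rewrite R1, R2; ring) end.
      eapply Rle_trans. apply Rabs_triang. rewrite Rabs_Ropp.
      specialize (Tay n). specialize (HZ n). pose proof (pow2_ge_0 h).
      assert (2 * Rabs h / (a + INR (S n) - 1) <= 2 * Rabs h * / INR (S n)).
      { apply Rmult_le_compat_l. pose proof (Rabs_pos h); lra. apply Rinv_le_contravar; lra. }
      nra. }
    assert (L1 : is_lim_seq (fun n => Rabs (f (a + h) - f a - h * D n)) (Rabs (f (a + h) - f a - h * d))).
    { apply (is_lim_seq_abs (fun n => f (a + h) - f a - h * D n) (f (a + h) - f a - h * d)).
      apply is_lim_seq_minus'. apply is_lim_seq_const.
      apply (is_lim_seq_scal_l D h d). apply digamma_partial_lim; auto. }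
    assert (L2 : is_lim_seq (fun n => 2 * Z * h ^ 2 + 2 * Rabs h * / INR (S n)) (2 * Z * h ^ 2 + 2 * Rabs h * 0)).
    { apply is_lim_seq_plus'. apply is_lim_seq_const. apply (is_lim_seq_scal_l _ (2 * Rabs h) 0).
      replace (Finite 0) with (Rbar_inv p_infty) by reflexivity.
      apply is_lim_seq_inv. apply (is_lim_seq_incr_1 INR). apply is_lim_seq_INR. discriminate. }
    pose proof (is_lim_seq_le _ _ _ _ Bn L1 L2) as Fin. simpl in Fin. simpl. lra. }
  apply is_derive_Reals. intros eps He.
  assert (Hp : 0 < Rmin (Rmin (/ 2) (a - 1)) (eps / (2 * Z + 1))).
  { repeat apply Rmin_pos; try lra. apply Rdiv_lt_0_compat; lra. }
  exists (mkposreal _ Hp). intros h Hn Hh. simpl in Hh.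
  Rmin_bounds.
  assert (Hb : - (a - 1) < h) by (assert (Q : Rabs h < a - 1) by lra; apply Rabs_lt_between in Q; lra).
  specialize (Main h ltac:(lra) ltac:(lra)).
  change (Rabs ((f (a + h) - f a) / h - d) < eps).
  replace ((f (a + h) - f a) / h - d) with ((f (a + h) - f a - h * d) / h) by (field; auto).
  assert (Hah : 0 < Rabs h) by (apply Rabs_pos_lt; auto).
  unfold Rdiv. rewrite Rabs_mult, Rabs_inv.
  apply Rle_lt_trans with (2 * Z * h ^ 2 * / Rabs h).
  apply Rmult_le_compat_r. left. apply Rinv_0_lt_compat; auto. exact Main.
  rewrite <- (pow2_abs h).
  replace (2 * Z * Rabs h ^ 2 * / Rabs h) with (2 * Z * Rabs h) by (field; lra).
  assert (H3 : Rabs h < eps / (2 * Z + 1)) by lra.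
  apply (Rmult_lt_compat_r (2 * Z + 1)) in H3; [|lra].
  replace (eps / (2 * Z + 1) * (2 * Z + 1)) with eps in H3 by (field; lra). nra.
Qed.

Lemma digamma_eq (a : R) : 1 < a -> digamma a = digamma_series a - euler_gamma.
Proof.
  intros Ha. destruct (Gamma_spec a Ha) as [_ P0].
  assert (D : is_derive Gamma a ((digamma_series a - euler_gamma) * Gamma a)).
  { apply (is_derive_ext_loc (fun x => exp (ln (Gamma x)))).
    - assert (Hp : 0 < a - 1) by lra. exists (mkposreal _ Hp). intros y Hy.
      change (Rabs (y - a) < a - 1) in Hy.
      apply Rabs_lt_between in Hy. apply exp_ln. apply Gamma_spec. lra.
    - rewrite <- (exp_ln (Gamma a)) at 1 by auto.
      apply (is_derive_comp exp (fun x => ln (Gamma x))).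
      apply is_derive_Reals, derivable_pt_lim_exp.
      apply is_derive_ln_Gamma; auto. }
  unfold digamma. rewrite (is_derive_unique _ _ _ D). field. lra.
Qed.

Lemma ex_series_inv_pow (a : R) (p : nat) : 1 <= a -> ex_series (fun n => / (INR n + a) ^ (S (S p))).
Proof.
  intros Ha. apply (ex_series_le_R _ (fun n => / INR (S n) ^ 2)); [|apply ex_series_inv_sq].
  intros n. pose proof (pos_INR n).
  rewrite Rabs_right by (left; apply Rinv_0_lt_compat, pow_lt; lra).
  apply Rinv_le_contravar. apply pow_lt, INR_S_pos.
  rewrite S_INR. apply Rle_trans with ((INR n + a) ^ 2). apply pow_incr; lra.
  apply Rle_pow; lra || lia.
Qed.

Lemma is_derive_inv_pow_series (a : R) (p : nat) : 1 < a ->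
  is_derive (fun x => Series (fun n => / (INR n + x) ^ (S (S p)))) a
    (- INR (S (S p)) * Series (fun n => / (INR n + a) ^ (S (S (S p))))).
Proof.
  intros Ha. destruct (inv_pow_taylor (S (S p))) as [K [HK B]].
  rewrite <- Series_scal_l.
  apply (is_derive_Series (fun n x => / (INR n + x) ^ (S (S p))) _ (fun n => K * / (INR n + a) ^ 2) a (Rmin (/ 2) (a - 1))).
  - apply Rmin_pos; lra.
  - intros x Hx. apply ex_series_inv_pow.
    assert (Q : Rabs (x - a) < a - 1) by (eapply Rlt_le_trans; [exact Hx|apply Rmin_r]).
    apply Rabs_lt_between in Q. lra.
  - apply (ex_series_scal_R (- INR (S (S p)))). apply ex_series_inv_pow. lra.
  - apply (ex_series_scal_R K). apply (ex_series_inv_pow a 0). lra.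
  - intros n h Hh. pose proof (pos_INR n). rewrite <- Rplus_assoc. apply B. lra.
    eapply Rlt_le_trans; [exact Hh|apply Rmin_l].
Qed.

Lemma is_derive_digamma_series (a : R) : 1 < a ->
  is_derive digamma_series a (Series (fun n => / (INR n + a) ^ 2)).
Proof.
  intros Ha. destruct (inv_pow_taylor 1) as [K [HK B]].
  apply (is_derive_Series (fun n x => / INR (S n) - / (INR n + x)) _ (fun n => K * / (INR n + a) ^ 2) a (Rmin (/ 2) (a - 1))).
  - apply Rmin_pos; lra.
  - intros x Hx. apply ex_digamma_series.
    assert (Q : Rabs (x - a) < a - 1) by (eapply Rlt_le_trans; [exact Hx|apply Rmin_r]).
    apply Rabs_lt_between in Q. lra.
  - apply (ex_series_inv_pow a 0). lra.
  - apply (ex_series_scal_R K). apply (ex_series_inv_pow a 0). lra.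
  - intros n h Hh. pose proof (pos_INR n). rewrite <- Rplus_assoc.
    specialize (B (INR n + a) h ltac:(lra) (Rlt_le_trans _ _ _ Hh (Rmin_l _ _))).
    rewrite <- Rabs_Ropp. eapply Rle_trans; [|exact B]. right. f_equal. simpl. rewrite !Rmult_1_r.
    ring.
Qed.

Lemma polygamma_eq (k : nat) (a : R) : 1 < a ->
  polygamma (S k) a = (-1) ^ k * INR (fact (S k)) * Series (fun n => / (INR n + a) ^ (S (S k))).
Proof.
  revert a. induction k; intros a Ha.
  - change (polygamma 1 a) with (Derive digamma a).
    assert (D : is_derive digamma a (Series (fun n => / (INR n + a) ^ 2))).
    { apply (is_derive_ext_loc (fun x => digamma_series x - euler_gamma)).
      - assert (Hp : 0 < a - 1) by lra. exists (mkposreal _ Hp). intros y Hy.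
        change (Rabs (y - a) < a - 1) in Hy.
        apply Rabs_lt_between in Hy. symmetry. apply digamma_eq. lra.
      - rewrite <- (Rminus_0_r (Series _)).
        apply (is_derive_minus digamma_series (fun _ => euler_gamma)).
        apply is_derive_digamma_series; auto. apply (is_derive_const euler_gamma a). }
    rewrite (is_derive_unique _ _ _ D). simpl. ring.
  - change (polygamma (S (S k)) a) with (Derive (polygamma (S k)) a).
    apply is_derive_unique.
    apply (is_derive_ext_loc (fun x => (-1) ^ k * INR (fact (S k)) * Series (fun n => / (INR n + x) ^ (S (S k))))).
    + assert (Hp : 0 < a - 1) by lra. exists (mkposreal _ Hp). intros y Hy.
      change (Rabs (y - a) < a - 1) in Hy.
      apply Rabs_lt_between in Hy. symmetry. apply IHk. lra.
    + replace ((-1) ^ S k * INR (fact (S (S k))) * Series (fun n => / (INR n + a) ^ S (S (S k))))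
        with ((-1) ^ k * INR (fact (S k)) * (- INR (S (S k)) * Series (fun n => / (INR n + a) ^ S (S (S k))))).
      apply (is_derive_scal (fun x => Series (fun n => / (INR n + x) ^ (S (S k))))).
      apply is_derive_inv_pow_series; auto.
      rewrite (fact_simpl (S k)), mult_INR. simpl pow. ring.
Qed.

(** * Complex powers and double series *)

Lemma cpow_Cexp (a : R) (z : C) : cpow a z = Cexp (RtoC (ln a) * z).
Proof.
  unfold cpow, Cexp.
  replace (Re (RtoC (ln a) * z)) with (Re z * ln a) by (destruct z; simpl; ring).
  replace (Im (RtoC (ln a) * z)) with (Im z * ln a) by (destruct z; simpl; ring).
  reflexivity.
Qed.

Lemma cpow_plus (a : R) (z w : C) : cpow a (z + w) = (cpow a z * cpow a w)%C.
Proof. rewrite !cpow_Cexp, Cmult_plus_distr_l. apply Cexp_plus. Qed.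

Lemma cpow_0 (a : R) : cpow a 0 = 1.
Proof. rewrite cpow_Cexp, Cmult_0_r. apply Cexp_0. Qed.

Lemma Cmod_cpow (a : R) (z : C) : Cmod (cpow a z) = exp (Re z * ln a).
Proof. rewrite cpow_Cexp, Cmod_Cexp. f_equal. destruct z; simpl; ring. Qed.

Lemma cpow_neq_0 (a : R) (z : C) : cpow a z <> 0.
Proof. intros E. pose proof (Cmod_cpow a z). rewrite E, Cmod_0 in H.
pose proof (exp_pos (Re z * ln a)). lra. Qed.

Lemma cpow_opp (a : R) (z : C) : cpow a (- z) = (/ cpow a z)%C.
Proof.
  assert (E : (cpow a z * cpow a (- z))%C = 1) by (rewrite <- cpow_plus, Cplus_opp_r; apply cpow_0).
  rewrite <- (Cmult_1_l (/ cpow a z)), <- E. field. apply cpow_neq_0.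
Qed.

Lemma cpow_base_mult (a b : R) (z : C) : 0 < a -> 0 < b -> cpow (a * b) z = (cpow a z * cpow b z)%C.
Proof.
  intros Ha Hb. rewrite !cpow_Cexp, ln_mult by auto. rewrite <- Cexp_plus, RtoC_plus. f_equal. ring.
Qed.

Lemma cpow_1_r (a : R) : 0 < a -> cpow a 1 = RtoC a.
Proof.
  intros Ha. unfold cpow; simpl. rewrite Rmult_0_l, cos_0, sin_0, Rmult_1_l, exp_ln by auto.
  apply injective_projections; simpl; ring.
Qed.

Lemma cpow_INR (a : R) (n : nat) : 0 < a -> cpow a (RtoC (INR n)) = RtoC (a ^ n).
Proof.
  intros Ha. induction n. simpl. apply cpow_0.
  rewrite S_INR, RtoC_plus, cpow_plus, IHn, cpow_1_r by auto. rewrite <- RtoC_mult. f_equal. simpl.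
  ring.
Qed.

Lemma cdiff_cpow (a : R) (f : C -> C) (z : C) : cdiff f z -> cdiff (fun w => cpow a (f w)) z.
Proof.
  intros H. apply cdiff_ext with (fun w => Cexp (RtoC (ln a) * f w)).
  intros w. symmetry. apply cpow_Cexp.
  apply (cdiff_comp Cexp (fun w => RtoC (ln a) * f w)%C). apply cdiff_mult; auto. apply cdiff_const.
  apply cdiff_Cexp.
Qed.

(** * Finite sums and complex series *)

Lemma csum_0 (f : nat -> C) : csum 0 f = 0.
Proof. reflexivity. Qed.

Lemma csum_S (n : nat) (f : nat -> C) : csum (S n) f = (csum n f + f n)%C.
Proof.
  assert (A : forall (l : list C) z, fold_right Cplus z l = (fold_right Cplus 0 l + z)%C).
  { induction l; intros z; simpl. ring. rewrite IHl. ring. }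
  unfold csum. rewrite seq_S, map_app, fold_right_app. simpl. rewrite A. ring.
Qed.

Lemma csum_ext (n : nat) (f g : nat -> C) : (forall i, (i < n)%nat -> f i = g i) -> csum n f = csum n g.
Proof.
  induction n; intros H. reflexivity. rewrite !csum_S, IHn by (intros; apply H; lia).
  rewrite H by lia. reflexivity.
Qed.

Lemma csum_mult_l (n : nat) (c : C) (f : nat -> C) : (c * csum n f)%C = csum n (fun i => c * f i)%C.
Proof. induction n. rewrite !csum_0. ring. rewrite !csum_S, <- IHn. ring. Qed.

Lemma csum_minus (n : nat) (f g : nat -> C) : (csum n f - csum n g)%C = csum n (fun i => f i - g i)%C.
Proof. induction n. rewrite !csum_0. ring. rewrite !csum_S, <- IHn. ring. Qed.

Lemma csum_first (n : nat) (f : nat -> C) : csum (S n) f = (f 0%nat + csum n (fun i => f (S i)))%C.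
Proof.
  induction n. rewrite csum_S, !csum_0. ring.
  rewrite csum_S, IHn, csum_S. ring.
Qed.

Lemma cdiff_csum (n : nat) (f : nat -> C -> C) (z : C) :
  (forall i, (i < n)%nat -> cdiff (f i) z) -> cdiff (fun w => csum n (fun i => f i w)) z.
Proof.
  induction n; intros H. exact (cdiff_const 0 z).
  apply cdiff_ext with (fun w => csum n (fun i => f i w) + f n w)%C.
  intros w. rewrite csum_S. reflexivity.
  apply cdiff_plus. apply IHn. intros; apply H; lia. apply H; lia.
Qed.

Lemma Re_csum (n : nat) (u : nat -> C) : Re (csum (S n) u) = sum_n (fun i => Re (u i)) n.
Proof.
  induction n. rewrite csum_S, csum_0, sum_O, Cplus_0_l. reflexivity.
  rewrite csum_S, sum_Sn_R, <- IHn. reflexivity.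
Qed.

Lemma Im_csum (n : nat) (u : nat -> C) : Im (csum (S n) u) = sum_n (fun i => Im (u i)) n.
Proof.
  induction n. rewrite csum_S, csum_0, sum_O, Cplus_0_l. reflexivity.
  rewrite csum_S, sum_Sn_R, <- IHn. reflexivity.
Qed.

Lemma sum_n_csum (n : nat) (u : nat -> C) :
  @sum_n (NormedModule.AbelianMonoid C_AbsRing C_NormedModule) u n = csum (S n) u.
Proof.
  induction n. rewrite csum_S, csum_0, sum_O, Cplus_0_l. reflexivity.
  rewrite csum_S, sum_Sn, IHn. reflexivity.
Qed.

Lemma is_Cseries_eps (u : nat -> C) (l : C) :
  is_Cseries u l <-> forall eps, 0 < eps -> exists N, forall n, (N <= n)%nat -> Cmod (csum (S n) u - l) < eps.
Proof.
  split.
  - intros H eps He.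
    assert (He2 : 0 < eps / 2) by lra.
    destruct (H (fun y => Cmod (y - l) < eps)) as [N HN].
    { exists (mkposreal _ He2). intros y Hy.
      assert (K := C_NormedModule_mixin_compat2 l y (mkposreal _ He2) Hy). simpl in K.
      change (Cmod (y - l) < sqrt 2 * (eps / 2)) in K.
      assert (sqrt 2 <= 2). { rewrite <- (sqrt_pow2 2) at 2 by lra. apply sqrt_le_1_alt. lra. }
      nra. }
    exists N. intros n Hn. specialize (HN n Hn). rewrite sum_n_csum in HN. exact HN.
  - intros H P [e He]. destruct (H e (cond_pos e)) as [N HN].
    exists N. intros n Hn. apply He. rewrite sum_n_csum.
    apply C_NormedModule_mixin_compat1. exact (HN n Hn).
Qed.

Lemma is_Cseries_RI (u : nat -> C) (l : C) :
  is_Cseries u l <-> is_series (fun n => Re (u n)) (Re l) /\ is_series (fun n => Im (u n)) (Im l).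
Proof.
  rewrite is_Cseries_eps. split.
  - intros H. split.
    + intros P [e He]. destruct (H e (cond_pos e)) as [N HN]. exists N. intros n Hn. apply He.
      rewrite <- Re_csum. eapply Rle_lt_trans; [|apply (HN n Hn)].
      eapply Rle_trans; [|apply re_le_Cmod]. right. reflexivity.
    + intros P [e He]. destruct (H e (cond_pos e)) as [N HN]. exists N. intros n Hn. apply He.
      rewrite <- Im_csum. eapply Rle_lt_trans; [|apply (HN n Hn)].
      eapply Rle_trans; [|apply im_le_Cmod]. right. reflexivity.
  - intros [H1 H2] eps He. assert (He2 : 0 < eps / 2) by lra.
    destruct (H1 (fun y => Rabs (y - Re l) < eps / 2)) as [N1 K1]. { exists (mkposreal _ He2).
    intros y Hy; exact Hy. }
    destruct (H2 (fun y => Rabs (y - Im l) < eps / 2)) as [N2 K2]. { exists (mkposreal _ He2).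
    intros y Hy; exact Hy. }
    exists (max N1 N2). intros n Hn. specialize (K1 n ltac:(lia)). specialize (K2 n ltac:(lia)).
    rewrite <- Re_csum in K1. rewrite <- Im_csum in K2.
    eapply Rle_lt_trans. apply Cmod_le_sum.
    change (Re (csum (S n) u - l)) with (Re (csum (S n) u) - Re l).
    change (Im (csum (S n) u - l)) with (Im (csum (S n) u) - Im l). lra.
Qed.

Lemma CSeries_unique (u : nat -> C) (l : C) : is_Cseries u l -> CSeries u = l.
Proof.
  intros H. apply is_Cseries_RI in H. destruct H as [H1 H2]. unfold CSeries.
  rewrite (is_series_unique _ _ H1), (is_series_unique _ _ H2). destruct l; reflexivity.
Qed.

Lemma is_Cseries_unique (u : nat -> C) (l m : C) : is_Cseries u l -> is_Cseries u m -> l = m.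
Proof. intros H1 H2. rewrite <- (CSeries_unique _ _ H1). apply CSeries_unique; auto. Qed.

Lemma is_Cseries_ext (u v : nat -> C) (l : C) : (forall n, u n = v n) -> is_Cseries u l -> is_Cseries v l.
Proof. intros E. exact (is_series_ext u v l E). Qed.

Lemma is_Cseries_plus (u v : nat -> C) (l m : C) :
  is_Cseries u l -> is_Cseries v m -> is_Cseries (fun n => u n + v n)%C (l + m)%C.
Proof. exact (is_series_plus u v l m). Qed.

Lemma is_Cseries_mult_l (c : C) (u : nat -> C) (l : C) :
  is_Cseries u l -> is_Cseries (fun n => c * u n)%C (c * l)%C.
Proof. exact (is_series_scal_l c u l). Qed.

Lemma is_Cseries_RtoC (u : nat -> R) : ex_series u -> is_Cseries (fun n => RtoC (u n)) (RtoC (Series u)).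
Proof.
  intros H. apply is_Cseries_RI. split. apply Series_correct; auto.
  change (is_lim_seq (sum_n (fun _ : nat => 0)) 0). apply (is_lim_seq_ext (fun _ => 0)).
  intros n. induction n. rewrite sum_O. reflexivity. rewrite sum_Sn_R, <- IHn. ring.
  apply is_lim_seq_const.
Qed.

Lemma Cmod_csum_diff_le (u : nat -> C) (b : nat -> R) (N k : nat) :
  (forall n, Cmod (u n) <= b n) ->
  Cmod (csum (S (N + k)) u - csum (S N) u) <= sum_n b (N + k) - sum_n b N.
Proof.
  intros H. induction k. rewrite Nat.add_0_r. unfold Cminus. rewrite Cplus_opp_r, Cmod_0. lra.
  rewrite Nat.add_succ_r, csum_S, sum_Sn_R.
  replace (csum (S (N + k)) u + u (S (N + k)) - csum (S N) u)%C
    with ((csum (S (N + k)) u - csum (S N) u) + u (S (N + k)))%C by ring.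
  eapply Rle_trans. apply Cmod_triangle. specialize (H (S (N + k))). lra.
Qed.

Lemma Cmod_csum_le (u : nat -> C) (b : nat -> R) (N : nat) :
  (forall n, Cmod (u n) <= b n) -> Cmod (csum (S N) u) <= sum_n b N.
Proof.
  intros H. induction N. rewrite csum_S, csum_0, sum_O, Cplus_0_l. auto.
  rewrite csum_S, sum_Sn_R. eapply Rle_trans. apply Cmod_triangle. specialize (H (S N)). lra.
Qed.

Lemma Cseries_tail (u : nat -> C) (l : C) (b : nat -> R) (N : nat) :
  (forall n, Cmod (u n) <= b n) -> ex_series b -> is_Cseries u l ->
  Cmod (l - csum (S N) u) <= Series b - sum_n b N.
Proof.
  intros Hb Hex Hl. apply Rnot_lt_le. intros K.
  rewrite is_Cseries_eps in Hl.
  destruct (Hl (Cmod (l - csum (S N) u) - (Series b - sum_n b N))) as [M HM]. lra.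
  specialize (HM (N + M)%nat ltac:(lia)).
  pose proof (Cmod_csum_diff_le u b N M Hb) as D.
  assert (P : sum_n b (N + M) <= Series b).
  { apply sum_n_le_Series; auto. intros n. eapply Rle_trans; [apply Cmod_ge_0|apply Hb]. }
  assert (T : Cmod (l - csum (S N) u) <= Cmod (csum (S (N + M)) u - l) + Cmod (csum (S (N + M)) u - csum (S N) u)).
  { replace (l - csum (S N) u)%C with ((csum (S (N + M)) u - csum (S N) u) - (csum (S (N + M)) u - l))%C by ring.
    rewrite Rplus_comm. apply Cmod_triangle_minus. }
  lra.
Qed.

Lemma Cseries_bound (u : nat -> C) (l : C) (b : nat -> R) :
  (forall n, Cmod (u n) <= b n) -> ex_series b -> is_Cseries u l -> Cmod l <= Series b.
Proof.
  intros Hb Hex Hl. pose proof (Cseries_tail u l b 0 Hb Hex Hl) as T.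
  pose proof (Cmod_csum_le u b 0 Hb) as T0.
  replace l with ((l - csum 1 u) + csum 1 u)%C by ring.
  eapply Rle_trans. apply Cmod_triangle. lra.
Qed.

Lemma ex_Cseries_le (u : nat -> C) (b : nat -> R) :
  (forall n, Cmod (u n) <= b n) -> ex_series b -> exists l, is_Cseries u l.
Proof.
  intros Hb Hex.
  destruct (ex_series_le_R (fun n => Re (u n)) b) as [l1 H1]; auto.
  { intros n. eapply Rle_trans. apply re_le_Cmod. apply Hb. }
  destruct (ex_series_le_R (fun n => Im (u n)) b) as [l2 H2]; auto.
  { intros n. eapply Rle_trans. apply im_le_Cmod. apply Hb. }
  exists (l1, l2). apply is_Cseries_RI. split; auto.
Qed.

(** The form in which [is_mordell_tornheim] gives the double series: [a] lists the inner sums, so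
    convergence of the inner and of the outer series is part of the claim. *)
Definition is_iter (u : nat -> nat -> C) (L : C) : Prop :=
  exists a : nat -> C, (forall n, is_Cseries (u n) (a n)) /\ is_Cseries a L.

Lemma is_iter_unique (u : nat -> nat -> C) (L M : C) : is_iter u L -> is_iter u M -> L = M.
Proof.
  intros [a [A1 A2]] [b [B1 B2]]. apply (is_Cseries_unique a); auto.
  apply (is_Cseries_ext b); auto. intros n. apply (is_Cseries_unique (u n)); auto.
Qed.

Lemma is_iter_CSeries (u : nat -> nat -> C) (L : C) :
  is_iter u L -> CSeries (fun n => CSeries (u n)) = L.
Proof.
  intros [a [A1 A2]]. apply CSeries_unique. apply (is_Cseries_ext a); auto.
  intros n. symmetry. apply CSeries_unique; auto.
Qed.

Lemma is_iter_ext (u v : nat -> nat -> C) (L : C) :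
  (forall n m, u n m = v n m) -> is_iter u L -> is_iter v L.
Proof.
  intros E [a [A1 A2]]. exists a. split; auto. intros n. apply (is_Cseries_ext (u n)); auto.
Qed.

Lemma is_iter_plus (u v : nat -> nat -> C) (L M : C) :
  is_iter u L -> is_iter v M -> is_iter (fun n m => u n m + v n m)%C (L + M)%C.
Proof.
  intros [a [A1 A2]] [b [B1 B2]]. exists (fun n => a n + b n)%C. split.
  intros n. apply is_Cseries_plus; auto. apply is_Cseries_plus; auto.
Qed.

Lemma is_iter_mult_l (c : C) (u : nat -> nat -> C) (L : C) :
  is_iter u L -> is_iter (fun n m => c * u n m)%C (c * L)%C.
Proof.
  intros [a [A1 A2]]. exists (fun n => c * a n)%C. split.
  intros n. apply is_Cseries_mult_l; auto. apply is_Cseries_mult_l; auto.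
Qed.

Lemma is_iter_prod (a b : nat -> C) (A B : C) :
  is_Cseries a A -> is_Cseries b B -> is_iter (fun n m => a n * b m)%C (A * B)%C.
Proof.
  intros HA HB. exists (fun n => a n * B)%C. split.
  intros n. apply is_Cseries_mult_l; auto.
  apply (is_Cseries_ext (fun n => B * a n)%C). intros; ring.
  rewrite Cmult_comm. apply is_Cseries_mult_l; auto.
Qed.

Lemma is_iter_0 : is_iter (fun _ _ => 0) 0.
Proof.
  assert (Z : is_Cseries (fun _ => 0) 0).
  { apply is_Cseries_eps. intros eps He. exists 0%nat. intros n _.
    replace (csum (S n) (fun _ => 0)) with (RtoC 0). unfold Cminus. rewrite Cplus_opp_r, Cmod_0.
    auto.
    induction n. rewrite csum_S, csum_0. ring. rewrite csum_S, <- IHn. ring. }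
  exists (fun _ => 0). auto.
Qed.

Lemma is_iter_csum (k : nat) (u : nat -> nat -> nat -> C) (L : nat -> C) :
  (forall i, (i < k)%nat -> is_iter (u i) (L i)) ->
  is_iter (fun n m => csum k (fun i => u i n m)) (csum k L).
Proof.
  induction k; intros H.
  - apply is_iter_0.
  - rewrite csum_S. apply (is_iter_ext (fun n m => csum k (fun i => u i n m) + u k n m)%C).
    intros n m. symmetry. exact (csum_S k (fun i => u i n m)).
    apply is_iter_plus. apply IHk. intros; apply H; lia. apply H; lia.
Qed.

Lemma csum_swap (N M : nat) (u : nat -> nat -> C) :
  csum N (fun n => csum M (u n)) = csum M (fun m => csum N (fun n => u n m)).
Proof.
  induction N.
  - rewrite csum_0. induction M. reflexivity. rewrite csum_S, <- IHM, csum_0. ring.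
  - rewrite csum_S, IHN. clear IHN. induction M. rewrite !csum_0. ring.
    rewrite (csum_S M (fun m => csum (S N) (fun n => u n m))), <- IHM, !(csum_S M), (csum_S N).
    ring.
Qed.

(** * Double series dominated by a product *)

Section DoubleSeries.
Variables (al be : nat -> R).
Hypotheses (Xal : ex_series al) (Xbe : ex_series be).

(** The mass of the majorant [al n * be m] outside the square of indices up to [N]. *)
Definition square_tail (N : nat) : R := Series al * Series be - sum_n al N * sum_n be N.

Lemma square_tail_lim : forall eps, 0 < eps -> exists N, square_tail N <= eps.
Proof.
  intros eps He.
  assert (L : is_lim_seq square_tail (Series al * Series be - Series al * Series be)).
  { apply is_lim_seq_minus'. apply is_lim_seq_const.
    apply is_lim_seq_mult'; apply Series_correct; auto. }
  rewrite Rminus_diag in L.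
  destruct (L (fun y => Rabs (y - 0) < eps)) as [N HN].
  { exists (mkposreal _ He). intros y Hy; exact Hy. }
  exists N. specialize (HN N (Nat.le_refl N)). rewrite Rminus_0_r in HN.
  pose proof (Rle_abs (square_tail N)). lra.
Qed.

(** The error depends on the majorants alone, so it is uniform in any parameters of [u]. This makes
    the double series a uniform limit of finite sums; squares serve because they are symmetric in
    the two indices. *)
Lemma iter_square_tail (u : nat -> nat -> C) :
  (forall n m, Cmod (u n m) <= al n * be m) ->
  exists L, is_iter u L /\
  forall N, Cmod (L - csum (S N) (fun n => csum (S N) (u n))) <= square_tail N.
Proof.
  intros Hu.
  assert (X1 : forall n, ex_series (fun m => al n * be m)) by (intros; apply ex_series_scal_R; auto).
  assert (I1 : forall n, is_Cseries (u n) (CSeries (u n))).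
  { intros n. destruct (ex_Cseries_le (u n) (fun m => al n * be m) (Hu n) (X1 n)) as [l Hl].
    rewrite (CSeries_unique _ _ Hl). exact Hl. }
  assert (B1 : forall n, Cmod (CSeries (u n)) <= al n * Series be).
  { intros n. rewrite <- Series_scal_l. apply (Cseries_bound (u n)); auto. }
  assert (X2 : ex_series (fun n => al n * Series be)) by (apply (ex_series_scal_r (Series be) al Xal)).
  destruct (ex_Cseries_le (fun n => CSeries (u n)) _ B1 X2) as [L HL].
  exists L. split. exists (fun n => CSeries (u n)). auto.
  intros N.
  pose proof (Cseries_tail _ L _ N B1 X2 HL) as T1. rewrite Series_scal_r in T1.
  assert (E1 : @eq R (sum_n (fun n => al n * Series be) N) (sum_n al N * Series be)).
  { clear. induction N. rewrite !sum_O. reflexivity. rewrite !sum_Sn_R, IHN. ring. }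
  rewrite E1 in T1.
  assert (T2 : Cmod (csum (S N) (fun n => CSeries (u n)) - csum (S N) (fun n => csum (S N) (u n)))
     <= sum_n al N * (Series be - sum_n be N)).
  { rewrite csum_minus.
    assert (E2 : sum_n al N * (Series be - sum_n be N) = sum_n (fun n => al n * (Series be - sum_n be N)) N).
    { generalize (Series be - sum_n be N). intros c. clear. induction N. rewrite !sum_O.
      reflexivity. rewrite !sum_Sn_R, <- IHN. ring. }
    rewrite E2. apply Cmod_csum_le. intros n.
    pose proof (Cseries_tail (u n) _ _ N (Hu n) (X1 n) (I1 n)) as T. rewrite Series_scal_l in T.
    assert (E3 : @eq R (sum_n (fun m => al n * be m) N) (al n * sum_n be N)).
    { generalize (al n). intros c. clear. induction N. rewrite !sum_O. reflexivity.
      rewrite !sum_Sn_R, IHN. ring. }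
    rewrite E3 in T. lra. }
  replace (L - csum (S N) (fun n => csum (S N) (u n)))%C with
   ((L - csum (S N) (fun n => CSeries (u n))) + (csum (S N) (fun n => CSeries (u n)) - csum (S N) (fun n => csum (S N) (u n))))%C by ring.
  eapply Rle_trans. apply Cmod_triangle. unfold square_tail. lra.
Qed.
End DoubleSeries.

(** Both iterated sums are limits of the same partial sums over squares. *)
Lemma double_series_swap (al be : nat -> R) (u : nat -> nat -> C) :
  ex_series al -> ex_series be ->
  (forall n m, Cmod (u n m) <= al n * be m) ->
  exists L, is_iter u L /\ is_iter (fun m n => u n m) L.
Proof.
  intros Xal Xbe Hu.
  destruct (iter_square_tail al be Xal Xbe u Hu) as [L [HL TL]].
  destruct (iter_square_tail be al Xbe Xal (fun m n => u n m)) as [M [HM TM]].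
  { intros m n. rewrite Rmult_comm. apply Hu. }
  exists L. split; auto. replace L with M; auto.
  destruct (Ceq_dec (M - L) 0) as [E|E].
  { replace M with (M - L + L)%C by ring. rewrite E. ring. }
  exfalso. assert (Hp : 0 < Cmod (M - L)) by (apply Cmod_gt_0; auto).
  destruct (square_tail_lim al be Xal Xbe (Cmod (M - L) / 3)) as [N HN]. lra.
  specialize (TL N). specialize (TM N).
  rewrite (csum_swap (S N) (S N) (fun m n => u n m)) in TM.
  assert (square_tail be al N = square_tail al be N) by (unfold square_tail; ring).
  assert (T : Cmod (M - L) <= square_tail al be N + square_tail al be N).
  { replace (M - L)%C with ((M - csum (S N) (fun n => csum (S N) (u n))) - (L - csum (S N) (fun n => csum (S N) (u n))))%C by ring.
    eapply Rle_trans. apply Cmod_triangle_minus. rewrite H in TM. apply Rplus_le_compat. exact TM.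
    exact TL. }
  lra.
Qed.

(** * The remainder of the expansion of [(n + m x)^(-t)] *)

(** [negbinom i t] is the generalized binomial coefficient of [-t] over [i]. *)
Fixpoint negbinom (i : nat) (t : C) : C :=
  match i with
  | O => 1
  | S i' => (- t * RtoC (/ INR (S i')) * negbinom i' (t + 1))%C
  end.

Definition taylor_rem (K : nat) (w : R) (t : C) : C :=
  (cpow (1 + w) (- t) - csum K (fun i => negbinom i t * RtoC (w ^ i)))%C.

(** Each differentiation of the remainder costs a factor [|t| <= T] and moves [t] to [t + 1]; the 2
    comes from [vderive_bound]. The same number also dominates the coefficients [negbinom K t]. *)
Fixpoint taylor_const (K : nat) (T : R) : R :=
  match K with O => 1 | S K' => 2 * T * taylor_const K' (T + 1) end.

Lemma negbinom_S (i : nat) (t : C) :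
  negbinom (S i) t = (- t * RtoC (/ INR (S i)) * negbinom i (t + 1))%C.
Proof. reflexivity. Qed.

Lemma taylor_const_pos (K : nat) (T : R) : 0 <= T -> 0 <= taylor_const K T.
Proof.
  revert T. induction K; intros T HT; simpl. lra. apply Rmult_le_pos. lra. apply IHK. lra.
Qed.

Lemma Cmod_add_1 (t : C) (T : R) : Cmod t <= T -> Cmod (t + 1) <= T + 1.
Proof. intros H. eapply Rle_trans. apply Cmod_triangle. rewrite Cmod_1. lra. Qed.

Lemma negbinom_bound (i : nat) (t : C) (T : R) : Cmod t <= T -> Cmod (negbinom i t) <= taylor_const i T.
Proof.
  revert t T. induction i; intros t T H; simpl taylor_const.
  - simpl. rewrite Cmod_1. lra.
  - rewrite negbinom_S, !Cmod_mult, Cmod_opp, Cmod_R.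
    specialize (IHi (t + 1)%C (T + 1) (Cmod_add_1 t T H)).
    pose proof (Cmod_ge_0 t). pose proof (INR_S_ge_1 i).
    assert (Hi : 0 <= Rabs (/ INR (S i)) <= 1).
    { split. apply Rabs_pos. rewrite Rabs_right by (left; apply Rinv_0_lt_compat; lra).
      rewrite <- Rinv_1. apply Rinv_le_contravar; lra. }
    apply Rmult_le_compat; auto. apply Rmult_le_pos; lra. apply Cmod_ge_0.
    nra.
Qed.

Definition vderive (f : R -> C) (w : R) (l : C) : Prop :=
  is_derive (fun x => Re (f x)) w (Re l) /\ is_derive (fun x => Im (f x)) w (Im l).

Lemma vderive_ext (f g : R -> C) (w : R) (l : C) : (forall x, f x = g x) -> vderive f w l -> vderive g w l.
Proof.
  intros E [H1 H2]. split.
  apply (is_derive_ext (fun x => Re (f x))); auto. intros; rewrite E; reflexivity.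
  apply (is_derive_ext (fun x => Im (f x))); auto. intros; rewrite E; reflexivity.
Qed.

Lemma vderive_plus (f g : R -> C) (w : R) (l m : C) :
  vderive f w l -> vderive g w m -> vderive (fun x => f x + g x)%C w (l + m)%C.
Proof.
  intros [H1 H2] [K1 K2]. split.
  exact (is_derive_plus _ _ _ _ _ H1 K1). exact (is_derive_plus _ _ _ _ _ H2 K2).
Qed.

Lemma vderive_minus (f g : R -> C) (w : R) (l m : C) :
  vderive f w l -> vderive g w m -> vderive (fun x => f x - g x)%C w (l - m)%C.
Proof.
  intros [H1 H2] [K1 K2]. split.
  exact (is_derive_minus _ _ _ _ _ H1 K1). exact (is_derive_minus _ _ _ _ _ H2 K2).
Qed.

Lemma vderive_const_mult (c : C) (f : R -> R) (w l : R) :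
  is_derive f w l -> vderive (fun x => c * RtoC (f x))%C w (c * RtoC l)%C.
Proof.
  intros H. split.
  - apply (is_derive_ext (fun x => Re c * f x)). intros; simpl; unfold Re, Im; ring.
    replace (Re (c * RtoC l)) with (Re c * l) by (simpl; unfold Re, Im; ring).
    exact (is_derive_scal f w (Re c) l H).
  - apply (is_derive_ext (fun x => Im c * f x)). intros; simpl; unfold Re, Im; ring.
    replace (Im (c * RtoC l)) with (Im c * l) by (simpl; unfold Re, Im; ring).
    exact (is_derive_scal f w (Im c) l H).
Qed.

Lemma vderive_cpow (z : C) (w : R) : 0 < 1 + w ->
  vderive (fun x => cpow (1 + x) z) w (z * cpow (1 + w) (z - 1))%C.
Proof.
  intros Hw. unfold Cminus. rewrite cpow_plus, cpow_opp, cpow_1_r by auto.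
  rewrite <- RtoC_inv. split; unfold cpow; simpl; auto_derive; auto.
  unfold Re, Im; field; lra. unfold Re, Im; field; lra. lra.
Qed.

Lemma vderive_csum (n : nat) (f : nat -> R -> C) (l : nat -> C) (w : R) :
  (forall i, (i < n)%nat -> vderive (f i) w (l i)) -> vderive (fun x => csum n (fun i => f i x)) w (csum n l).
Proof.
  induction n; intros H.
  - split; exact (@is_derive_const R_AbsRing R_NormedModule 0 w).
  - rewrite csum_S. apply vderive_ext with (fun x => csum n (fun i => f i x) + f n x)%C.
    intros x. symmetry. exact (csum_S n (fun i => f i x)).
    apply vderive_plus. apply IHn. intros; apply H; lia. apply H; lia.
Qed.

(** Differentiation in [w] lowers the order by one and raises [t] by one, in step with the recursion
    of [negbinom]; the remainder can thus be bounded by induction, without an integral formula. *)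
Lemma vderive_taylor_rem (K : nat) (w : R) (t : C) : 0 < 1 + w ->
  vderive (fun x => taylor_rem (S K) x t) w (- t * taylor_rem K w (t + 1))%C.
Proof.
  intros Hw. unfold taylor_rem.
  replace (- t * (cpow (1 + w) (- (t + 1)) - csum K (fun i : nat => negbinom i (t + 1) * RtoC (w ^ i))))%C
    with (- t * cpow (1 + w) (- t - 1) - (negbinom 0 t * RtoC 0 + csum K (fun i => negbinom (S i) t * RtoC (INR (S i) * w ^ i))))%C.
  2:{ replace (- (t + 1))%C with (- t - 1)%C by ring.
      assert (E : csum K (fun i => negbinom (S i) t * RtoC (INR (S i) * w ^ i))%C =
        (- t * csum K (fun i => negbinom i (t + 1) * RtoC (w ^ i)))%C).
      { rewrite csum_mult_l. apply csum_ext. intros i _. rewrite negbinom_S.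
        rewrite RtoC_mult, RtoC_inv by (pose proof (INR_S_pos i); lra). field. intros Z.
        apply (f_equal Re) in Z. simpl Re in Z.
        change (INR (S i) = 0) in Z. pose proof (INR_S_pos i). lra. }
      rewrite E. ring. }
  apply vderive_minus. apply vderive_cpow; auto.
  apply vderive_ext with (fun x => negbinom 0 t * RtoC 1 + csum K (fun i => negbinom (S i) t * RtoC (x ^ S i)))%C.
  { intros x. rewrite csum_first. reflexivity. }
  apply vderive_plus. apply vderive_const_mult.
  exact (@is_derive_const R_AbsRing R_NormedModule 1 w).
  apply vderive_csum. intros i _. apply vderive_const_mult.
  apply is_derive_Reals. exact (derivable_pt_lim_pow w (S i)).
Qed.

(** The mean value theorem holds for real and imaginary parts separately, hence the factor 2. *)
Lemma vderive_bound (f f' : R -> C) (w M : R) : 0 <= w ->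
  (forall x, 0 <= x <= w -> vderive f x (f' x)) -> (forall x, 0 <= x <= w -> Cmod (f' x) <= M) ->
  Cmod (f w - f 0) <= 2 * M * w.
Proof.
  intros Hw Hf HM. eapply Rle_trans. apply Cmod_le_sum.
  assert (A : forall g g' : R -> R, (forall x, 0 <= x <= w -> is_derive g x (g' x)) ->
     (forall x, 0 <= x <= w -> Rabs (g' x) <= M) -> Rabs (g w - g 0) <= M * w).
  { intros g g' Hg Hg'. destruct (MVT_gen g 0 w g') as [c [Hc Ec]].
    - intros x. rewrite Rmin_left, Rmax_right by lra. intros; apply Hg; lra.
    - intros x. rewrite Rmin_left, Rmax_right by lra. intros Hx. apply continuity_pt_filterlim.
      apply (ex_derive_continuous g). eexists; apply Hg; lra.
    - rewrite Rmin_left, Rmax_right in Hc by lra.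
      rewrite Ec, Rminus_0_r, Rabs_mult, (Rabs_right w) by lra.
      apply Rmult_le_compat_r; auto. }
  assert (A1 := A (fun x => Re (f x)) (fun x => Re (f' x)) (fun x Hx => proj1 (Hf x Hx))
    (fun x Hx => Rle_trans _ _ _ (re_le_Cmod _) (HM x Hx))).
  assert (A2 := A (fun x => Im (f x)) (fun x => Im (f' x)) (fun x Hx => proj2 (Hf x Hx))
    (fun x Hx => Rle_trans _ _ _ (im_le_Cmod _) (HM x Hx))).
  change (Re (f w - f 0)) with (Re (f w) - Re (f 0)).
  change (Im (f w - f 0)) with (Im (f w) - Im (f 0)). cbv beta in A1, A2. lra.
Qed.

Lemma taylor_rem_0 (K : nat) (t : C) : taylor_rem (S K) 0 t = 0.
Proof.
  unfold taylor_rem. rewrite Rplus_0_r, csum_first.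
  assert (E : csum K (fun i => negbinom (S i) t * RtoC (0 ^ S i))%C = 0).
  { induction K. reflexivity. rewrite csum_S, IHK. simpl pow. rewrite Rmult_0_l. ring. }
  rewrite E. rewrite cpow_Cexp, ln_1, Cmult_0_l, Cexp_0. simpl. ring.
Qed.

(** After [K] differentiations [t] has become [t + K], and [(1 + w) ^ (- (t + K))] is bounded by 1
    exactly because its exponent has nonpositive real part: this is the hypothesis on
    [Re t + INR K]. *)
Lemma taylor_rem_bound (K : nat) (t : C) (T w : R) :
  0 <= Re t + INR K -> Cmod t <= T -> 0 <= w -> Cmod (taylor_rem K w t) <= taylor_const K T * w ^ K.
Proof.
  revert t T w. induction K; intros t T w Ht HT Hw.
  - unfold taylor_rem. rewrite csum_0. simpl INR in Ht. unfold Cminus.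
    rewrite Copp_0, Cplus_0_r, Cmod_cpow.
    replace (taylor_const 0 T * w ^ 0) with (exp 0) by (rewrite exp_0; simpl; ring).
    apply exp_le_compat.
    assert (0 <= ln (1 + w)) by (rewrite <- ln_1; apply ln_le; lra).
    replace (Re (- t)) with (- Re t) by (destruct t; reflexivity). nra.
  - assert (HT0 : 0 <= T) by (pose proof (Cmod_ge_0 t); lra).
    pose proof (vderive_bound (fun x => taylor_rem (S K) x t) (fun x => - t * taylor_rem K x (t + 1))%C w
      (T * (taylor_const K (T + 1) * w ^ K)) Hw) as B.
    cbv beta in B. rewrite taylor_rem_0 in B.
    replace (taylor_rem (S K) w t - 0)%C with (taylor_rem (S K) w t) in B by ring.
    simpl taylor_const. simpl pow.
    eapply Rle_trans. apply B.
    + intros x Hx. apply vderive_taylor_rem. lra.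
    + intros x Hx. rewrite Cmod_mult, Cmod_opp. apply Rmult_le_compat; auto; try apply Cmod_ge_0.
      eapply Rle_trans. apply (IHK (t + 1)%C (T + 1)).
      rewrite S_INR in Ht. replace (Re (t + 1)) with (Re t + 1) by (destruct t; reflexivity). lra.
      apply Cmod_add_1; auto. lra.
      apply Rmult_le_compat_l. apply taylor_const_pos; lra. apply pow_incr; lra.
    + right. ring.
Qed.

Definition interp_const (K : nat) (T : R) : R := 2 * taylor_const K T + taylor_const (S K) T.

(** For [w <= 1] the bound of order [K + 1] applies; for [w >= 1] the last subtracted term is given
    back and the bound of order [K] applies. The exponent [K + 1 - th] lies between the two, so it
    is admissible on both sides. Its freedom is what later makes both sums converge. *)
Lemma taylor_rem_interp (K : nat) (t : C) (T w th : R) :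
  0 <= Re t -> Cmod t <= T -> 0 < w -> 0 <= th <= 1 ->
  Cmod (taylor_rem (S K) w t) <= interp_const K T * exp ((INR (S K) - th) * ln w).
Proof.
  intros Ht HT Hw Hth.
  assert (HT0 : 0 <= T) by (pose proof (Cmod_ge_0 t); lra).
  pose proof (pos_INR K). pose proof (taylor_const_pos K T HT0).
  pose proof (taylor_const_pos (S K) T HT0).
  assert (Ew : forall n, w ^ n = exp (INR n * ln w)) by (intros n; rewrite <- Rpower_pow by auto; reflexivity).
  unfold interp_const. rewrite S_INR.
  destruct (Rle_dec w 1) as [L|G].
  - eapply Rle_trans. apply (taylor_rem_bound (S K) t T); auto. rewrite S_INR; lra. lra.
    rewrite Ew, S_INR.
    assert (exp ((INR K + 1) * ln w) <= exp ((INR K + 1 - th) * ln w)).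
    { apply exp_le_compat. assert (ln w <= 0) by (rewrite <- ln_1; apply ln_le; lra). nra. }
    pose proof (exp_pos ((INR K + 1 - th) * ln w)). nra.
  - assert (E : taylor_rem (S K) w t = (taylor_rem K w t - negbinom K t * RtoC (w ^ K))%C).
    { unfold taylor_rem. rewrite csum_S. ring. }
    rewrite E. eapply Rle_trans. apply Cmod_triangle_minus. rewrite Cmod_mult, Cmod_R.
    assert (Hwk : 0 <= w ^ K) by (apply pow_le; lra). rewrite (Rabs_right (w ^ K)) by lra.
    pose proof (taylor_rem_bound K t T w ltac:(lra) HT ltac:(lra)) as B1.
    pose proof (negbinom_bound K t T HT) as B2.
    assert (exp (INR K * ln w) <= exp ((INR K + 1 - th) * ln w)).
    { apply exp_le_compat. assert (0 <= ln w) by (rewrite <- ln_1; apply ln_le; lra). nra. }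
    rewrite <- Ew in H2.
    assert (Cmod (negbinom K t) * w ^ K <= taylor_const K T * w ^ K) by (apply Rmult_le_compat_r; auto).
    assert (taylor_const K T * w ^ K <= taylor_const K T * exp ((INR K + 1 - th) * ln w)) by (apply Rmult_le_compat_l; auto).
    pose proof (exp_pos ((INR K + 1 - th) * ln w)).
    assert (0 <= taylor_const (S K) T * exp ((INR K + 1 - th) * ln w)) by (apply Rmult_le_pos; lra).
    lra.
Qed.

(** The summand of the Mordell-Tornheim series minus the first [K] terms of its
    expansion in powers of [n / (m x)]. *)
Definition eterm (K : nat) (x : R) (r s t : C) (n m : nat) : C :=
  (cpow (INR n) (- r) * cpow (INR m) (- s) *
   (cpow (INR n + INR m * x) (- t)
    - csum K (fun i => negbinom i t * RtoC (INR n ^ i) * cpow (INR m * x) (- t - RtoC (INR i)))))%C.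

(** Factoring out [(m x) ^ (- t)] leaves a function of the ratio [n / (m x)] alone. *)
Lemma eterm_taylor_rem (K : nat) (x : R) (r s t : C) (n m : nat) : 0 < x ->
  eterm K x r s t (S n) (S m) =
  (cpow (INR (S n)) (- r) * cpow (INR (S m)) (- s) * cpow (INR (S m) * x) (- t)
   * taylor_rem K (INR (S n) / (INR (S m) * x)) t)%C.
Proof.
  intros Hx. unfold eterm, taylor_rem.
  pose proof (INR_S_pos n) as Pn. pose proof (INR_S_pos m) as Pm.
  set (y := INR (S m) * x). assert (Hy : 0 < y) by (apply Rmult_lt_0_compat; auto).
  set (k := INR (S n)) in *.
  replace (k + y) with (y * (1 + k / y)) by (field; lra).
  rewrite cpow_base_mult; auto. 2:{ assert (0 < k / y) by (apply Rdiv_lt_0_compat; auto). lra. }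
  assert (E : csum K (fun i => negbinom i t * RtoC (k ^ i) * cpow y (- t - RtoC (INR i)))%C
     = (cpow y (- t) * csum K (fun i => negbinom i t * RtoC ((k / y) ^ i)))%C).
  { rewrite csum_mult_l. apply csum_ext. intros i _.
    unfold Cminus. rewrite cpow_plus, (cpow_opp y (RtoC (INR i))), cpow_INR by auto.
    unfold Rdiv. rewrite Rpow_mult_distr, RtoC_mult, pow_inv, RtoC_inv by (apply pow_nonzero; lra).
    ring. }
  rewrite E. ring.
Qed.

(** The power [K + 1 - th] of [n / (m x)] weakens the decay in [n] and strengthens that in [m] by
    the same amount. The exponential constant absorbs the powers of [x], whether [x] is below or
    above 1. *)
Lemma eterm_bound (K : nat) (x a b th T : R) (r s t : C) (n m : nat) :
  0 < x -> 0 <= th <= 1 -> 0 <= Re t -> Cmod t <= T ->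
  a + INR (S K) - th <= Re r -> b - INR (S K) + th <= Re s + Re t ->
  Cmod (eterm (S K) x r s t (S n) (S m)) <=
  (interp_const K T * exp ((T + INR (S K)) * Rabs (ln x)) * Rpower (INR (S n)) (- a)) * Rpower (INR (S m)) (- b).
Proof.
  intros Hx Hth Ht HT Hr Hs. rewrite eterm_taylor_rem by auto.
  pose proof (INR_S_pos n) as Pn. pose proof (INR_S_pos m) as Pm.
  pose proof (INR_S_ge_1 n) as Qn. pose proof (INR_S_ge_1 m) as Qm.
  assert (Hy : 0 < INR (S m) * x) by (apply Rmult_lt_0_compat; auto).
  assert (HT0 : 0 <= T) by (pose proof (Cmod_ge_0 t); lra).
  assert (HtT : Re t <= T). { pose proof (re_le_Cmod t). pose proof (Rle_abs (Re t)). lra. }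
  pose proof (INR_S_ge_1 K) as QK.
  rewrite !Cmod_mult, !Cmod_cpow, ln_mult by auto.
  assert (Hw : 0 < INR (S n) / (INR (S m) * x)) by (apply Rdiv_lt_0_compat; auto).
  pose proof (taylor_rem_interp K t T _ th Ht HT Hw Hth) as B.
  rewrite ln_div, ln_mult in B by auto.
  assert (HI : 0 <= interp_const K T).
  { unfold interp_const. pose proof (taylor_const_pos K T HT0).
    pose proof (taylor_const_pos (S K) T HT0). lra. }
  set (Ln := ln (INR (S n))) in *. set (Lm := ln (INR (S m))) in *.
  assert (HLn : 0 <= Ln) by (unfold Ln; rewrite <- ln_1; apply ln_le; lra).
  assert (HLm : 0 <= Lm) by (unfold Lm; rewrite <- ln_1; apply ln_le; lra).
  unfold Rpower. fold Ln Lm.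
  replace (Re (- r)) with (- Re r) by (destruct r; reflexivity).
  replace (Re (- s)) with (- Re s) by (destruct s; reflexivity).
  replace (Re (- t)) with (- Re t) by (destruct t; reflexivity).
  eapply Rle_trans. apply Rmult_le_compat_l. repeat apply Rmult_le_pos; left; apply exp_pos.
  exact B.
  replace (exp (- Re r * Ln) * exp (- Re s * Lm) * exp (- Re t * (Lm + ln x)) *
    (interp_const K T * exp ((INR (S K) - th) * (Ln - (Lm + ln x)))))
   with (interp_const K T * exp ((- Re r + (INR (S K) - th)) * Ln + (- Re s - Re t - (INR (S K) - th)) * Lm
       + (- Re t - (INR (S K) - th)) * ln x)).
  2:{ rewrite (Rmult_comm (exp _ * exp _ * exp _)), Rmult_assoc. f_equal.
      rewrite <- !exp_plus. f_equal. ring. }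
  rewrite !Rmult_assoc. apply Rmult_le_compat_l; auto.
  rewrite <- !exp_plus. apply exp_le_compat.
  assert (X1 : (- Re r + (INR (S K) - th)) * Ln <= - a * Ln) by (apply Rmult_le_compat_r; lra).
  assert (X2 : (- Re s - Re t - (INR (S K) - th)) * Lm <= - b * Lm) by (apply Rmult_le_compat_r; lra).
  assert (X3 : (- Re t - (INR (S K) - th)) * ln x <= (T + INR (S K)) * Rabs (ln x)).
  { pose proof (Rle_abs (ln x)). pose proof (Rle_abs (- ln x)). rewrite Rabs_Ropp in H0.
    pose proof (Rabs_pos (ln x)).
    apply Rle_trans with ((Re t + (INR (S K) - th)) * Rabs (ln x)).
    replace ((- Re t - (INR (S K) - th)) * ln x) with ((Re t + (INR (S K) - th)) * (- ln x)) by ring.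
    apply Rmult_le_compat_l; lra. apply Rmult_le_compat_r; lra. }
  lra.
Qed.

(** * Integer exponents *)

(** The number of multisets of size [j] from [r] kinds. The convention for [binom (-1) 0] gives the
    value 1 at [r = j = 0], so the Pascal rule [multichoose_SS] holds without exception. *)
Definition multichoose (r j : nat) : R := binom (Z.of_nat j + Z.of_nat r - 1) (Z.of_nat j).

Lemma binom_nat (a b : nat) : (b <= a)%nat -> binom (Z.of_nat a) (Z.of_nat b) = Binomial.C a b.
Proof.
  intros H. unfold binom.
  replace (Z.leb 0 (Z.of_nat a)) with true by (symmetry; apply Z.leb_le; lia).
  replace (Z.leb 0 (Z.of_nat b)) with true by (symmetry; apply Z.leb_le; lia).
  replace (Z.leb (Z.of_nat b) (Z.of_nat a)) with true by (symmetry; apply Z.leb_le; lia).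
  simpl. rewrite !Nat2Z.id. reflexivity.
Qed.

Lemma binom_out (a b : Z) : (0 <= a)%Z -> (b < 0 \/ a < b)%Z -> binom a b = 0.
Proof.
  intros Ha H. unfold binom.
  replace (Z.leb 0 a) with true by (symmetry; apply Z.leb_le; lia).
  destruct (Z.leb_spec 0 b); destruct (Z.leb_spec b a); simpl; auto; lia.
Qed.

Lemma multichoose_S (r j : nat) : multichoose (S r) j = Binomial.C (j + r) j.
Proof.
  unfold multichoose. replace (Z.of_nat j + Z.of_nat (S r) - 1)%Z with (Z.of_nat (j + r)) by lia.
  apply binom_nat. lia.
Qed.

Lemma C_n_n (n : nat) : Binomial.C n n = 1.
Proof. unfold Binomial.C. rewrite Nat.sub_diag. simpl. field. apply INR_fact_neq_0. Qed.

Lemma C_n_0 (n : nat) : Binomial.C n 0 = 1.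
Proof. unfold Binomial.C. rewrite Nat.sub_0_r. simpl. field. apply INR_fact_neq_0. Qed.

Lemma multichoose_0_r (r : nat) : multichoose r 0 = 1.
Proof. destruct r. reflexivity. rewrite multichoose_S. apply C_n_0. Qed.

Lemma multichoose_0_l (j : nat) : multichoose 0 (S j) = 0.
Proof. apply binom_out; lia. Qed.

Lemma multichoose_SS (r j : nat) :
  multichoose (S r) (S j) = multichoose r (S j) + multichoose (S r) j.
Proof.
  rewrite !multichoose_S. destruct r.
  - rewrite multichoose_0_l, !Nat.add_0_r, !C_n_n. ring.
  - rewrite multichoose_S. replace (S j + S r)%nat with (S (S (j + r))) by lia.
    replace (S j + r)%nat with (S (j + r)) by lia. replace (j + S r)%nat with (S (j + r)) by lia.
    rewrite <- (pascal (S (j + r)) j) by lia. ring.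
Qed.

Lemma multichoose_sym (r t : nat) : multichoose (S t) r = multichoose (S r) t.
Proof.
  rewrite !multichoose_S. rewrite (pascal_step1 (r + t) r) by lia.
  f_equal; lia.
Qed.

(** The recursion of [negbinom] at integers, up to sign. *)
Lemma multichoose_shift (t i : nat) :
  INR (S i) * multichoose t (S i) = INR t * multichoose (S t) i.
Proof.
  revert t. induction i.
  - induction t. rewrite multichoose_0_l. simpl; ring.
    rewrite multichoose_SS, !multichoose_0_r. rewrite multichoose_0_r in IHt.
    pose proof (S_INR t). change (INR 1) with 1 in *. lra.
  - induction t. rewrite multichoose_0_l. simpl; ring.
    rewrite multichoose_SS, (multichoose_SS (S t) i).
    pose proof (IHi (S t)) as E. rewrite !S_INR in *. nra.
Qed.

Lemma negbinom_INR (i t : nat) : negbinom i (RtoC (INR t)) = RtoC ((-1) ^ i * multichoose t i).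
Proof.
  revert t. induction i; intros t.
  - rewrite multichoose_0_r. simpl. f_equal. ring.
  - rewrite negbinom_S.
    replace (RtoC (INR t) + 1)%C with (RtoC (INR (S t))) by (rewrite S_INR, RtoC_plus; reflexivity).
    rewrite IHi, <- RtoC_opp, <- !RtoC_mult. f_equal.
    pose proof (multichoose_shift t i). pose proof (INR_S_pos i).
    apply (Rmult_eq_reg_l (INR (S i))); [|lra].
    replace (INR (S i) * ((-1) ^ S i * multichoose t (S i))) with ((-1) ^ S i * (INR (S i) * multichoose t (S i))) by ring.
    rewrite H. simpl pow. field. lra.
Qed.

(** * Partial fractions of [n^-r (n + m x)^-t] *)

Lemma RtoC_m1 : RtoC (-1) = (- RtoC 1)%C.
Proof. rewrite <- RtoC_opp. reflexivity. Qed.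

(** The principal part at one of the two poles: powers [a ^ p] down to [a ^ 1]. The sign is -1 at
    the pole of [1 / n] and 1 at that of [1 / (n + m x)]. *)
Definition pf_sum (sg : R) (v a : C) (p q : nat) : C :=
  csum p (fun i => RtoC (sg ^ i * multichoose q i) * v ^ (q + i) * a ^ (p - i))%C.

Lemma pf_sum_0_r (sg : R) (v a : C) (p : nat) : pf_sum sg v a (S p) 0 = (a ^ S p)%C.
Proof.
  unfold pf_sum. rewrite csum_first.
  assert (E : csum p (fun i => RtoC (sg ^ S i * multichoose 0 (S i)) * v ^ (0 + S i) * a ^ (S p - S i))%C = 0).
  { assert (Z : forall k, csum k (fun _ => 0) = 0) by (induction k; [reflexivity|rewrite csum_S, IHk; ring]).
    rewrite <- (Z p). apply csum_ext. intros i _. rewrite multichoose_0_l, Rmult_0_r. ring. }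
  rewrite E, multichoose_0_r. simpl. rewrite Rmult_1_l. ring.
Qed.

Lemma pf_sum_rec (sg : R) (v a : C) (p q : nat) :
  pf_sum sg v a (S p) (S q) = (v * pf_sum sg v a (S p) q + RtoC sg * v * pf_sum sg v a p (S q))%C.
Proof.
  unfold pf_sum. rewrite !(csum_first p), Cmult_plus_distr_l, !csum_mult_l.
  rewrite !multichoose_0_r.
  assert (E : csum p (fun i => RtoC (sg ^ S i * multichoose (S q) (S i)) * v ^ (S q + S i) * a ^ (S p - S i))%C
   = (csum p (fun i => v * (RtoC (sg ^ S i * multichoose q (S i)) * v ^ (q + S i) * a ^ (S p - S i)))
     + csum p (fun i => RtoC sg * v * (RtoC (sg ^ i * multichoose (S q) i) * v ^ (S q + i) * a ^ (p - i))))%C).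
  { assert (P : forall k f g, (csum k f + csum k g)%C = csum k (fun i => f i + g i)%C).
    { induction k; intros f g. rewrite !csum_0; ring. rewrite !csum_S, <- IHk. ring. }
    rewrite P. apply csum_ext. intros i _. rewrite multichoose_SS.
    replace (S p - S i)%nat with (p - i)%nat by lia.
    replace (S q + S i)%nat with (S (S (q + i))) by lia.
    replace (q + S i)%nat with (S (q + i)) by lia.
    replace (S q + i)%nat with (S (q + i)) by lia.
    simpl pow. simpl Cpow. rewrite !RtoC_mult, !RtoC_plus. ring. }
  rewrite E. simpl pow. replace (S q + 0)%nat with (S (q + 0)) by lia. simpl Cpow. ring.
Qed.

(** Applied to [a = 1 / n], [b = 1 / (n + m x)], [v = 1 / (m x)]. The relation between them is all
    that is needed: it gives [a ^ (r+1) * b ^ (t+1) = v * (a ^ (r+1) * b ^ t - a ^ r * b ^ (t+1))],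
    a double induction that [pf_sum_rec] follows on the other side. *)
Lemma partial_fractions (a b v : C) (r t : nat) :
  (a * b = v * (a - b))%C -> (1 <= r + t)%nat ->
  (a ^ r * b ^ t = pf_sum (-1) v a r t + RtoC ((-1) ^ r) * pf_sum 1 v b t r)%C.
Proof.
  intros H. revert t. induction r; intros t Ht.
  - destruct t; [lia|]. rewrite pf_sum_0_r. unfold pf_sum. rewrite csum_0. simpl. ring.
  - induction t.
    + rewrite pf_sum_0_r. unfold pf_sum. rewrite csum_0. simpl. ring.
    + rewrite !pf_sum_rec. assert (A1 := IHr (S t) ltac:(lia)). assert (A2 := IHt ltac:(lia)).
      transitivity (v * (a ^ S r * b ^ t) - v * (a ^ r * b ^ S t))%C.
      { simpl Cpow. transitivity ((a * b) * (a ^ r * b ^ t))%C. ring. rewrite H. ring. }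
      rewrite A1, A2. simpl pow. rewrite !RtoC_mult, !RtoC_m1. ring.
Qed.

(** The common coefficient, up to sign, of the two simple poles. That [last_coef_l] and
    [last_coef_r] give the same number is what joins the divergent sums of [1 / n] and
    [1 / (n + m x)] into a convergent difference. *)
Definition last_coef (r t : nat) : R := binom (Z.of_nat r + Z.of_nat t - 2) (Z.of_nat t - 1).

Lemma last_coef_l (r t : nat) : (2 <= S r + t)%nat -> last_coef (S r) t = multichoose t r.
Proof.
  intros H. unfold last_coef. destruct t.
  - rewrite binom_out by lia. destruct r; [lia|]. symmetry. apply multichoose_0_l.
  - rewrite multichoose_sym. unfold multichoose. f_equal; lia.
Qed.

Lemma last_coef_r (r t : nat) : last_coef r (S t) = multichoose r t.
Proof. unfold last_coef, multichoose. f_equal; lia. Qed.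

(** The subtracted terms are exactly the powers [a ^ r] to [a ^ 2] of the expansion: the [r - 1]
    terms that become products of zeta values. The two first powers remain and combine into
    [a - b]. *)
Lemma partial_fractions_truncated (a b v : C) (r t : nat) :
  (a * b = v * (a - b))%C -> (2 <= r + t)%nat ->
  (a ^ r * b ^ t - csum (r - 1) (fun i => RtoC ((-1) ^ i * multichoose t i) * v ^ (t + i) * a ^ (r - i))
   = - RtoC ((-1) ^ r * last_coef r t) * v ^ (r + t - 1) * (a - b)
     + RtoC ((-1) ^ r) * csum (t - 1) (fun j => RtoC (multichoose r j) * v ^ (r + j) * b ^ (t - j)))%C.
Proof.
  intros H Ht. rewrite (partial_fractions a b v r t H) by lia.
  assert (E1 : pf_sum (-1) v a r t = (csum (r - 1) (fun i => RtoC ((-1) ^ i * multichoose t i) * v ^ (t + i) * a ^ (r - i))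
     - RtoC ((-1) ^ r * last_coef r t) * v ^ (r + t - 1) * a)%C).
  { unfold pf_sum. destruct r.
    (* For [r = 0] there is no last term to split off, as [r - 1] is truncated to 0; the formula
       survives because [last_coef 0 t] vanishes for [t >= 2]. *)
    - destruct t as [|t]; [lia|]. rewrite last_coef_r. destruct t as [|t]; [lia|].
      rewrite multichoose_0_l, Rmult_0_r.
      rewrite !csum_0. ring.
    - rewrite csum_S. replace (S r - 1)%nat with r by lia. rewrite last_coef_l by lia.
      replace (S r - r)%nat with 1%nat by lia. replace (S r + t - 1)%nat with (t + r)%nat by lia.
      simpl pow. rewrite !RtoC_mult, !RtoC_m1. simpl Cpow. ring. }
  assert (E2 : pf_sum 1 v b t r = (csum (t - 1) (fun j => RtoC (multichoose r j) * v ^ (r + j) * b ^ (t - j))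
     + RtoC (last_coef r t) * v ^ (r + t - 1) * b)%C).
  { unfold pf_sum. destruct t.
    - destruct r as [|r]; [lia|]. rewrite last_coef_l by lia. destruct r as [|r]; [lia|].
      rewrite multichoose_0_l.
      rewrite !csum_0. ring.
    - rewrite csum_S. replace (S t - 1)%nat with t by lia. rewrite last_coef_r.
      replace (S t - t)%nat with 1%nat by lia. replace (r + S t - 1)%nat with (r + t)%nat by lia.
      rewrite pow1, Rmult_1_l. simpl Cpow. rewrite Cmult_1_r. f_equal.
      apply csum_ext. intros i _. rewrite pow1, Rmult_1_l. reflexivity. }
  rewrite E1, E2. rewrite !RtoC_mult. ring.
Qed.

(** * Summation over [n] at integer exponents *)

Lemma iter_real_swap (w : C) (g : nat -> nat -> R) (al be : nat -> R) :
  ex_series al -> ex_series be -> (forall m, ex_series (fun n => g n m)) ->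
  (forall n m, Cmod (cpow (INR (S m)) (- w) * RtoC (g n m)) <= al n * be m) ->
  exists L, is_iter (fun n m => cpow (INR (S m)) (- w) * RtoC (g n m))%C L /\
    is_Cseries (fun m => cpow (INR (S m)) (- w) * RtoC (Series (fun n => g n m)))%C L.
Proof.
  intros Xal Xbe Xg B.
  destruct (double_series_swap al be _ Xal Xbe B) as [L [I1 [c [C1 C2]]]].
  exists L. split; auto. apply (is_Cseries_ext c); auto.
  intros m. apply (is_Cseries_unique (fun n => cpow (INR (S m)) (- w) * RtoC (g n m))%C). apply C1.
  apply is_Cseries_mult_l. apply is_Cseries_RtoC. apply Xg.
Qed.

Lemma ln_interp (n y : R) (th : R) : 0 < n -> 0 < y -> 0 <= th <= 1 ->
  th * ln n + (1 - th) * ln y <= ln (n + y).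
Proof.
  intros Hn Hy Hth.
  assert (ln n <= ln (n + y)) by (apply ln_le; lra).
  assert (ln y <= ln (n + y)) by (apply ln_le; lra). nra.
Qed.

(** With [y = m x], the difference is [y / (n * (n + y))], and [n + y >= n ^ th * y ^ (1 - th)]
    bounds it by [y ^ th / n ^ (1 + th)]. The sum over [m] then needs [Re w - th > 1]; half of the
    slack [Re w - 1] is spent on [th]. *)
Lemma digamma_summand_bound (x : R) (w : C) : 0 < x -> 1 < Re w ->
  exists al be : nat -> R, ex_series al /\ ex_series be /\ forall n m,
  Cmod (cpow (INR (S m)) (- w) * RtoC (/ INR (S n) - / (INR (S n) + INR (S m) * x))) <= al n * be m.
Proof.
  intros Hx Hw.
  set (th := Rmin 1 ((Re w - 1) / 2)).
  assert (Hth : 0 < th <= 1) by (split; [apply Rmin_pos; lra | apply Rmin_l]).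
  assert (Hth2 : th <= (Re w - 1) / 2) by apply Rmin_r.
  exists (fun n => exp (th * ln x) * Rpower (INR (S n)) (- (1 + th))), (fun m => Rpower (INR (S m)) (- (Re w - th))).
  split; [|split].
  - apply ex_series_scal_R. apply ex_series_Rpower. lra.
  - apply ex_series_Rpower. lra.
  - intros n m. pose proof (INR_S_pos n) as Pn. pose proof (INR_S_pos m) as Pm.
    rewrite Cmod_mult, Cmod_cpow, Cmod_R.
    set (k := INR (S n)) in *. set (mm := INR (S m)) in *.
    assert (Hy : 0 < mm * x) by (apply Rmult_lt_0_compat; auto).
    assert (Ey : / k - / (k + mm * x) = exp (ln (mm * x) - ln k - ln (k + mm * x))).
    { unfold Rminus. rewrite !exp_plus, !exp_Ropp, !exp_ln by lra. field. split; lra. }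
    rewrite Ey, Rabs_right by (left; apply exp_pos).
    replace (Re (- w)) with (- Re w) by (destruct w; reflexivity).
    unfold Rpower. rewrite <- !exp_plus. apply exp_le_compat.
    pose proof (ln_interp k (mm * x) th Pn Hy ltac:(lra)) as LI.
    rewrite ln_mult in * by auto. lra.
Qed.

Lemma digamma_iter (x : R) (w : C) : 0 < x -> 1 < Re w ->
  exists L, is_Cseries (digamma_term x w) L /\
  is_iter (fun n m => cpow (INR (S m)) (- w) * RtoC (/ INR (S n) - / (INR (S n) + INR (S m) * x)))%C L.
Proof.
  intros Hx Hw. destruct (digamma_summand_bound x w Hx Hw) as [al [be [Xal [Xbe Bd]]]].
  destruct (iter_real_swap w (fun n m => / INR (S n) - / (INR (S n) + INR (S m) * x)) al be) as [L [I1 I2]]; auto.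
  - intros m. apply (ex_series_ext (fun n => / INR (S n) - / (INR n + (1 + INR (S m) * x)))).
    intros n. rewrite (S_INR n). do 2 f_equal. ring.
    apply ex_digamma_series. pose proof (INR_S_pos m).
    assert (0 < INR (S m) * x) by (apply Rmult_lt_0_compat; auto). lra.
  - exists L. split; auto.
    apply (is_Cseries_ext (fun m => cpow (INR (S m)) (- w) * RtoC (Series (fun n => (/ INR (S n) - / (INR (S n) + INR (S m) * x))%R)))%C); auto.
    intros m. unfold digamma_term, Cdiv. rewrite cpow_opp, Cmult_comm. f_equal. f_equal.
    rewrite digamma_eq. unfold digamma_series.
    replace (Series (fun n => / INR (S n) - / (INR n + (INR (S m) * x + 1)))) with (Series (fun n : nat => / INR (S n) - / (INR (S n) + INR (S m) * x))).
    ring. apply Series_ext. intros n. rewrite (S_INR n). do 2 f_equal. ring.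
    pose proof (INR_S_pos m). assert (0 < INR (S m) * x) by (apply Rmult_lt_0_compat; auto). lra.
Qed.

(** Of the [k + 2] factors [n + m x], an amount [1 + th] is estimated by [n] and the rest,
    [k + 1 - th], by [m x]. The factor [(-1) ^ k / (k + 1)!] inverts the one in [polygamma_eq],
    because [(-1) ^ k] squares to 1. *)
Lemma polygamma_iter (x : R) (k : nat) (w : C) : 0 < x -> 1 < Re w + INR (S k) ->
  exists L, is_Cseries (polygamma_term x (S k) w) L /\
  is_iter (fun n m => cpow (INR (S m)) (- w) * RtoC (/ (INR (S n) + INR (S m) * x) ^ (S (S k))))%C
    (RtoC ((-1) ^ k / INR (fact (S k))) * L)%C.
Proof.
  intros Hx Hw. pose proof (INR_S_ge_1 k) as Qk.
  set (th := Rmin 1 ((Re w + INR (S k) - 1) / 2)).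
  assert (Hth : 0 < th <= 1) by (split; [apply Rmin_pos; lra | apply Rmin_l]).
  assert (Hth2 : th <= (Re w + INR (S k) - 1) / 2) by apply Rmin_r.
  assert (Sh : forall n m, INR n + (1 + INR (S m) * x) = INR (S n) + INR (S m) * x) by (intros; rewrite (S_INR n); ring).
  destruct (iter_real_swap w (fun n m => / (INR (S n) + INR (S m) * x) ^ (S (S k)))
    (fun n => exp ((th - INR (S k)) * ln x) * Rpower (INR (S n)) (- (1 + th)))
    (fun m => Rpower (INR (S m)) (- (Re w + INR (S k) - th)))) as [L [I1 I2]].
  - apply ex_series_scal_R. apply ex_series_Rpower. lra.
  - apply ex_series_Rpower. lra.
  - intros m. apply (ex_series_ext (fun n => / (INR n + (1 + INR (S m) * x)) ^ (S (S k)))).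
    intros n. rewrite Sh. reflexivity.
    apply ex_series_inv_pow. pose proof (INR_S_pos m).
    assert (0 < INR (S m) * x) by (apply Rmult_lt_0_compat; auto). lra.
  - intros n m. pose proof (INR_S_pos n) as Pn. pose proof (INR_S_pos m) as Pm.
    rewrite Cmod_mult, Cmod_cpow, Cmod_R.
    set (i := INR (S n)) in *. set (mm := INR (S m)) in *.
    assert (Hy : 0 < mm * x) by (apply Rmult_lt_0_compat; auto).
    assert (Ey : / (i + mm * x) ^ S (S k) = exp (- (INR (S k) + 1) * ln (i + mm * x))).
    { rewrite <- (Rpower_pow (S (S k))) by lra. unfold Rpower. rewrite <- exp_Ropp. f_equal.
      rewrite (S_INR (S k)). ring. }
    rewrite Ey, Rabs_right by (left; apply exp_pos).
    replace (Re (- w)) with (- Re w) by (destruct w; reflexivity).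
    unfold Rpower. rewrite <- !exp_plus. apply exp_le_compat.
    assert (L1 : ln i <= ln (i + mm * x)) by (apply ln_le; lra).
    assert (L2 : ln (mm * x) <= ln (i + mm * x)) by (apply ln_le; lra).
    rewrite ln_mult in L2 by auto.
    assert (M1 : (1 + th) * ln i <= (1 + th) * ln (i + mm * x)) by (apply Rmult_le_compat_l; lra).
    assert (M2 : (INR (S k) - th) * (ln mm + ln x) <= (INR (S k) - th) * ln (i + mm * x)) by (apply Rmult_le_compat_l; lra).
    lra.
  - assert (Hf : INR (fact (S k)) <> 0) by apply INR_fact_neq_0.
    assert (Hs : (-1) ^ k * (-1) ^ k = 1) by (rewrite <- Rpow_mult_distr; replace (-1 * -1) with 1 by ring; apply pow1).
    exists (RtoC ((-1) ^ k * INR (fact (S k))) * L)%C. split.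
    + apply (is_Cseries_ext (fun m => RtoC ((-1) ^ k * INR (fact (S k))) * (cpow (INR (S m)) (- w) * RtoC (Series (fun n => (/ (INR (S n) + INR (S m) * x) ^ (S (S k)))%R))))%C).
      2: apply is_Cseries_mult_l; auto.
      intros m. unfold polygamma_term, Cdiv. rewrite cpow_opp, polygamma_eq.
      rewrite !RtoC_mult.
      replace (Series (fun n => / (INR n + (INR (S m) * x + 1)) ^ S (S k))) with (Series (fun n : nat => / (INR (S n) + INR (S m) * x) ^ S (S k))).
      ring. apply Series_ext. intros n. rewrite <- Sh. do 2 f_equal. ring.
      pose proof (INR_S_pos m). assert (0 < INR (S m) * x) by (apply Rmult_lt_0_compat; auto). lra.
    + rewrite Cmult_assoc, <- RtoC_mult.
      replace ((-1) ^ k / INR (fact (S k)) * ((-1) ^ k * INR (fact (S k)))) with 1.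
      rewrite Cmult_1_l. exact I1.
      transitivity ((-1) ^ k * (-1) ^ k). auto. field. auto.
Qed.

Lemma Cmult_opp_r_swap (a b : C) : (a * - b = - (a * b))%C.
Proof. ring. Qed.

Lemma RtoC_inv_pow (y : R) (n : nat) : y <> 0 -> (RtoC (/ y) ^ n)%C = RtoC (/ y ^ n).
Proof. intros H. rewrite <- RtoC_pow, pow_inv. reflexivity. Qed.

Lemma eterm_integer (x : R) (r t : nat) (s : C) (n m : nat) : 0 < x ->
  eterm (r - 1) x (RtoC (INR r)) s (RtoC (INR t)) (S n) (S m) =
  (cpow (INR (S m)) (- s) *
   (RtoC (/ INR (S n)) ^ r * RtoC (/ (INR (S n) + INR (S m) * x)) ^ t
    - csum (r - 1) (fun i => RtoC ((-1) ^ i * multichoose t i) * RtoC (/ (INR (S m) * x)) ^ (t + i) * RtoC (/ INR (S n)) ^ (r - i))))%C.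
Proof.
  intros Hx. unfold eterm.
  pose proof (INR_S_pos n) as Pn. pose proof (INR_S_pos m) as Pm.
  set (k := INR (S n)) in *. set (y := INR (S m) * x).
  assert (Hy : 0 < y) by (apply Rmult_lt_0_compat; auto).
  rewrite (Cmult_comm (cpow k _)), <- Cmult_assoc. f_equal.
  rewrite !cpow_opp, !cpow_INR by lra.
  rewrite !RtoC_inv_pow by lra. rewrite !RtoC_inv by (apply pow_nonzero; lra).
  unfold Cminus. rewrite Cmult_plus_distr_l. f_equal.
  rewrite Cmult_opp_r_swap. f_equal. rewrite csum_mult_l. apply csum_ext. intros i Hi.
  rewrite negbinom_INR. rewrite !RtoC_inv_pow by lra.
  replace (- RtoC (INR t) + - RtoC (INR i))%C with (- RtoC (INR (t + i)))%C by (rewrite plus_INR, RtoC_plus; ring).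
  rewrite cpow_opp, cpow_INR, <- !RtoC_inv by (try apply pow_nonzero; lra).
  replace r with (r - i + i)%nat at 1 by lia. rewrite pow_add.
  assert (k ^ i <> 0) by (apply pow_nonzero; lra).
  assert (k ^ (r - i) <> 0) by (apply pow_nonzero; lra).
  rewrite <- !RtoC_mult. f_equal. field. split; auto. split; auto. apply pow_nonzero; lra.
Qed.

Lemma eterm_integer_iter (x : R) (r t : nat) (s : C) :
  0 < x -> (2 <= r + t)%nat -> 2 - INR r - INR t < Re s ->
  is_iter (fun n m => eterm (r - 1) x (RtoC (INR r)) s (RtoC (INR t)) (S n) (S m))
   (- RtoC ((-1) ^ r / x ^ (r + t - 1) * last_coef r t)
      * CSeries (digamma_term x (RtoC (INR r) + s + RtoC (INR t) - RtoC 1))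
    + RtoC ((-1) ^ r)
      * csum (t - 1) (fun j : nat =>
          RtoC (multichoose r j
                * ((-1) ^ (t - j) / INR (Factorial.fact (t - j - 1)))
                * (1 / x ^ (j + r)))
          * CSeries (polygamma_term x (t - j - 1)
                       (RtoC (INR r) + s + RtoC (INR j)))))%C.
Proof.
  intros Hx Hrt Hs.
  set (w := (RtoC (INR r) + s + RtoC (INR t) - RtoC 1)%C).
  assert (Hw : 1 < Re w). { unfold w. destruct s; simpl in *. lra. }
  destruct (digamma_iter x w Hx Hw) as [L [L1 L2]].
  rewrite (CSeries_unique _ _ L1).
  apply (is_iter_ext (fun n m =>
    - RtoC ((-1) ^ r / x ^ (r + t - 1) * last_coef r t) * (cpow (INR (S m)) (- w) * RtoC (/ INR (S n) - / (INR (S n) + INR (S m) * x)))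
    + RtoC ((-1) ^ r) * csum (t - 1) (fun j =>
       RtoC (multichoose r j * (1 / x ^ (j + r))) * (cpow (INR (S m)) (- (RtoC (INR r) + s + RtoC (INR j))) * RtoC (/ (INR (S n) + INR (S m) * x) ^ (t - j)))))%C).
  - intros n m. rewrite eterm_integer by auto.
    pose proof (INR_S_pos n) as Pn. pose proof (INR_S_pos m) as Pm.
    set (k := INR (S n)) in *. set (mm := INR (S m)) in *.
    assert (Hy : 0 < mm * x) by (apply Rmult_lt_0_compat; auto).
    rewrite partial_fractions_truncated; auto.
    2:{ rewrite <- RtoC_minus, <- !RtoC_mult. f_equal. field. repeat split; lra. }
    (* Powers of [v = 1 / (m x)] are distributed: [x ^ (- i)] goes to the coefficient, [m ^ (- i)]
       to the exponent of the Dirichlet series. *)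
    assert (Vp : forall i z, z = (s + RtoC (INR i))%C -> (RtoC (/ (mm * x)) ^ i * cpow mm (- s))%C = (RtoC (/ x ^ i) * cpow mm (- z))%C).
    { intros i z ->. rewrite RtoC_inv_pow by lra.
      replace (- (s + RtoC (INR i)))%C with (- s + - RtoC (INR i))%C by ring.
      rewrite cpow_plus, (cpow_opp mm (RtoC (INR i))), cpow_INR by auto.
      rewrite <- RtoC_inv by (apply pow_nonzero; lra).
      rewrite Rpow_mult_distr, Rinv_mult, RtoC_mult. ring. }
    symmetry. rewrite Cmult_plus_distr_l. f_equal.
    + rewrite <- RtoC_minus.
      transitivity (- RtoC ((-1) ^ r * last_coef r t) * (RtoC (/ (mm * x)) ^ (r + t - 1) * cpow mm (- s)) * RtoC (/ k - / (k + mm * x)))%C. ring.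
      rewrite (Vp (r + t - 1)%nat w).
      2:{ unfold w. rewrite minus_INR, plus_INR by lia. rewrite RtoC_minus, RtoC_plus. simpl INR.
      ring. }
      unfold Rdiv. rewrite !RtoC_mult. ring.
    + rewrite Cmult_assoc, (Cmult_comm (cpow mm (- s))), <- Cmult_assoc. f_equal.
      rewrite csum_mult_l. apply csum_ext. intros j Hj.
      transitivity (RtoC (multichoose r j) * (RtoC (/ (mm * x)) ^ (r + j) * cpow mm (- s)) * RtoC (/ (k + mm * x)) ^ (t - j))%C. ring.
      rewrite (Vp (r + j)%nat (RtoC (INR r) + s + RtoC (INR j))%C).
      2:{ rewrite plus_INR, RtoC_plus. ring. }
      rewrite (RtoC_inv_pow (k + mm * x)) by lra.
      unfold Rdiv. rewrite Rmult_1_l, !RtoC_mult, (Nat.add_comm j r). ring.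
  - apply is_iter_plus. apply is_iter_mult_l. exact L2.
    apply is_iter_mult_l.
    apply (is_iter_csum (t - 1) (fun j n m => RtoC (multichoose r j * (1 / x ^ (j + r))) * (cpow (INR (S m)) (- (RtoC (INR r) + s + RtoC (INR j))) * RtoC (/ (INR (S n) + INR (S m) * x) ^ (t - j))))%C).
    intros j Hj.
    assert (Hk : exists k, (t - j - 1 = S k)%nat) by (exists (t - j - 2)%nat; lia).
    destruct Hk as [k Hk].
    destruct (polygamma_iter x k (RtoC (INR r) + s + RtoC (INR j))%C Hx) as [M [M1 M2]].
    { rewrite <- Hk, !minus_INR by lia. destruct s; simpl in *. lra. }
    (* Here [t - j] is [k + 2], so the sign [(-1) ^ (t - j)] of the formula agrees with the
       [(-1) ^ k] of [polygamma_iter]. *)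
    rewrite Hk, (CSeries_unique _ _ M1). replace (t - j)%nat with (S (S k)) by lia.
    replace (RtoC (multichoose r j * ((-1) ^ S (S k) / INR (fact (S k))) * (1 / x ^ (j + r))) * M)%C
     with (RtoC (multichoose r j * (1 / x ^ (j + r))) * (RtoC ((-1) ^ k / INR (fact (S k))) * M))%C.
    apply is_iter_mult_l. exact M2.
    rewrite Cmult_assoc, <- RtoC_mult. f_equal. f_equal. simpl pow. unfold Rdiv. ring.
Qed.

Lemma series_existence (x : R) (r t : nat) (s : C) :
  0 < x -> (1 <= r + t)%nat -> 2 - INR r - INR t < Re s ->
  ex_Cseries (digamma_term x (RtoC (INR r) + s + RtoC (INR t) - RtoC 1)%C) /\
  (forall j : nat, (j + 2 <= t)%nat ->
     ex_Cseries (polygamma_term x (t - j - 1) (RtoC (INR r) + s + RtoC (INR j))%C)).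
Proof.
  intros Hx Hrt Hs. split.
  - destruct (digamma_iter x (RtoC (INR r) + s + RtoC (INR t) - RtoC 1)%C Hx) as [L [L1 _]].
    { destruct s; simpl in *. lra. }
    exists L. exact L1.
  - intros j Hj.
    assert (Hk : exists k, (t - j - 1 = S k)%nat) by (exists (t - j - 2)%nat; lia).
    destruct Hk as [k Hk].
    destruct (polygamma_iter x k (RtoC (INR r) + s + RtoC (INR j))%C Hx) as [M [M1 _]].
    { rewrite <- Hk, !minus_INR by lia. destruct s; simpl in *. lra. }
    rewrite Hk. exists M. exact M1.
Qed.

(** * The continuation of the Mordell-Tornheim series *)


Lemma Ceq_eps (a b : C) : (forall eps, 0 < eps -> Cmod (a - b) <= eps) -> a = b.
Proof.
  intros H. destruct (Ceq_dec (a - b) 0) as [E|E].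
  replace a with (a - b + b)%C by ring. rewrite E. ring.
  exfalso. apply Cmod_gt_0 in E. specialize (H (Cmod (a - b) / 2) ltac:(lra)). lra.
Qed.

(** An [eps / 3] argument through the approximant. Only a ray issuing from [p] has to stay in [S],
    so [p] may be a boundary point, as happens for [t = 0]. *)
Lemma lhol_line_lim {U : NormedModule C_AbsRing} (S : U -> Prop) (f : U -> C) (p v : U) (d : R) :
  lhol S f -> S p -> 0 < d -> (forall e, 0 < e < d -> S (line p v (RtoC e))) ->
  forall eps, 0 < eps -> exists d', 0 < d' /\ forall e, 0 < e < d' -> Cmod (f (line p v (RtoC e)) - f p) <= eps.
Proof.
  intros Hf Hp Hd Hline eps He.
  destruct (Hf (eps / 3)) as [g [G1 G2]]. lra.
  destruct (cdiff_ccont _ _ (G1 p Hp v) (eps / 3)) as [d1 [Hd1 K]]. lra.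
  exists (Rmin d d1). split. apply Rmin_pos; auto. intros e Hde.
  Rmin_bounds.
  specialize (K (RtoC e)). rewrite Cmod_R, Rabs_right, Cplus_0_l, line_0 in K by lra.
  specialize (K ltac:(lra)).
  pose proof (G2 p Hp). pose proof (G2 _ (Hline e ltac:(lra))).
  replace (f (line p v (RtoC e)) - f p)%C with
    ((f (line p v (RtoC e)) - g (line p v (RtoC e))) + (g (line p v (RtoC e)) - g p) - (f p - g p))%C by ring.
  eapply Rle_trans. apply Cmod_triangle_minus. 
  pose proof (Cmod_triangle (f (line p v (RtoC e)) - g (line p v (RtoC e))) (g (line p v (RtoC e)) - g p)). lra.
Qed.

Lemma holomorphic_line_lim {U : NormedModule C_AbsRing} (F : U -> C) (p v : U) :
  holomorphic_at F p ->
  exists d, 0 < d /\ (forall e, 0 < e < d -> holomorphic_at F (line p v (RtoC e))) /\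
  forall eps, 0 < eps -> exists d', 0 < d' /\ forall e, 0 < e < d' -> Cmod (F (line p v (RtoC e)) - F p) <= eps.
Proof.
  intros H.
  assert (A : forall r, 0 < r -> exists d, 0 < d /\ forall e, 0 < e < d -> ndist p (line p v (RtoC e)) < r).
  { intros r Hr. pose proof (norm_ge_0 v). exists (r / (norm v + 1)). split.
    apply Rdiv_lt_0_compat; lra.
    intros e [He1 He2]. eapply Rle_lt_trans. apply ndist_line. rewrite Cmod_R, Rabs_right by lra.
    apply (Rmult_lt_compat_r (norm v + 1)) in He2; [|lra].
    replace (r / (norm v + 1) * (norm v + 1)) with r in He2 by (field; lra). nra. }
  assert (HL : locally p (fun q => holomorphic_at F q)) by (apply (locally_locally p _ H)).
  destruct (locally_ndist p _ HL) as [r [Hr K]]. destruct (A r Hr) as [d [Hd D]].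
  exists d. split; auto. split. intros e He. apply K. auto.
  intros eps He. destruct (ex_filterdiff_cont F p (holomorphic_at_diff F p H) eps He) as [r2 [Hr2 K2]].
  destruct (A r2 Hr2) as [d2 [Hd2 D2]]. exists d2. split; auto.
  intros e Hde. left. apply K2. auto.
Qed.

(** The difference vanishes on a ball close to [q] and the vanishing spreads to [q] itself, where
    [F] now has its true value. *)
Lemma agree_holomorphic_eq {U : NormedModule C_AbsRing} (F G : U -> C) (q : U) :
  holomorphic_at F q -> lhol_at G q -> agree_close F G q -> F q = G q.
Proof.
  intros HF [r1 [Hr1 L1]] HA. destruct (holomorphic_lhol_at F q HF) as [r2 [Hr2 L2]].
  set (r := Rmin r1 r2 / 5). assert (Hm : 0 < Rmin r1 r2) by (apply Rmin_pos; auto).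
  assert (Hr : 0 < r) by (unfold r; lra).
  Rmin_bounds.
  assert (E5 : 5 * r = Rmin r1 r2) by (unfold r; field).
  set (f := fun q' => (F q' - G q')%C).
  assert (Lf : lhol (fun q' => ndist q q' < 5 * r) f).
  { intros eps He. destruct (L1 (eps / 2)) as [g1 [A1 B1]]. lra.
    destruct (L2 (eps / 2)) as [g2 [A2 B2]]. lra.
    exists (fun q' => (g2 q' - g1 q')%C). split.
    - intros q' Hq' v. apply cdiff_minus. apply A2; lra. apply A1; lra.
    - intros q' Hq'. unfold f.
      replace (F q' - G q' - (g2 q' - g1 q'))%C with ((F q' - g2 q') - (G q' - g1 q'))%C by ring.
      eapply Rle_trans. apply Cmod_triangle_minus. pose proof (A1 q' ltac:(lra)).
      pose proof (B1 q' ltac:(lra)). pose proof (B2 q' ltac:(lra)). lra. }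
  destruct (HA r Hr) as [q' [d [Hd [Hq' K]]]].
  assert (Z : f q = 0).
  { apply (vanish_spread f q q' q r Lf Hq'). exists d. split; auto. intros q2 H2. unfold f.
    rewrite K by auto. ring.
    rewrite ndist_refl. exact Hr. }
  unfold f in Z. replace (F q) with (F q - G q + G q)%C by ring. rewrite Z. ring.
Qed.

Lemma cdiff_negbinom (i : nat) (f : C -> C) (z : C) : cdiff f z -> cdiff (fun w => negbinom i (f w)) z.
Proof.
  revert f. induction i; intros f Hf.
  - exact (cdiff_const 1 z).
  - apply cdiff_ext with (fun w => - f w * RtoC (/ INR (S i)) * negbinom i (f w + 1))%C.
    intros; reflexivity.
    apply cdiff_mult. apply cdiff_mult. apply cdiff_opp; auto. apply cdiff_const.
    apply (IHi (fun w => f w + 1)%C). apply cdiff_plus; auto. apply cdiff_const.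
Qed.

Lemma csum_mask (K i0 : nat) (f : nat -> C) : (i0 < K)%nat ->
  csum K f = (csum K (fun i => if Nat.eqb i i0 then 0 else f i) + f i0)%C.
Proof.
  induction K; intros H. lia. rewrite !csum_S.
  destruct (Nat.eqb_spec K i0) as [->|N].
  - assert (E : csum i0 (fun i => if Nat.eqb i i0 then 0 else f i) = csum i0 f).
    { apply csum_ext. intros i Hi. destruct (Nat.eqb_spec i i0); auto. lia. }
    rewrite E. ring.
  - rewrite IHK by lia. ring.
Qed.

(** * Zeta away from its pole and its growth at 1 *)

Section Zeta.
Variable zeta : C -> C.
Hypothesis Hzeta : is_riemann_zeta zeta.

Lemma zeta_cdiff (w : C) : w <> 1 -> cdiff zeta w.
Proof.
  intros Hw. destruct Hzeta as [H1 _].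
  destruct (ex_filterdiff_line zeta w (RtoC 1) (holomorphic_at_diff zeta w (H1 w Hw))) as [l Hl].
  exists l. intros eps He. destruct (Hl eps He) as [d [Hd K]]. exists d. split; auto.
  intros u Hu. specialize (K u Hu).
  change (Cmod (zeta (w + (0 + u) * 1) - zeta (w + 0 * 1) - l * u)%C <= eps * Cmod u) in K.
  replace (w + (0 + u) * 1)%C with (w + u)%C in K by ring.
  replace (w + 0 * 1)%C with w in K by ring. exact K.
Qed.

Lemma zeta_series (z : C) : 1 < Re z -> is_Cseries (fun k => cpow (INR (S k)) (- z)) (zeta z).
Proof.
  intros Hz. destruct Hzeta as [_ H2]. apply (is_Cseries_ext (fun k => Cinv (cpow (INR (S k)) z))).
  intros n. symmetry. apply cpow_opp. apply H2. exact Hz.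
Qed.

Lemma zeta_real_ge (sg : R) (N : nat) : 1 < sg -> sum_n (fun k => Rpower (INR (S k)) (- sg)) N <= Cmod (zeta (RtoC sg)).
Proof.
  intros Hs.
  assert (E : zeta (RtoC sg) = RtoC (Series (fun k => Rpower (INR (S k)) (- sg)))).
  { apply (is_Cseries_unique (fun k => cpow (INR (S k)) (- RtoC sg))). apply zeta_series. exact Hs.
    apply (is_Cseries_ext (fun k => RtoC (Rpower (INR (S k)) (- sg)))). 2: apply is_Cseries_RtoC, ex_series_Rpower; auto.
    intros n. unfold cpow, Rpower. simpl. rewrite Ropp_0, Rmult_0_l, cos_0, sin_0.
    apply injective_projections; simpl; ring. }
  rewrite E, Cmod_R. eapply Rle_trans; [|apply Rle_abs].
  apply (sum_n_le_Series (fun k => Rpower (INR (S k)) (- sg))). intros; left; apply exp_pos.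
  apply ex_series_Rpower; auto.
Qed.

Lemma harmonic_unbounded (M : R) : exists N, M < sum_n (fun k => / INR (S k)) N.
Proof.
  destruct (nfloor_ex (exp (Rabs M))) as [N [_ HN]]. left; apply exp_pos.
  exists N. eapply Rlt_le_trans; [|apply ln_le_harmonic].
  apply Rle_lt_trans with (Rabs M). apply Rle_abs. rewrite <- (ln_exp (Rabs M)).
  apply ln_increasing. apply exp_pos. rewrite !S_INR. lra.
Qed.

(** The specification of [zeta] says nothing about the kind of singularity at 1, but the series
    forces the growth: for [e < 1 / (2 * (N + 1))] each of its first [N + 1] terms is at least half
    of the harmonic one, since [e * ln n] stays below [1 / 2]. *)
Lemma zeta_unbounded (M : R) : exists d, 0 < d /\ forall e, 0 < e < d -> M < Cmod (zeta (RtoC (1 + e))).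
Proof.
  destruct (harmonic_unbounded (2 * M)) as [N HN].
  exists (/ (2 * INR (S N))). split. apply Rinv_0_lt_compat. pose proof (INR_S_pos N). lra.
  intros e [He1 He2]. eapply Rlt_le_trans; [|apply (zeta_real_ge (1 + e) N); lra].
  assert (G : forall n, (n <= N)%nat -> sum_n (fun k => / INR (S k)) n / 2 <= sum_n (fun k => Rpower (INR (S k)) (- (1 + e))) n).
  { assert (St : forall n, (n <= N)%nat -> / INR (S n) / 2 <= Rpower (INR (S n)) (- (1 + e))).
    { intros n Hn. pose proof (INR_S_pos n) as Pn.
      unfold Rpower. replace (- (1 + e) * ln (INR (S n))) with (- ln (INR (S n)) + - (e * ln (INR (S n)))) by ring.
      rewrite exp_plus, (exp_Ropp (ln (INR (S n)))), exp_ln by auto.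
      apply Rmult_le_compat_l. left; apply Rinv_0_lt_compat; auto.
      eapply Rle_trans; [|apply exp_ineq1_le].
      assert (ln (INR (S n)) <= INR (S N)).
      { eapply Rle_trans. apply ln_le_sub_1; auto.
        assert (INR (S n) <= INR (S N)) by (apply le_INR; lia). lra. }
      assert (e * ln (INR (S n)) <= e * INR (S N)) by (apply Rmult_le_compat_l; lra).
      pose proof (INR_S_pos N).
      apply (Rmult_lt_compat_r (2 * INR (S N))) in He2; [|lra]. rewrite Rinv_l in He2 by lra. lra. }
    induction n; intros Hn. rewrite !sum_O. apply St; auto.
    rewrite !sum_Sn_R. specialize (St (S n) Hn). specialize (IHn ltac:(lia)). lra. }
  specialize (G N (Nat.le_refl N)). lra.
Qed.

(** * The candidate for the continuation and its approximants *)

Variable x : R.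
Hypothesis Hx : 0 < x.

(** [mask] switches off terms that have a pole at the point under consideration. *)
Definition polar_sum (mask : nat -> bool) (K : nat) (p : C * C * C) : C :=
  let '(r, s, t) := p in
  csum K (fun i => if mask i then 0 else
    negbinom i t * cpow x (- t - RtoC (INR i)) * zeta (s + t + RtoC (INR i)) * zeta (r - RtoC (INR i)))%C.

Definition theta_ext (mask : nat -> bool) (K : nat) (p : C * C * C) : C :=
  (polar_sum mask K p +
   let '(r, s, t) := p in CSeries (fun n => CSeries (fun m => eterm K x r s t (S n) (S m))))%C.

Definition theta_approx (mask : nat -> bool) (K N : nat) (p : C * C * C) : C :=
  (polar_sum mask K p +
   let '(r, s, t) := p in csum (S N) (fun n => csum (S N) (fun m => eterm K x r s t (S n) (S m))))%C.

(** The conditions of [eterm_bound] as closed inequalities, so that points with [t = 0] belong to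
    it. *)
Definition ext_dom (K : nat) (a b th T : R) (p : C * C * C) : Prop :=
  let '(r, s, t) := p in
  0 <= Re t /\ Cmod t <= T /\ a + INR K - th <= Re r /\ b - INR K + th <= Re s + Re t.

Definition no_pole (mask : nat -> bool) (K : nat) (p : C * C * C) : Prop :=
  let '(r, s, t) := p in
  forall i, (i < K)%nat -> mask i = true \/ (s + t + RtoC (INR i))%C <> 1.

Lemma eterm_iter (K : nat) (a b th T : R) (r s t : C) :
  1 < a -> 1 < b -> 0 <= th <= 1 -> ext_dom (S K) a b th T (r, s, t) ->
  is_iter (fun n m => eterm (S K) x r s t (S n) (S m))
    (CSeries (fun n => CSeries (fun m => eterm (S K) x r s t (S n) (S m)))).
Proof.
  intros Ha Hb Hth [D1 [D2 [D3 D4]]].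
  destruct (iter_square_tail (fun n => interp_const K T * exp ((T + INR (S K)) * Rabs (ln x)) * Rpower (INR (S n)) (- a))
    (fun m => Rpower (INR (S m)) (- b))) with (u := fun n m => eterm (S K) x r s t (S n) (S m)) as [L [HL _]].
  apply ex_series_scal_R, ex_series_Rpower; auto. apply ex_series_Rpower; auto.
  intros n m. apply (eterm_bound K x a b th T); auto.
  rewrite (is_iter_CSeries _ _ HL). exact HL.
Qed.

Lemma theta_approx_err (mask : nat -> bool) (K : nat) (a b th T : R) :
  1 < a -> 1 < b -> 0 <= th <= 1 ->
  forall eps, 0 < eps -> exists N, forall p, ext_dom (S K) a b th T p ->
    Cmod (theta_ext mask (S K) p - theta_approx mask (S K) N p) <= eps.
Proof.
  intros Ha Hb Hth eps He.
  set (al := fun n => interp_const K T * exp ((T + INR (S K)) * Rabs (ln x)) * Rpower (INR (S n)) (- a)).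
  set (be := fun m => Rpower (INR (S m)) (- b)).
  assert (Xal : ex_series al) by (apply ex_series_scal_R, ex_series_Rpower; auto).
  assert (Xbe : ex_series be) by (apply ex_series_Rpower; auto).
  destruct (square_tail_lim al be Xal Xbe eps He) as [N HN]. exists N.
  intros [[r s] t] [D1 [D2 [D3 D4]]].
  destruct (iter_square_tail al be Xal Xbe (fun n m => eterm (S K) x r s t (S n) (S m))) as [L [HL TL]].
  { intros n m. apply (eterm_bound K x a b th T); auto. }
  unfold theta_ext, theta_approx. rewrite (is_iter_CSeries _ _ HL). specialize (TL N).
  match goal with |- Cmod ?X <= _ => replace X with (L - csum (S N) (fun n => csum (S N) (fun m => eterm (S K) x r s t (S n) (S m))))%C by ring end.
  lra.
Qed.

Lemma cdiff_polar_sum (mask : nat -> bool) (K : nat) (r s t v1 v2 v3 : C) :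
  INR K < Re r -> no_pole mask K (r, s, t) ->
  cdiff (fun z => polar_sum mask K ((r + z * v1, s + z * v2), t + z * v3)%C) 0.
Proof.
  intros Hr Hnp. unfold polar_sum.
  apply (cdiff_csum K (fun i z => if mask i then 0 else
    negbinom i (t + z * v3) * cpow x (- (t + z * v3) - RtoC (INR i)) * zeta (s + z * v2 + (t + z * v3) + RtoC (INR i)) * zeta (r + z * v1 - RtoC (INR i)))%C).
  intros i Hi. specialize (Hnp i Hi). destruct (mask i). exact (cdiff_const 0 0).
  destruct Hnp as [Hnp|Hnp]. discriminate.
  assert (At : forall c v, cdiff (fun z => c + z * v)%C 0) by (intros; apply cdiff_affine).
  repeat apply cdiff_mult.
  - apply (cdiff_negbinom i (fun z => t + z * v3)%C). apply At.
  - apply cdiff_cpow. apply cdiff_minus. apply cdiff_opp. apply At. apply cdiff_const.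
  - apply (cdiff_comp zeta (fun z => s + z * v2 + (t + z * v3) + RtoC (INR i))%C).
    apply cdiff_plus. apply cdiff_plus; apply At. apply cdiff_const.
    apply zeta_cdiff. rewrite !Cmult_0_l, !Cplus_0_r. exact Hnp.
  - apply (cdiff_comp zeta (fun z => r + z * v1 - RtoC (INR i))%C).
    apply cdiff_minus. apply At. apply cdiff_const.
    (* The factors [zeta (r - i)] never meet the pole: [i <= K - 1] and [Re r > K] give
       [Re (r - i) > 1]. *)
    apply zeta_cdiff. rewrite Cmult_0_l, Cplus_0_r. intros E. apply (f_equal Re) in E.
    change (Re r - INR i = 1) in E. assert (INR i <= INR K - 1).
    { assert (Q : INR (S i) <= INR K) by (apply le_INR; lia). rewrite S_INR in Q. lra. }
    lra.
Qed.

Lemma cdiff_eterm (K : nat) (r s t v1 v2 v3 : C) (n m : nat) :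
  cdiff (fun z => eterm K x (r + z * v1) (s + z * v2) (t + z * v3) n m)%C 0.
Proof.
  assert (At : forall c v, cdiff (fun z => c + z * v)%C 0) by (intros; apply cdiff_affine).
  unfold eterm. apply cdiff_mult. apply cdiff_mult; apply cdiff_cpow; apply cdiff_opp; apply At.
  apply cdiff_minus. apply cdiff_cpow, cdiff_opp, At.
  apply (cdiff_csum K (fun i z => negbinom i (t + z * v3) * RtoC (INR n ^ i) * cpow (INR m * x) (- (t + z * v3) - RtoC (INR i)))%C).
  intros i _. apply cdiff_mult. apply cdiff_mult. apply (cdiff_negbinom i (fun z => t + z * v3)%C).
  apply At. apply cdiff_const.
  apply cdiff_cpow. apply cdiff_minus. apply cdiff_opp. apply At. apply cdiff_const.
Qed.

Lemma theta_ext_lhol (mask : nat -> bool) (K : nat) (a b th T : R) :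
  1 < a -> 1 < b -> 0 <= th <= 1 ->
  lhol (U := C3) (fun p => ext_dom (S K) a b th T p /\ no_pole mask (S K) p) (theta_ext mask (S K)).
Proof.
  intros Ha Hb Hth eps He.
  destruct (theta_approx_err mask K a b th T Ha Hb Hth eps He) as [N HN].
  exists (theta_approx mask (S K) N). split.
  2:{ intros q [Hq _]. apply HN. exact Hq. }
  intros [[r s] t] [[D1 [D2 [D3 D4]]] Hnp] [[v1 v2] v3].
  change (cdiff (fun z => theta_approx mask (S K) N ((r + z * v1, s + z * v2), t + z * v3)%C) 0).
  unfold theta_approx. apply cdiff_plus.
  - apply cdiff_polar_sum; auto. lra.
  - apply (cdiff_csum (S N) (fun n z => csum (S N) (fun m => eterm (S K) x (r + z * v1) (s + z * v2) (t + z * v3) (S n) (S m)))%C).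
    intros n _. apply (cdiff_csum (S N) (fun m z => eterm (S K) x (r + z * v1) (s + z * v2) (t + z * v3) (S n) (S m))%C).
    intros m _. apply cdiff_eterm.
Qed.

(** * Agreement of [Theta] with the candidate *)

Variable Theta : C * C * C -> C.
Hypothesis HTheta : is_mordell_tornheim x Theta.

Definition no_mask (i : nat) : bool := false.

Lemma Theta_iter (r s t : C) :
  1 < Re (r + t)%C -> 1 < Re (s + t)%C -> 2 < Re (r + s + t)%C ->
  is_iter (fun n m => eterm 0 x r s t (S n) (S m)) (Theta (r, s, t)).
Proof.
  intros H1 H2 H3. destruct HTheta as [_ H]. destruct (H r s t H1 H2 H3) as [c [C1 C2]].
  apply (is_iter_ext (fun n m => MT_term x r s t (S n) (S m))).
  - intros n m. unfold MT_term, eterm. rewrite csum_0, !cpow_opp.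
    field. repeat split; apply cpow_neq_0.
  - exists c. auto.
Qed.

Lemma Theta_eq_ext (K : nat) (a b th T : R) (r s t : C) :
  1 < a -> 1 < b -> 0 <= th <= 1 -> ext_dom (S K) a b th T (r, s, t) -> 1 < Re s + Re t ->
  Theta (r, s, t) = theta_ext no_mask (S K) (r, s, t).
Proof.
  intros Ha Hb Hth HD Hst. assert (HD' := HD). destruct HD' as [D1 [D2 [D3 D4]]].
  pose proof (INR_S_ge_1 K) as QK.
  apply (is_iter_unique (fun n m => eterm 0 x r s t (S n) (S m))).
  - apply Theta_iter; destruct r, s, t; simpl in *; lra.
  - unfold theta_ext, polar_sum, no_mask.
    (* Each subtracted term separates into a power of [n] and a power of [m]; with [Re s + Re t > 1]
       all the zeta factors are given by their series, so the terms can be added back as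
       products. *)
    apply (is_iter_ext (fun n m => csum (S K) (fun i => negbinom i t * cpow x (- t - RtoC (INR i)) * (cpow (INR (S n)) (- (r - RtoC (INR i))) * cpow (INR (S m)) (- (s + t + RtoC (INR i)))))
       + eterm (S K) x r s t (S n) (S m))%C).
    + intros n m. pose proof (INR_S_pos n) as Pn. pose proof (INR_S_pos m) as Pm.
      unfold eterm. rewrite csum_0.
      assert (E : csum (S K) (fun i => negbinom i t * cpow x (- t - RtoC (INR i)) * (cpow (INR (S n)) (- (r - RtoC (INR i))) * cpow (INR (S m)) (- (s + t + RtoC (INR i)))))%C
       = (cpow (INR (S n)) (- r) * cpow (INR (S m)) (- s) * csum (S K) (fun i => negbinom i t * RtoC (INR (S n) ^ i) * cpow (INR (S m) * x) (- t - RtoC (INR i))))%C).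
      { rewrite csum_mult_l. apply csum_ext. intros i _.
        rewrite cpow_base_mult by auto.
        replace (- (r - RtoC (INR i)))%C with (- r + RtoC (INR i))%C by ring.
        replace (- (s + t + RtoC (INR i)))%C with (- s + (- t - RtoC (INR i)))%C by ring.
        rewrite (cpow_plus (INR (S n))), (cpow_plus (INR (S m)) (- s)), cpow_INR by auto. ring. }
      rewrite E. ring.
    + apply is_iter_plus; [|apply (eterm_iter K a b th T); auto].
      apply (is_iter_csum (S K) (fun i n m => negbinom i t * cpow x (- t - RtoC (INR i)) * (cpow (INR (S n)) (- (r - RtoC (INR i))) * cpow (INR (S m)) (- (s + t + RtoC (INR i)))))%C).
      intros i Hi. rewrite <- Cmult_assoc. apply is_iter_mult_l.
      assert (Q : INR (S i) <= INR (S K)) by (apply le_INR; lia). rewrite S_INR in Q.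
      pose proof (pos_INR i).
      rewrite (Cmult_comm (zeta _)).
      apply is_iter_prod; apply zeta_series; destruct r, s, t; simpl in *; lra.
Qed.

(** An open convex region that avoids the poles of [zeta (s + t + i)]. *)
Definition ext_region (K : nat) (a b th T sg : R) (p : C * C * C) : Prop :=
  let '(r, s, t) := p in
  (0 < Re t < T /\ - T < Im t < T) /\ a + INR K - th < Re r /\ b - INR K + th < Re s + Re t /\
  0 < sg * (Im s + Im t).

(** The region bounds real and imaginary parts of [t] by [T], hence [Cmod t] by [2 * T]. A pole
    would make [s + t] real, which the sign condition excludes. *)
Lemma ext_region_dom (K : nat) (a b th T sg : R) (p : C * C * C) :
  ext_region K a b th T sg p -> ext_dom K a b th (2 * T) p /\ no_pole no_mask K p.
Proof.
  destruct p as [[r s] t]. intros [[[A1 A2] [A3 A4]] [A5 [A6 A7]]]. split.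
  - repeat split; try lra. eapply Rle_trans. apply Cmod_le_sum. rewrite (Rabs_right (Re t)) by lra.
    assert (Rabs (Im t) <= T) by (apply Rabs_le_between; lra). lra.
  - intros i _. right. intros E. apply (f_equal Im) in E.
    change (Im s + Im t + 0 = 0) in E. replace (Im s + Im t) with 0 in A7 by lra. lra.
Qed.

Lemma ext_region_open (K : nat) (a b th T sg : R) (p : C3) : Rabs sg <= 1 ->
  ext_region K a b th T sg p -> locally p (ext_region K a b th T sg).
Proof.
  intros Hsg. destruct p as [[r s] t]. intros [[[A1 A2] [A3 A4]] [A5 [A6 A7]]].
  set (e := Rmin (Rmin (Rmin (Re t) (T - Re t)) (Rmin (Im t + T) (T - Im t)))
     (Rmin (Rmin (Re r - (a + INR K - th)) ((Re s + Re t - (b - INR K + th)) / 2)) (sg * (Im s + Im t) / 2))).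
  assert (He : 0 < e) by (unfold e; repeat apply Rmin_pos; lra).
  assert (B : e <= Re t /\ e <= T - Re t /\ e <= Im t + T /\ e <= T - Im t /\ e <= Re r - (a + INR K - th)
     /\ e <= (Re s + Re t - (b - INR K + th)) / 2 /\ e <= sg * (Im s + Im t) / 2).
  { unfold e.
    set (u1 := Re t). set (u2 := T - u1). set (u3 := Im t + T). set (u4 := T - Im t).
    set (u5 := Re r - (a + INR K - th)). set (u6 := (Re s + u1 - (b - INR K + th)) / 2).
    set (u7 := sg * (Im s + Im t) / 2).
    Rmin_bounds. repeat split; lra. }
  exists (mkposreal e He). intros [[r' s'] t'] [[[R1 R2] [S1 S2]] [T1 T2]].
  change (Rabs (Re r' - Re r) < e) in R1. change (Rabs (Re s' - Re s) < e) in S1.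
  change (Rabs (Im s' - Im s) < e) in S2. change (Rabs (Re t' - Re t) < e) in T1.
  change (Rabs (Im t' - Im t) < e) in T2.
  apply Rabs_lt_between in R1. apply Rabs_lt_between in S1. apply Rabs_lt_between in T1.
  assert (Hsd : Rabs (sg * ((Im s' - Im s) + (Im t' - Im t))) < 2 * e).
  { rewrite Rabs_mult. apply Rle_lt_trans with (1 * Rabs ((Im s' - Im s) + (Im t' - Im t))).
    apply Rmult_le_compat_r; auto. apply Rabs_pos.
    pose proof (Rabs_triang (Im s' - Im s) (Im t' - Im t)). lra. }
  apply Rabs_lt_between in Hsd. apply Rabs_lt_between in T2.
  repeat split; try lra.
Qed.

Lemma convex_lt (c u v T : R) : c < u -> c < v -> 0 <= T <= 1 -> c < u + T * (v - u).
Proof.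
  intros. destruct (Rle_dec u v). assert (0 <= T * (v - u)) by (apply Rmult_le_pos; lra). lra.
  assert (T * (u - v) <= 1 * (u - v)) by (apply Rmult_le_compat_r; lra). lra.
Qed.

Lemma ext_region_convex (K : nat) (a b th T sg : R) (p q : C3) :
  ext_region K a b th T sg p -> ext_region K a b th T sg q ->
  forall u, 0 <= u <= 1 -> ext_region K a b th T sg (seg p q u).
Proof.
  destruct p as [[r s] t], q as [[r' s'] t'].
  intros [[[A1 A2] [A3 A4]] [A5 [A6 A7]]] [[[B1 B2] [B3 B4]] [B5 [B6 B7]]] u Hu.
  change (ext_region K a b th T sg ((r + RtoC u * (r' - r), s + RtoC u * (s' - s)), t + RtoC u * (t' - t))%C).
  assert (ER : forall y z : C, Re (y + RtoC u * (z - y))%C = Re y + u * (Re z - Re y)) by (intros; destruct y, z; simpl; ring).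
  assert (EI : forall y z : C, Im (y + RtoC u * (z - y))%C = Im y + u * (Im z - Im y)) by (intros; destruct y, z; simpl; ring).
  unfold ext_region. rewrite !ER, !EI.
  pose proof (convex_lt _ _ _ u A1 B1 Hu). pose proof (convex_lt _ _ _ u A3 B3 Hu).
  pose proof (convex_lt (- T) (- Re t) (- Re t') u ltac:(lra) ltac:(lra) Hu).
  pose proof (convex_lt (- T) (- Im t) (- Im t') u ltac:(lra) ltac:(lra) Hu).
  pose proof (convex_lt _ _ _ u A5 B5 Hu). pose proof (convex_lt _ _ _ u A6 B6 Hu).
  pose proof (convex_lt _ _ _ u A7 B7 Hu).
  repeat split; lra.
Qed.

Lemma theta_ext_lhol_at (K : nat) (a b th T sg : R) (q : C3) :
  1 < a -> 1 < b -> 0 <= th <= 1 -> Rabs sg <= 1 ->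
  ext_region (S K) a b th T sg q -> lhol_at (theta_ext no_mask (S K)) q.
Proof.
  intros Ha Hb Hth Hsg Hq.
  destruct (locally_ndist q _ (ext_region_open _ _ _ _ _ _ q Hsg Hq)) as [r [Hr Hb']].
  exists r. split; auto.
  eapply lhol_subset; [|apply (theta_ext_lhol no_mask K a b th (2 * T)); auto].
  intros q' Hq'. apply (ext_region_dom (S K) a b th T sg). apply Hb'. exact Hq'.
Qed.

Lemma Theta_continuation (K : nat) (a b th T sg : R) (q : C3) :
  1 < a -> 1 < b -> 0 <= th <= 1 -> Rabs sg <= 1 ->
  ext_region (S K) a b th T sg q -> agree_close Theta (theta_ext no_mask (S K)) q.
Proof.
  intros Ha Hb Hth Hsg Hq.
  destruct q as [[r s] t]. assert (Hq' := Hq). destruct Hq' as [A0 [A5 [A6 A7]]].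
  (* A real shift of [s] into the region of convergence leaves [Im (s + t)] unchanged, hence on the
     side given by [sg]. Reaching real part 2 rather than 1 leaves room for a neighbourhood. *)
  set (R0 := Rmax 0 (2 - Re s - Re t)).
  assert (HR1 : 0 <= R0) by apply Rmax_l. assert (HR2 : 2 - Re s - Re t <= R0) by apply Rmax_r.
  set (p := ((r, (s + RtoC R0)%C), t) : C3).
  assert (ERe : Re (s + RtoC R0)%C = Re s + R0) by reflexivity.
  assert (EIm : Im (s + RtoC R0)%C = Im s) by (simpl; apply Rplus_0_r).
  assert (Hp : ext_region (S K) a b th T sg p).
  { unfold p, ext_region. rewrite ERe, EIm. repeat split; lra. }
  apply (meromorphic_continuation C3_ball_convex Theta (theta_ext no_mask (S K)) (ext_region (S K) a b th T sg) p).
  - exact (proj1 HTheta).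
  - apply ext_region_convex; auto.
  - intros q' Hq'. apply (theta_ext_lhol_at K a b th T sg); auto.
  - intros rho Hrho.
    assert (Lp : locally p (fun q' : C3 => ext_region (S K) a b th T sg q')) by (apply ext_region_open; auto).
    assert (L2 : locally p (fun q' : C3 => 1 < Re (snd (fst q')) + Re (snd q'))).
    { assert (H4 : 0 < / 4) by lra. exists (mkposreal _ H4).
      intros [[r' s'] t'] [[_ [S1 _]] [T1 _]].
      change (Rabs (Re s' - Re (s + RtoC R0)%C) < / 4) in S1.
      change (Rabs (Re t' - Re t) < / 4) in T1.
      rewrite ERe in S1. apply Rabs_lt_between in S1. apply Rabs_lt_between in T1.
      simpl fst; simpl snd. lra. }
    destruct (locally_ndist p _ (filter_and _ _ Lp L2)) as [d [Hd K1]].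
    exists p, d. split; auto. split. rewrite ndist_refl; auto.
    intros q' Hq'. destruct (K1 q' Hq') as [K2 K3]. destruct q' as [[r' s'] t'].
    apply (Theta_eq_ext K a b th (2 * T)); auto. apply (ext_region_dom _ _ _ _ _ _ _ K2).
Qed.

Lemma Theta_eq_regular (K : nat) (a b th T : R) (r s t : C) :
  1 < a -> 1 < b -> 0 <= th <= 1 ->
  Im r = 0 -> Im t = 0 -> 0 <= Re t < T -> a + INR (S K) - th < Re r -> b - INR (S K) + th < Re s + Re t ->
  holomorphic_at Theta (r, s, t) -> no_pole no_mask (S K) (r, s, t) ->
  Theta (r, s, t) = theta_ext no_mask (S K) (r, s, t).
Proof.
  intros Ha Hb Hth Ir It Ht Hr Hs Hol Hnp.
  (* The point need not lie in the open region: [Im s] and [Re t] may be 0. Along [v], [Re t]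
     becomes positive and [Im s] moves away from 0 on its own side, so every nearby point of the ray
     lies in the region. *)
  set (sg := if Rle_dec 0 (Im s) then 1 else -1).
  assert (Hsg : Rabs sg <= 1 /\ 0 <= sg * Im s /\ sg * sg = 1).
  { unfold sg. destruct (Rle_dec 0 (Im s)). rewrite Rabs_R1. lra.
    rewrite Rabs_left by lra. lra. }
  destruct Hsg as [Sg1 [Sg2 Sg3]].
  set (p := ((r, s), t) : C3).
  set (v := ((RtoC 0, (RtoC sg * Ci)%C), RtoC 1) : C3).
  assert (Hreg : forall e, 0 < e < T - Re t -> ext_region (S K) a b th T sg (line p v (RtoC e))).
  { intros e He. change (ext_region (S K) a b th T sg ((r + RtoC e * RtoC 0, s + RtoC e * (RtoC sg * Ci)), t + RtoC e * RtoC 1)%C).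
    unfold ext_region.
    replace (Re (r + RtoC e * RtoC 0)%C) with (Re r) by (destruct r; simpl; ring).
    replace (Re (s + RtoC e * (RtoC sg * Ci))%C) with (Re s) by (destruct s; simpl; ring).
    replace (Im (s + RtoC e * (RtoC sg * Ci))%C) with (Im s + e * sg) by (destruct s; simpl; ring).
    replace (Re (t + RtoC e * RtoC 1)%C) with (Re t + e) by (destruct t; simpl; ring).
    replace (Im (t + RtoC e * RtoC 1)%C) with (Im t) by (destruct t; simpl; ring).
    rewrite It. repeat split; try lra.
    replace (sg * (Im s + e * sg + 0)) with (sg * Im s + e * (sg * sg)) by ring. rewrite Sg3. lra. }
  destruct (holomorphic_line_lim Theta p v Hol) as [d [Hd [Hd1 Hd2]]].
  apply Ceq_eps. intros eps He.
  destruct (Hd2 (eps / 2)) as [d2 [Hd2' K2]]. lra.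
  assert (Sp : ext_dom (S K) a b th (2 * T) p /\ no_pole no_mask (S K) p).
  { split; auto. repeat split; try lra. eapply Rle_trans. apply Cmod_le_sum.
    rewrite It, Rabs_R0, Rabs_right; lra. }
  destruct (lhol_line_lim _ _ p v (T - Re t) (theta_ext_lhol no_mask K a b th (2 * T) Ha Hb Hth) Sp ltac:(lra)) with (eps := eps / 2)
    as [d3 [Hd3 K3]].
  { intros e Hde. apply (ext_region_dom _ _ _ _ _ sg). apply Hreg; auto. } { lra. }
  set (e := Rmin (Rmin d d2) (Rmin d3 (T - Re t)) / 2).
  assert (Hm : 0 < Rmin (Rmin d d2) (Rmin d3 (T - Re t))) by (repeat apply Rmin_pos; lra).
  Rmin_bounds.
  assert (He' : 0 < e) by (unfold e; lra).
  assert (He2 : e < Rmin (Rmin d d2) (Rmin d3 (T - Re t))) by (unfold e; lra).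
  specialize (K2 e ltac:(lra)). specialize (K3 e ltac:(lra)).
  assert (E : Theta (line p v (RtoC e)) = theta_ext no_mask (S K) (line p v (RtoC e))).
  { apply agree_holomorphic_eq. apply Hd1; lra.
    apply (theta_ext_lhol_at K a b th T sg); auto. apply Hreg; lra.
    apply (Theta_continuation K a b th T sg); auto. apply Hreg; lra. }
  change (Theta (r, s, t)) with (Theta p).
  change (theta_ext no_mask (S K) (r, s, t)) with (theta_ext no_mask (S K) p).
  rewrite E in K2.
  replace (Theta p - theta_ext no_mask (S K) p)%C with
    ((theta_ext no_mask (S K) (line p v (RtoC e)) - theta_ext no_mask (S K) p) - (theta_ext no_mask (S K) (line p v (RtoC e)) - Theta p))%C by ring.
  eapply Rle_trans. apply Cmod_triangle_minus. lra.
Qed.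

Lemma polar_sum_split (K i0 : nat) (r s t : C) : (i0 < K)%nat ->
  theta_ext no_mask K (r, s, t) =
  (theta_ext (fun i => Nat.eqb i i0) K (r, s, t)
   + negbinom i0 t * cpow x (- t - RtoC (INR i0)) * zeta (r - RtoC (INR i0)) * zeta (s + t + RtoC (INR i0)))%C.
Proof.
  intros H. unfold theta_ext, polar_sum, no_mask.
  rewrite (csum_mask K i0 (fun i => negbinom i t * cpow x (- t - RtoC (INR i)) * zeta (s + t + RtoC (INR i)) * zeta (r - RtoC (INR i)))%C H).
  ring.
Qed.

(** Only the term [i0] is singular, with coefficient [c]. Were [c] nonzero, [zeta (1 + e)] would
    make [Theta] unbounded along the ray, against its holomorphy; so [c = 0], and the unspecified
    value [zeta 1] is multiplied by 0. *)
Lemma Theta_eq_polar (K i0 : nat) (a b th T : R) (r s t : C) :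
  1 < a -> 1 < b -> 0 <= th <= 1 ->
  Im r = 0 -> Im t = 0 -> 0 <= Re t < T -> a + INR (S K) - th < Re r -> b - INR (S K) + th < Re s + Re t ->
  holomorphic_at Theta (r, s, t) -> (i0 < S K)%nat -> (s + t + RtoC (INR i0))%C = 1 ->
  Theta (r, s, t) = theta_ext no_mask (S K) (r, s, t).
Proof.
  intros Ha Hb Hth Ir It Ht Hr Hs Hol Hi0 Hpole.
  set (p := ((r, s), t) : C3).
  set (v := ((RtoC 0, RtoC 1), RtoC 0) : C3).
  set (mask := fun i => Nat.eqb i i0).
  assert (Lv : forall e, line p v (RtoC e) = ((r, s + RtoC e)%C, t)).
  { intros e. change (line p v (RtoC e)) with ((r + RtoC e * RtoC 0, s + RtoC e * RtoC 1), t + RtoC e * RtoC 0)%C.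
    do 2 f_equal; try f_equal; ring. }
  (* The poles in [s] differ by integers, so a shift by less than 1 to the right of one of them
     meets no other. *)
  assert (Far : forall e i, 0 < e < 1 -> (s + RtoC e + t + RtoC (INR i))%C <> 1).
  { intros e i He Q.
    assert (Q2 : RtoC (e + INR i) = RtoC (INR i0)).
    { rewrite RtoC_plus. replace (RtoC (INR i0)) with (1 - (s + t))%C by (rewrite <- Hpole; ring).
      rewrite <- Q. ring. }
    apply RtoC_inj in Q2. rewrite !INR_IZR_INZ in Q2.
    assert (E : e = IZR (Z.of_nat i0 - Z.of_nat i)) by (rewrite minus_IZR; lra).
    assert (0 < Z.of_nat i0 - Z.of_nat i < 1)%Z by (split; apply lt_IZR; simpl; lra). lia. }
  assert (Dp : ext_dom (S K) a b th T p).
  { repeat split; try lra. eapply Rle_trans. apply Cmod_le_sum.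
    rewrite It, Rabs_R0, Rabs_right; lra. }
  assert (De : forall e, 0 < e -> ext_dom (S K) a b th T (line p v (RtoC e))).
  { intros e He. rewrite Lv. destruct Dp as [D1 [D2 [D3 D4]]]. repeat split; auto.
    change (Re (s + RtoC e)%C) with (Re s + e). lra. }
  assert (Np : no_pole mask (S K) p).
  { intros i _. unfold mask. destruct (Nat.eqb_spec i i0) as [E|N]; auto. right. intros Q.
    assert (Q2 : RtoC (INR i) = RtoC (INR i0)).
    { replace (RtoC (INR i0)) with (1 - (s + t))%C by (rewrite <- Hpole; ring). rewrite <- Q.
      ring. }
    apply RtoC_inj, INR_eq in Q2. auto. }
  assert (Ne : forall m e, 0 < e < 1 -> no_pole m (S K) (line p v (RtoC e))).
  { intros m e He. rewrite Lv. intros i _. right. apply Far. auto. }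
  destruct (holomorphic_line_lim Theta p v Hol) as [d [Hd [Hd1 Hd2]]].
  assert (GL := lhol_line_lim _ _ p v 1 (theta_ext_lhol mask K a b th T Ha Hb Hth) (conj Dp Np) Rlt_0_1
    (fun e He => conj (De e (proj1 He)) (Ne mask e He))).
  set (c := (negbinom i0 t * cpow x (- t - RtoC (INR i0)) * zeta (r - RtoC (INR i0)))%C).
  assert (Eq : forall e, 0 < e < Rmin d 1 -> Theta (line p v (RtoC e)) =
     (theta_ext mask (S K) (line p v (RtoC e)) + c * zeta (RtoC (1 + e)))%C).
  { intros e He. Rmin_bounds.
    assert (Hol' := Hd1 e ltac:(lra)). assert (Dq := De e ltac:(lra)).
    assert (Nq := Ne no_mask e ltac:(lra)).
    rewrite Lv in *.
    rewrite (Theta_eq_regular K a b th T) by (auto; change (Re (s + RtoC e)%C) with (Re s + e); lra).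
    rewrite (polar_sum_split (S K) i0) by auto. fold mask. fold c. do 3 f_equal.
    transitivity (s + t + RtoC (INR i0) + RtoC e)%C. ring. rewrite Hpole, RtoC_plus. reflexivity. }
  assert (Gp : theta_ext no_mask (S K) p = (theta_ext mask (S K) p + c * zeta 1)%C).
  { unfold p. rewrite (polar_sum_split (S K) i0) by auto. fold mask. fold c. rewrite Hpole.
    reflexivity. }
  destruct (Ceq_dec c 0) as [Ec|Ec].
  - change (Theta p = theta_ext no_mask (S K) p). rewrite Gp, Ec, Cmult_0_l, Cplus_0_r.
    apply Ceq_eps. intros eps He.
    destruct (Hd2 (eps / 2)) as [d2 [Hd2' K2]]. lra. destruct (GL (eps / 2)) as [d3 [Hd3 K3]]. lra.
    set (e := Rmin (Rmin d 1) (Rmin d2 d3) / 2).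
    assert (Hm : 0 < Rmin (Rmin d 1) (Rmin d2 d3)) by (repeat apply Rmin_pos; lra).
    Rmin_bounds.
    assert (He' : 0 < e < Rmin (Rmin d 1) (Rmin d2 d3)) by (unfold e; lra).
    specialize (K2 e ltac:(lra)). specialize (K3 e ltac:(lra)). rewrite (Eq e) in K2 by lra.
    rewrite Ec, Cmult_0_l, Cplus_0_r in K2.
    replace (Theta p - theta_ext mask (S K) p)%C with
      ((theta_ext mask (S K) (line p v (RtoC e)) - theta_ext mask (S K) p) - (theta_ext mask (S K) (line p v (RtoC e)) - Theta p))%C by ring.
    eapply Rle_trans. apply Cmod_triangle_minus. lra.
  - exfalso. apply Cmod_gt_0 in Ec.
    destruct (Hd2 1 Rlt_0_1) as [d2 [Hd2' K2]]. destruct (GL 1 Rlt_0_1) as [d3 [Hd3 K3]].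
    set (M := Cmod (Theta p) + Cmod (theta_ext mask (S K) p) + 2).
    destruct (zeta_unbounded (M / Cmod c)) as [d4 [Hd4 K4]].
    set (e := Rmin (Rmin (Rmin d 1) d4) (Rmin d2 d3) / 2).
    assert (Hm : 0 < Rmin (Rmin (Rmin d 1) d4) (Rmin d2 d3)) by (repeat apply Rmin_pos; lra).
    Rmin_bounds.
    assert (He' : 0 < e < Rmin (Rmin (Rmin d 1) d4) (Rmin d2 d3)) by (unfold e; lra).
    specialize (K2 e ltac:(lra)). specialize (K3 e ltac:(lra)). specialize (K4 e ltac:(lra)).
    rewrite (Eq e) in K2 by lra.
    set (G1 := theta_ext mask (S K) (line p v (RtoC e))) in *. set (z := zeta (RtoC (1 + e))) in *.
    assert (B : Cmod (c * z) <= M).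
    { replace (c * z)%C with ((G1 + c * z - Theta p) + Theta p - ((G1 - theta_ext mask (S K) p) + theta_ext mask (S K) p))%C by ring.
      eapply Rle_trans. apply Cmod_triangle_minus.
      pose proof (Cmod_triangle (G1 + c * z - Theta p) (Theta p)).
      pose proof (Cmod_triangle (G1 - theta_ext mask (S K) p) (theta_ext mask (S K) p)). unfold M.
      lra. }
    rewrite Cmod_mult in B. apply (Rmult_lt_compat_l (Cmod c)) in K4; auto.
    replace (Cmod c * (M / Cmod c)) with M in K4 by (field; lra). lra.
Qed.

Lemma Theta_integer_ext (r t : nat) (s : C) :
  (2 <= r)%nat -> 2 - INR r - INR t < Re s ->
  holomorphic_at Theta (RtoC (INR r), s, RtoC (INR t)) ->
  Theta (RtoC (INR r), s, RtoC (INR t)) = theta_ext no_mask (r - 1) (RtoC (INR r), s, RtoC (INR t)).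
Proof.
  intros Hr Hs Hol.
  destruct r as [|[|K]]; try lia. replace (S (S K) - 1)%nat with (S K) by lia.
  (* [g] is the slack [Re (r + s + t) - 2]. With [r = K + 2], the choices [a = 1 + th / 2] and
     [b = 1 + th] leave [th / 2] to spare in the condition on [r] and need [2 * th < g] in the one
     on [s + t]. *)
  set (g := Re s + INR t + INR (S (S K)) - 2). assert (Hg : 0 < g) by (unfold g; lra).
  set (th := Rmin (/ 2) (g / 3)).
  assert (Hth : 0 < th <= / 2) by (split; [apply Rmin_pos; lra|apply Rmin_l]).
  assert (Hth2 : th <= g / 3) by apply Rmin_r.
  pose proof (S_INR (S K)) as ES. pose proof (pos_INR t).
  assert (R1 : 1 + th / 2 + INR (S K) - th < Re (RtoC (INR (S (S K))))) by (change (Re (RtoC (INR (S (S K))))) with (INR (S (S K))); lra).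
  assert (R2 : 1 + th - INR (S K) + th < Re s + Re (RtoC (INR t))) by (change (Re (RtoC (INR t))) with (INR t); unfold g in *; lra).
  assert (R3 : 0 <= Re (RtoC (INR t)) < INR t + 1) by (change (Re (RtoC (INR t))) with (INR t); lra).
  destruct (classic (exists i0, (i0 < S K)%nat /\ (s + RtoC (INR t) + RtoC (INR i0))%C = 1)) as [[i0 [Hi0 Hp]]|N].
  - apply (Theta_eq_polar K i0 (1 + th / 2) (1 + th) th (INR t + 1)); auto; lra.
  - apply (Theta_eq_regular K (1 + th / 2) (1 + th) th (INR t + 1)); auto; try lra.
    intros i Hi. right. intros Q. apply N. exists i. auto.
Qed.

(** On the polar divisor [r + t = 1] the function blows up like
    [zeta (1 + e) zeta s], so [zeta] would vanish near [s]. *)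
Lemma Theta_near_divisor (t : nat) (s : C) : (t <= 1)%nat -> 1 < Re s ->
  exists B, forall e, 0 < e < 1 ->
  Cmod (Theta (RtoC (INR (1 - t) + e), s, RtoC (INR t)) - zeta (RtoC (1 + e)) * zeta s) <= B.
Proof.
  intros Ht Hs.
  destruct (digamma_summand_bound x s Hx Hs) as [al [be [Xal [Xbe Bd]]]].
  exists (Series al * Series be). intros e He.
  (* [t] is 0 or 1. For [t = 0] the summand factors exactly and the correction [u] is 0; for [t = 1]
     the correction replaces [1 / n] by [1 / (n + m x)], a difference bounded uniformly in [e]. *)
  set (dlt := RtoC (INR t)).
  set (u := fun n m => (- dlt * cpow (INR (S n)) (- RtoC e) * (cpow (INR (S m)) (- s) * RtoC (/ INR (S n) - / (INR (S n) + INR (S m) * x))))%C).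
  assert (Hu : forall n m, Cmod (u n m) <= al n * be m).
  { intros n m. unfold u. rewrite 2!Cmod_mult, Cmod_opp, Cmod_cpow. unfold dlt. rewrite Cmod_R.
    replace (Re (- RtoC e)%C) with (- e) by reflexivity.
    assert (E1 : exp (- e * ln (INR (S n))) <= 1).
    { rewrite <- exp_0. apply exp_le_compat.
      assert (0 <= ln (INR (S n))) by (rewrite <- ln_1; apply ln_le; [lra|apply INR_S_ge_1]). nra. }
    assert (E2 : 0 <= Rabs (INR t) <= 1).
    { split. apply Rabs_pos. rewrite Rabs_right by (apply Rle_ge, pos_INR). apply (le_INR t 1).
      exact Ht. }
    pose proof (exp_pos (- e * ln (INR (S n)))). specialize (Bd n m).
    pose proof (Cmod_ge_0 (cpow (INR (S m)) (- s) * RtoC (/ INR (S n) - / (INR (S n) + INR (S m) * x)))).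
    assert (0 <= Rabs (INR t) * exp (- e * ln (INR (S n))) <= 1) by nra.
    eapply Rle_trans; [|exact Bd]. nra. }
  destruct (iter_square_tail al be Xal Xbe u Hu) as [L [IL TL]].
  assert (BL : Cmod L <= Series al * Series be).
  { specialize (TL 0%nat). unfold square_tail in TL. rewrite !sum_O in TL.
    rewrite !csum_S, !csum_0, !Cplus_0_l in TL.
    specialize (Hu 0%nat 0%nat). replace L with ((L - u 0%nat 0%nat) + u 0%nat 0%nat)%C by ring.
    eapply Rle_trans. apply Cmod_triangle. lra. }
  assert (IP : is_iter (fun n m => cpow (INR (S n)) (- RtoC (1 + e)) * cpow (INR (S m)) (- s))%C (zeta (RtoC (1 + e)) * zeta s)%C).
  { apply is_iter_prod; apply zeta_series; simpl; lra. }
  assert (IT : is_iter (fun n m => eterm 0 x (RtoC (INR (1 - t) + e)) s (RtoC (INR t)) (S n) (S m)) (Theta (RtoC (INR (1 - t) + e), s, RtoC (INR t)))).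
  { assert (Q : INR (1 - t) + INR t = 1) by (rewrite minus_INR by auto; simpl; ring).
    pose proof (pos_INR t).
    apply Theta_iter; destruct s; simpl in *; lra. }
  assert (EL : Theta (RtoC (INR (1 - t) + e), s, RtoC (INR t)) = (zeta (RtoC (1 + e)) * zeta s + L)%C).
  { eapply is_iter_unique. exact IT.
    eapply is_iter_ext; [|apply is_iter_plus; [exact IP|exact IL]].
    intros n m. unfold u, eterm. rewrite csum_0.
    pose proof (INR_S_pos n) as Pn. pose proof (INR_S_pos m) as Pm.
    assert (Hy : 0 < INR (S m) * x) by (apply Rmult_lt_0_compat; auto).
    assert (H1 : RtoC (INR (S n)) <> 0) by (intros Z; apply RtoC_inj in Z; lra).
    assert (H2 : RtoC (INR (S n) + INR (S m) * x) <> 0) by (intros Z; apply RtoC_inj in Z; lra).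
    replace (- RtoC (1 + e))%C with (- RtoC 1 + - RtoC e)%C by (rewrite RtoC_plus; ring).
    rewrite (cpow_plus (INR (S n)) (- RtoC 1)), (cpow_opp (INR (S n)) (RtoC 1)), cpow_1_r by auto.
    rewrite RtoC_minus, !RtoC_inv by lra.
    unfold dlt. destruct t as [|[|t]]; [| |lia].
    - change (INR (1 - 0)) with 1. change (INR 0) with 0.
      replace (- RtoC (1 + e))%C with (- RtoC 1 + - RtoC e)%C by (rewrite RtoC_plus; ring).
      rewrite (cpow_plus (INR (S n)) (- RtoC 1)), (cpow_opp (INR (S n)) (RtoC 1)), cpow_1_r by auto.
      rewrite (cpow_opp _ (RtoC 0)), cpow_0. field. repeat split; auto.
    - change (INR (1 - 1)) with 0. change (INR 1) with 1. rewrite Rplus_0_l.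
      rewrite (cpow_opp (INR (S n) + _) (RtoC 1)), cpow_1_r by lra.
      field. repeat split; auto. }
  unfold dlt. rewrite EL.
  replace (zeta (RtoC (1 + e)) * zeta s + L - zeta (RtoC (1 + e)) * zeta s)%C with L by ring.
  exact BL.
Qed.

Lemma Theta_not_holomorphic (t : nat) (s : C) : (t <= 1)%nat -> 1 < Re s ->
  ~ holomorphic_at Theta (RtoC (INR (1 - t)), s, RtoC (INR t)).
Proof.
  intros Ht Hs Hol.
  set (p := ((RtoC (INR (1 - t)), s), RtoC (INR t)) : C3).
  assert (HL : locally p (fun q : C3 => holomorphic_at Theta q)) by (apply (locally_locally p _ Hol)).
  destruct (locally_ndist p _ HL) as [d [Hd K]].
  set (v2 := ((RtoC 0, RtoC 1), RtoC 0) : C3).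
  (* Holomorphy keeps [Theta] bounded as [r] decreases to the divisor, while up to a bounded term it
     is [zeta (1 + e) * zeta s']. *)
  assert (Zero : forall s', 1 < Re s' -> ndist p (((RtoC (INR (1 - t)), s'), RtoC (INR t)) : C3) < d -> zeta s' = 0).
  { intros s' Hs' Hdist. specialize (K _ Hdist).
    destruct (Ceq_dec (zeta s') 0) as [E|E]; auto. exfalso. apply Cmod_gt_0 in E.
    set (q := ((RtoC (INR (1 - t)), s'), RtoC (INR t)) : C3) in *.
    set (v := ((RtoC 1, RtoC 0), RtoC 0) : C3).
    destruct (holomorphic_line_lim Theta q v K) as [d1 [Hd1 [_ L1]]].
    destruct (L1 1 Rlt_0_1) as [d2 [Hd2 L2]].
    destruct (Theta_near_divisor t s' Ht Hs') as [B HB].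
    set (M := B + Cmod (Theta q) + 1).
    destruct (zeta_unbounded (M / Cmod (zeta s'))) as [d3 [Hd3 L3]].
    set (e := Rmin (Rmin d2 d3) 1 / 2).
    assert (Hm : 0 < Rmin (Rmin d2 d3) 1) by (repeat apply Rmin_pos; lra).
    Rmin_bounds.
    assert (He : 0 < e < Rmin (Rmin d2 d3) 1) by (unfold e; lra).
    specialize (L2 e ltac:(lra)). specialize (L3 e ltac:(lra)). specialize (HB e ltac:(lra)).
    assert (Lv : line q v (RtoC e) = ((RtoC (INR (1 - t) + e), s'), RtoC (INR t))).
    { change (line q v (RtoC e)) with ((RtoC (INR (1 - t)) + RtoC e * RtoC 1, s' + RtoC e * RtoC 0), RtoC (INR t) + RtoC e * RtoC 0)%C.
      rewrite RtoC_plus. do 2 f_equal; try f_equal; ring. }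
    rewrite Lv in L2. set (Te := Theta (RtoC (INR (1 - t) + e), s', RtoC (INR t))) in *.
    assert (Bz : Cmod (zeta (RtoC (1 + e)) * zeta s') <= M).
    { replace (zeta (RtoC (1 + e)) * zeta s')%C with ((Te - Theta q) + Theta q - (Te - zeta (RtoC (1 + e)) * zeta s'))%C by ring.
      eapply Rle_trans. apply Cmod_triangle_minus.
      pose proof (Cmod_triangle (Te - Theta q) (Theta q)). unfold M. lra. }
    rewrite Cmod_mult in Bz. apply (Rmult_lt_compat_r (Cmod (zeta s'))) in L3; auto.
    replace (M / Cmod (zeta s') * Cmod (zeta s')) with M in L3 by (field; lra). lra. }
  assert (V : vanish_near (U := C_NormedModule) zeta s).
  { set (nv := norm v2). assert (Hnv : 0 <= nv) by apply norm_ge_0.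
    exists (Rmin (Re s - 1) (d / (nv + 1))). split. apply Rmin_pos. lra.
    apply Rdiv_lt_0_compat; lra.
    intros s' Hs'. change (Cmod (s' - s) < Rmin (Re s - 1) (d / (nv + 1))) in Hs'.
    Rmin_bounds.
    apply Zero.
    - pose proof (re_le_Cmod (s' - s)) as Q. change (Re (s' - s)) with (Re s' - Re s) in Q.
      assert (Q2 : Rabs (Re s' - Re s) < Re s - 1) by lra. apply Rabs_lt_between in Q2. lra.
    - apply (eq_ind (line p v2 (s' - s)%C) (fun q : C3 => ndist p q < d)).
      + eapply Rle_lt_trans. apply ndist_line. fold nv.
        assert (Q : Cmod (s' - s) < d / (nv + 1)) by lra.
        apply (Rmult_lt_compat_r (nv + 1)) in Q; [|lra].
        replace (d / (nv + 1) * (nv + 1)) with d in Q by (field; lra).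
        pose proof (Cmod_ge_0 (s' - s)). lra.
      + change (line p v2 (s' - s)%C) with ((RtoC (INR (1 - t)) + (s' - s) * RtoC 0, s + (s' - s) * RtoC 1), RtoC (INR t) + (s' - s) * RtoC 0)%C.
        do 2 f_equal; try f_equal; ring. }
  (* The zeros spread through the half-plane [Re z > 1] to the point 2, where the first term of the
     series alone is 1. *)
  assert (V2 : vanish_near (U := C_NormedModule) zeta (RtoC 2)).
  { apply (vanish_global (U := C_NormedModule) (fun z => 1 < Re z) zeta s (RtoC 2)); auto.
    - intros u Hu. change (1 < Re (s + RtoC u * (RtoC 2 - s))%C).
      replace (Re (s + RtoC u * (RtoC 2 - s))%C) with (Re s + u * (2 - Re s)) by (destruct s; simpl; ring).
      apply convex_lt; lra.
    - intros z Hz. apply holomorphic_lhol_at. destruct Hzeta as [H1 _]. apply H1. intros Q.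
      rewrite Q in Hz. simpl in Hz. lra. }
  destruct V2 as [r [Hr V2]].
  assert (Z : zeta (RtoC 2) = 0) by (apply V2; rewrite ndist_refl; auto).
  pose proof (zeta_real_ge 2 0 ltac:(lra)) as Q. rewrite Z, Cmod_0, sum_O in Q.
  pose proof (exp_pos (- (2) * ln (INR 1))). unfold Rpower in Q. lra.
Qed.

(** * The formula at integer exponents *)

Lemma Theta_integer (r t : nat) (s : C) :
  (1 <= r + t)%nat -> 2 - INR r - INR t < Re s ->
  holomorphic_at Theta (RtoC (INR r), s, RtoC (INR t)) ->
  Theta (RtoC (INR r), s, RtoC (INR t)) =
   (csum (r - 1) (fun i : nat =>
      RtoC ((-1) ^ i / x ^ (t + i) * multichoose t i)
      * zeta (s + RtoC (INR t) + RtoC (INR i))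
      * zeta (RtoC (INR r) - RtoC (INR i)))
    - RtoC ((-1) ^ r / x ^ (r + t - 1) * last_coef r t)
      * CSeries (digamma_term x (RtoC (INR r) + s + RtoC (INR t) - RtoC 1))
    + RtoC ((-1) ^ r)
      * csum (t - 1) (fun j : nat =>
          RtoC (multichoose r j
                * ((-1) ^ (t - j) / INR (Factorial.fact (t - j - 1)))
                * (1 / x ^ (j + r)))
          * CSeries (polygamma_term x (t - j - 1)
                       (RtoC (INR r) + s + RtoC (INR j)))))%C.
Proof.
  intros Hrt Hs Hol.
  destruct (Nat.eq_dec (r + t) 1) as [E1|N1].
  (* For [r + t = 1] the hypothesis reads [Re s > 1], and holomorphy there is contradictory. *)
  { exfalso. replace r with (1 - t)%nat in Hol by lia. apply (Theta_not_holomorphic t s); auto. lia.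
    assert (Q : INR r + INR t = 1) by (rewrite <- plus_INR, E1; reflexivity). lra. }
  pose proof (eterm_integer_iter x r t s Hx ltac:(lia) Hs) as I.
  destruct (Compare_dec.le_lt_dec 2 r) as [Hr|Hr].
  - rewrite Theta_integer_ext by auto. unfold theta_ext, polar_sum, no_mask.
    rewrite (is_iter_CSeries _ _ I). unfold Cminus. rewrite <- !Cplus_assoc. f_equal.
    + apply csum_ext. intros i Hi. rewrite negbinom_INR. f_equal. f_equal.
      replace (- RtoC (INR t) + - RtoC (INR i))%C with (- RtoC (INR (t + i)))%C by (rewrite plus_INR, RtoC_plus; ring).
      rewrite cpow_opp, cpow_INR, <- RtoC_inv, <- RtoC_mult by (try apply pow_nonzero; lra).
      f_equal. unfold Rdiv. ring.
    + f_equal. ring.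
  - replace (r - 1)%nat with 0%nat in * by lia. rewrite csum_0.
    assert (Q : 2 <= INR r + INR t) by (rewrite <- plus_INR; apply (le_INR 2); lia).
    assert (Q1 : INR r <= 1) by (apply (le_INR r 1); lia).
    rewrite (is_iter_unique _ _ _ (Theta_iter (RtoC (INR r)) s (RtoC (INR t)) ltac:(simpl; lra)
      ltac:(destruct s; simpl in *; lra) ltac:(destruct s; simpl in *; lra)) I).
    ring.
Qed.
End Zeta.

Theorem theorem4p2 :
  forall (x : R) (zeta : C -> C) (Theta : C * C * C -> C),
  0 < x -> is_riemann_zeta zeta -> is_mordell_tornheim x Theta ->
  forall (r t : nat) (s : C),
  (1 <= r + t)%nat -> 2 - INR r - INR t < Re s ->
  ex_Cseries (digamma_term x (RtoC (INR r) + s + RtoC (INR t) - RtoC 1)%C) /\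
  (forall j : nat, (j + 2 <= t)%nat ->
     ex_Cseries (polygamma_term x (t - j - 1) (RtoC (INR r) + s + RtoC (INR j))%C)) /\
  (holomorphic_at Theta (RtoC (INR r), s, RtoC (INR t)) ->
   Theta (RtoC (INR r), s, RtoC (INR t)) =
   (csum (r - 1) (fun i : nat =>
      RtoC ((-1) ^ i / x ^ (t + i)
            * binom (Z.of_nat i + Z.of_nat t - 1) (Z.of_nat i))
      * zeta (s + RtoC (INR t) + RtoC (INR i))
      * zeta (RtoC (INR r) - RtoC (INR i)))
    - RtoC ((-1) ^ r / x ^ (r + t - 1)
            * binom (Z.of_nat r + Z.of_nat t - 2) (Z.of_nat t - 1))
      * CSeries (digamma_term x (RtoC (INR r) + s + RtoC (INR t) - RtoC 1))
    + RtoC ((-1) ^ r)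
      * csum (t - 1) (fun j : nat =>
          RtoC (binom (Z.of_nat j + Z.of_nat r - 1) (Z.of_nat j)
                * ((-1) ^ (t - j) / INR (Factorial.fact (t - j - 1)))
                * (1 / x ^ (j + r)))
          * CSeries (polygamma_term x (t - j - 1)
                       (RtoC (INR r) + s + RtoC (INR j)))))%C).
Proof.
  intros x zeta Theta Hx Hzeta HTheta r t s Hrt Hs.
  destruct (series_existence x r t s Hx Hrt Hs) as [E1 E2].
  split; [exact E1|]. split; [exact E2|]. intros Hol.
  exact (Theta_integer zeta Hzeta x Hx Theta HTheta r t s Hrt Hs Hol).
Qed.
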